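(* Consider the stochastic system $$dx(t)=[f(x(t))+G(x(t))u(t)]\,dt+\Gamma(x(t))\,dw(t),\qquad x(0)=x_0,\quad t\ge 0,$$ (the additive control terms $Bu$ and $M(u)$ of the general system class being zero: $B=0$ and $M_j=0$ for all $j\in\{1,\dots,q\}$). Assume that the vector $\tilde u$ of multiplicative controls is deterministic and satisfies $\|\tilde u\|_{L^2}^2:=\int_0^\infty\|\tilde u(t)\|^2dt<\infty$. Let $X\in\mathbb R^{n\times n}$ be positive definite and $V_X(x)=x^\top Xx$. If there are $\lambda>0$ and $\delta>0$ such that $$LV_X(x,0;\delta)\le-\lambda V_X(x)\qquad\text{for all }x\in\mathbb R^n,$$ then there is a constant $k>0$ such that $$\mathbb E\|x(t)\|^2\le k\,e^{(\|\tilde u\|_{L^2}/\delta)^2}\,\|x_0\|^2\,e^{-\lambda t}$$ for all $t\ge0$ and all initial values $x_0\in\mathbb R^n$.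
   Context: Setting: $(\Omega,\mathcal F,(\mathcal F_t)_{t\ge0},\mathbb P)$ is a filtered probability space with right-continuous, complete filtration. $w=(w_1,\dots,w_q)^\top$ is an $\mathbb R^q$-valued, $(\mathcal F_t)$-adapted Wiener process whose increments $w(t+h)-w(t)$ are independent of $\mathcal F_t$ for $t,h\ge0$, with $\mathbb E[w(t)w(t)^\top]=Kt$, $K=(k_{ij})_{i,j=1,\dots,q}$. $G(x)=[g_1(x)\ \cdots\ g_m(x)]$ and $\Gamma(x)=[\gamma_1(x)\ \cdots\ \gamma_q(x)]$, where $f,g_i,\gamma_j:\mathbb R^n\to\mathbb R^n$ satisfy $f(0)=g_i(0)=\gamma_j(0)=0$, each $g_i$ is either identically zero or non-constant, and the functions are regular enough (e.g. locally Lipschitz with a growth condition) that the state equation has a unique global solution. The control $u=(u_1,\dots,u_m)^\top$ is $\mathbb R^m$-valued, $(\mathcal F_t)$-adapted, and satisfies $\mathbb E\int_0^T\|u(t)\|^2dt<\infty$ for every $T>0$. $\|\cdot\|$ is the Euclidean norm, $\langle\cdot,\cdot\rangle$ the Euclidean inner product, $\|\cdot\|_F$ the Frobenius norm. Positive (semi)definite matrices are symmetric. Multiplicative controls: $\tilde u=(\tilde u_1,\dots,\tilde u_m)^\top$ with $\tilde u_i\equiv0$ if $g_i\equiv0$ and $\tilde u_i=u_i$ otherwise. Lyapunov operator on quadratic forms: for positive semidefinite $X\in\mathbb R^{n\times n}$, $\delta>0$ and $x,y\in\mathbb R^n$, $$LV_X(x,y;\delta)=2\langle x-y,X(f(x)-f(y))\rangle+\delta^2\|X^{1/2}(G(x)-G(y))\|_F^2+\|X^{1/2}(\Gamma(x)-\Gamma(y))K^{1/2}\|_F^2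 .$$ *)

(* Defs.v *)
From HB Require Import structures.
From mathcomp Require Import all_boot all_order all_algebra.
From mathcomp Require Import all_classical all_reals all_analysis.
From mathcomp Require Import measurable_realfun.

Set Implicit Arguments.
Unset Strict Implicit.
Unset Printing Implicit Defensive.

Import Order.TTheory GRing.Theory Num.Theory.
Import numFieldNormedType.Exports.

Local Open Scope classical_set_scope.
Local Open Scope ring_scope.

Section LinearAlgebra.
Context {R : realType}.

Definition dotv {n} (x y : 'cV[R]_n) : R := (x^T *m y) 0 0.

(* The library norm on matrices is the max norm, hence this one. *)
Definition enorm {n} (x : 'cV[R]_n) : R := Num.sqrt (dotv x x).

Definition frobenius {m n} (A : 'M[R]_(m, n)) : R :=
  Num.sqrt (\sum_i \sum_j A i j ^+ 2).

Definition possemidef {n} (A : 'M[R]_n) : Prop :=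
  A^T = A /\ forall x : 'cV[R]_n, 0 <= dotv x (A *m x).

Definition posdef {n} (A : 'M[R]_n) : Prop :=
  A^T = A /\ forall x : 'cV[R]_n, x != 0 -> 0 < dotv x (A *m x).

(* The positive semidefinite square root; it exists and is unique when A is
   positive semidefinite, and the value is irrelevant otherwise. *)
Definition msqrt {n} (A : 'M[R]_n) : 'M[R]_n :=
  xget 0 [set S : 'M[R]_n | possemidef S /\ S *m S = A].

Definition cols {n m} (g : 'I_m -> 'cV[R]_n -> 'cV[R]_n) (x : 'cV[R]_n) :
  'M[R]_(n, m) := \matrix_(i, j) g j x i 0.

Definition quadV {n} (X : 'M[R]_n) (x : 'cV[R]_n) : R := dotv x (X *m x).

Definition LV {n m q} (f : 'cV[R]_n -> 'cV[R]_n)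
    (g : 'I_m -> 'cV[R]_n -> 'cV[R]_n) (gamma : 'I_q -> 'cV[R]_n -> 'cV[R]_n)
    (K : 'M[R]_q) (X : 'M[R]_n) (x y : 'cV[R]_n) (delta : R) : R :=
  2 * dotv (x - y) (X *m (f x - f y))
  + delta ^+ 2 * frobenius (msqrt X *m (cols g x - cols g y)) ^+ 2
  + frobenius (msqrt X *m (cols gamma x - cols gamma y) *m msqrt K) ^+ 2.

(* The product sigma-algebra on R^n, i.e. its Borel sigma-algebra. *)
Definition borel_cV n : set (set 'cV[R]_n) :=
  g_sigma_preimage (fun (i : 'I_n) (x : 'cV[R]_n) => x i 0).

Definition borel_fun {n p} (f : 'cV[R]_n -> 'cV[R]_p) : Prop :=
  forall B, @borel_cV p B -> @borel_cV n (f @^-1` B).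

End LinearAlgebra.

Section Processes.
Context {R : realType} {d : measure_display} {Omega : measurableType d}.
Variables (P : probability Omega R) (F : R -> set (set Omega)).

Local Notation mu := (@lebesgue_measure R).

(* Time is [0, +oo[: filtrations and processes are indexed by R, but only
   their values at nonnegative times are ever used. *)

Definition usual_filtration : Prop :=
  [/\ forall t : R, 0 <= t -> sigma_algebra setT (F t),
      forall t : R, 0 <= t -> F t `<=` measurable,
      forall s t : R, 0 <= s -> s <= t -> F s `<=` F t,
      forall t : R, 0 <= t -> \bigcap_(s in [set s | t < s]) F s `<=` F t
    & P.-negligible `<=` F 0].

Definition Fmeasurable (t : R) (Y : Omega -> R) : Prop :=
  forall B : set R, measurable B -> F t (Y @^-1` B).

Definition adapted (Y : R -> Omega -> R) : Prop :=
  forall t : R, 0 <= t -> Fmeasurable t (Y t).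

Definition adapted_cV {n} (Y : R -> Omega -> 'cV[R]_n) : Prop :=
  forall i, adapted (fun t omega => Y t omega i 0).

Definition continuous_paths {n} (Y : R -> Omega -> 'cV[R]_n) : Prop :=
  {ae P, forall omega, {within `[0, +oo[, continuous (Y ^~ omega)}}.

(* N(0, v); for v = 0 the library's [normal_prob 0 0] is not the Dirac mass
   but the uniform law on [0, 1]. *)
Definition centered_normal (v : R) (B : set R) : \bar R :=
  if v == 0 then (\d_(0%R : R) B)%E else normal_prob 0 (Num.sqrt v) B.

(* Centered Gaussian vectors are those whose linear forms are all centered
   Gaussian, whence the covariance h K of w (t + h) - w t. *)
Definition wiener_process {q} (K : 'M[R]_q) (w : R -> Omega -> 'cV[R]_q) :
    Prop :=
  [/\ possemidef K,
      adapted_cV w,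
      {ae P, forall omega, w 0 omega = 0},
      continuous_paths w &
  [/\ forall t h : R, 0 <= t -> 0 <= h -> forall (c : 'cV[R]_q) (B : set R),
        measurable B ->
        P [set omega | B (dotv c (w (t + h) omega - w t omega))]
          = centered_normal (h * dotv c (K *m c)) B,
      forall t : R, 0 <= t -> forall i j : 'I_q,
        ('E_P[fun omega => (w t omega i 0 * w t omega j 0)%R]
           = (K i j * t)%:E)%E
    & forall t h : R, 0 <= t -> 0 <= h -> forall A B,
        F t A ->
        g_sigma_preimage
          (fun (j : 'I_q) omega => w (t + h) omega j 0 - w t omega j 0) B ->
        P (A `&` B) = (P A * P B)%E]].

Definition admissible_control {m} (u : R -> Omega -> 'cV[R]_m) : Prop :=
  [/\ adapted_cV u,
      forall i : 'I_m, measurable_fun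
        ([set z | 0 <= z.1] : set (R * Omega)%type) (fun z => u z.1 z.2 i 0)
    & forall T : R, 0 < T ->
        (\int[P]_omega \int[mu]_(t in `[0%R, T]) (enorm (u t omega) ^+ 2)%:E
          < +oo)%E].

Definition mult_control {n m} (g : 'I_m -> 'cV[R]_n -> 'cV[R]_n)
    (u : R -> Omega -> 'cV[R]_m) (t : R) (omega : Omega) : 'cV[R]_m :=
  \col_i if `[< forall x, g i x = 0 >] then 0 else u t omega i 0.

Definition L2normsq {m} (v : R -> 'cV[R]_m) : \bar R :=
  (\int[mu]_(t in `[0%R, +oo[) (enorm (v t) ^+ 2)%:E)%E.

Definition L2norm {m} (v : R -> 'cV[R]_m) : R := Num.sqrt (fine (L2normsq v)).

Definition cvg_probability0 (Y : nat -> Omega -> \bar R) : Prop :=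
  (forall k, measurable_fun setT (Y k)) /\
  forall eps : R, 0 < eps ->
    (fun k => P [set omega | (eps%:E <= `|Y k omega|)%E]) @ \oo --> 0%E.

(* Elementary integrands
   s |-> \sum_(i < sp_size) sp_val i * 1_(]sp_time i, sp_time i.+1])(s). *)
Record simple_process := SimpleProcess {
  sp_size : nat;
  sp_time : nat -> R;
  sp_val : nat -> Omega -> R;
  sp_time_ge0 : forall i, 0 <= sp_time i;
  sp_time_nondecreasing : forall i, sp_time i <= sp_time i.+1;
  sp_val_measurable : forall i, Fmeasurable (sp_time i) (sp_val i);
  sp_val_bounded : exists C, forall i omega, `|sp_val i omega| <= C }.

Definition sp_eval (S : simple_process) (s : R) (omega : Omega) : R :=
  \sum_(i < sp_size S)
    sp_val S i omega * \1_(`]sp_time S i, sp_time S i.+1]) s.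

Definition sp_integral (S : simple_process) (b : R -> Omega -> R) (t : R)
    (omega : Omega) : R :=
  \sum_(i < sp_size S) sp_val S i omega *
    (b (Num.min (sp_time S i.+1) t) omega - b (Num.min (sp_time S i) t) omega).

(* I is (a version of) the Ito integral of H over [0, t] against the scalar
   Wiener process b: H is adapted with almost surely square-integrable paths,
   and I is the limit in probability of the integrals of elementary integrands
   S k such that the integral of |S k - H|^2 over [0, t] tends to 0 in
   probability. *)
Definition is_ito_integral (b H : R -> Omega -> R) (t : R) (I : Omega -> R) :
    Prop :=
  [/\ adapted H,
      {ae P, forall omega, measurable_fun `[0, t] (H ^~ omega) /\
        (\int[mu]_(s in `[0%R, t]) (H s omega ^+ 2)%:E < +oo)%E}
    & exists S : nat -> simple_process,
        cvg_probability0 (fun k omega =>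
          \int[mu]_(s in `[0%R, t])
            ((sp_eval (S k) s omega - H s omega) ^+ 2)%:E)%E /\
        cvg_probability0 (fun k omega =>
          (sp_integral (S k) b t omega - I omega)%:E)].

Section SDE.
Context {n m q : nat}.
Variables (f : 'cV[R]_n -> 'cV[R]_n) (g : 'I_m -> 'cV[R]_n -> 'cV[R]_n).
Variables (gamma : 'I_q -> 'cV[R]_n -> 'cV[R]_n) (w : R -> Omega -> 'cV[R]_q).

Definition drift (u : R -> Omega -> 'cV[R]_m) (x : R -> Omega -> 'cV[R]_n)
    (t : R) (omega : Omega) : 'cV[R]_n :=
  f (x t omega) + cols g (x t omega) *m u t omega.

(* x is a global (strong) solution of
   dx = [f(x) + G(x) u] dt + Gamma(x) dw,  x(0) = x0,
   J t i j being the integral of gamma_j(x)_i against w_j over [0, t]. *)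
Definition sde_solution (u : R -> Omega -> 'cV[R]_m) (x0 : 'cV[R]_n)
    (x : R -> Omega -> 'cV[R]_n) : Prop :=
  [/\ adapted_cV x,
      continuous_paths x,
      {ae P, forall omega, forall t : R, 0 <= t -> forall i,
        mu.-integrable `[0, t] (fun s => (drift u x s omega i 0)%:E)}
    & exists J : R -> 'I_n -> 'I_q -> Omega -> R,
        (forall t : R, 0 <= t -> forall i j,
          is_ito_integral (fun s omega => w s omega j 0)
            (fun s omega => cols gamma (x s omega) i j) t (J t i j)) /\
        (forall t : R, 0 <= t -> {ae P, forall omega, forall i,
          x t omega i 0 = x0 i 0
            + (\int[mu]_(s in `[0, t]) drift u x s omega i 0)
            + \sum_j J t i j omega})].

Definition unique_global_solution (u : R -> Omega -> 'cV[R]_m) : Prop :=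
  forall x0 : 'cV[R]_n,
    (exists x, sde_solution u x0 x) /\
    (forall x y, sde_solution u x0 x -> sde_solution u x0 y ->
      {ae P, forall omega, forall t : R, 0 <= t -> x t omega = y t omega}).

End SDE.

End Processes.

(* Main.v *)
Require Import Defs.
From HB Require Import structures.
From mathcomp Require Import all_boot all_order all_algebra.
From mathcomp Require Import all_classical all_reals all_analysis.
From mathcomp Require Import measurable_realfun.
From mathcomp Require Import ring lra.
From mathcomp Require complex.

Set Implicit Arguments.
Unset Strict Implicit.
Unset Printing Implicit Defensive.

Import Order.TTheory GRing.Theory Num.Theory.
Import numFieldNormedType.Exports.
Local Open Scope classical_set_scope.
Local Open Scope ring_scope.

(** Let S be the positive definite square root of X, so that V_X(x) = |S x|^2.
    The deterministic control v may replace u in the drift, because the two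
    differ only in components that multiply a zero column of G. Young's
    inequality 2 z v h <= delta^2 h^2 + z^2 v^2 / delta^2 applied to
    2 <S x, S G(x) v> then turns the hypothesis on the Lyapunov operator into
    the pointwise bound ([drift_bound])

      2 <S x, S (f(x) + G(x) v)> + |S Gamma(x) K^(1/2)|^2
        <= (- lambda + |v|^2 / delta^2) V_X(x),

    whose left-hand side is the drift of V_X(x(t)) in Ito's formula. Taking
    expectations, Gronwall's inequality gives

      E V_X(x(t)) <= V_X(x_0) exp (|v|_{L^2}^2 / delta^2 - lambda t),

    the control contributing its total energy once and for all because it is
    deterministic. Comparing V_X with |x|^2 on both sides yields the constant k.

    The stochastic integral is only a local martingale, so a localization is
    needed. The solution is first modified on a null set so that all its path
    properties hold everywhere. The clock C_t is the integral over [0, t] of the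
    size of the drift and of the squared diffusion coefficients; it is adapted,
    continuous and nondecreasing. In place of stopping times, every quantity at
    time t is multiplied by the indicator B_t that C_t <= N. In a second moment
    E[B_T Y^2] this indicator may be dropped for an upper bound, which makes the
    martingale property available; so Ito's formula for squares is obtained as
    an inequality ([energy_inequality_lost], [energy_cut]), in the direction
    that an upper bound of the second moment requires.

    That inequality is proved from the definition of the stochastic integral as
    a limit in probability of integrals of simple processes. The simple
    processes are refined and truncated with the clock, which bounds their
    energy on every path; hence their convergence to B H holds in mean square
    ([ito_trunc]), and by the isometry and Fatou's lemma one sequence serves all
    times r <= T ([approx_all]). If zeta is a coordinate of S x, A the part of
    its drift retained by a bounded cut-off, and W the martingale part for
    the k-th approximations, then the square of B_s zeta_s + A_T + W_T expands
    into terms known from the isometry ([W_energy]) and the martingale property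
    ([AW_cvg]), while A_T^2 is a double integral over a triangle
    ([sqr_integral]).

    Summed over the coordinates and with the cut-off removed, this yields
    m(t) <= m(s) + int_s^t (- lambda + |v|^2 / delta^2) m for
    m(t) = E[B_t V_X(x(t))] ([mean_V_step]), hence the bound for m by
    [gronwall], and N -> oo concludes ([lyapunov_decay]). *)

(** * Real-valued integrals, mean-square and stochastic convergence *)

Lemma cvg0_squeeze (R : realType) (a b : nat -> R) :
  (forall k, `|a k| <= b k) -> b @ \oo --> (0 : R) -> a @ \oo --> (0 : R).
Proof.
move=> ab b0; apply: (@squeeze_cvgr _ _ _ _ (fun k => - b k) b) => //.
  by near=> k; rewrite -ler_norml.
by rewrite -oppr0; exact: cvgN.
Unshelve. all: by end_near. Qed.

Lemma sqrD_le (R : realDomainType) (a b : R) :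
  (a + b) ^+ 2 <= 2 * (a ^+ 2 + b ^+ 2).
Proof. by have := sqr_ge0 (a - b); lra. Qed.

Section integrable_functions.
Context {d} {T : measurableType d} {R : realType}.
Variable m : {measure set T -> \bar R}.
Implicit Types f g h : T -> R.

(** Integrability over the whole space of a real-valued function. The lemmas on
    int1 and on real-valued integrals, named E_ after expectations, keep the
    extended reals out of the computations below. *)
Definition int1 f := m.-integrable setT (EFin \o f).

Lemma int1_measurable f : int1 f -> measurable_fun setT f.
Proof. by move=> /integrableP[/measurable_EFinP]. Qed.

Lemma int1_le f g : measurable_fun setT f -> int1 g ->
  (forall x, `|f x| <= g x) -> int1 f.
Proof.
move=> mf ig fg; apply: (le_integrable _ _ _ ig) => //.
  exact/measurable_EFinP.
by move=> x _ /=; rewrite lee_fin (le_trans (fg x))// ler_norm.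
Qed.

Lemma int1D f g : int1 f -> int1 g -> int1 (fun x => f x + g x).
Proof. by move=> /[dup] _ fi gi; exact: (integrableD measurableT fi gi). Qed.

Lemma int1B f g : int1 f -> int1 g -> int1 (fun x => f x - g x).
Proof. by move=> fi gi; exact: (integrableB measurableT fi gi). Qed.

Lemma int1Z c f : int1 f -> int1 (fun x => c * f x).
Proof. by move=> fi; exact: (integrableZl measurableT c fi). Qed.

Lemma int10 : int1 (fun=> 0).
Proof. exact: integrable0. Qed.

Lemma int1_sum I (r : seq I) (F : I -> T -> R) :
  (forall i, int1 (F i)) -> int1 (fun x => \sum_(i <- r) F i x).
Proof.
move=> iF; elim: r => [|i r IH].
  by rewrite (_ : (fun _ => _) = fun=> 0); [exact: int10|apply/funext => x; rewrite big_nil].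
rewrite (_ : (fun _ => _) = fun x => F i x + \sum_(j <- r) F j x).
  exact: int1D.
by apply/funext => x; rewrite big_cons.
Qed.

Lemma int1_norm f : int1 f -> int1 (fun x => `|f x|).
Proof. by move=> fi; exact: (integrable_norm fi). Qed.

Lemma ED f g : int1 f -> int1 g ->
  \int[m]_x (f x + g x) = \int[m]_x f x + \int[m]_x g x.
Proof. exact: RintegralD. Qed.

Lemma EB f g : int1 f -> int1 g ->
  \int[m]_x (f x - g x) = \int[m]_x f x - \int[m]_x g x.
Proof. exact: RintegralB. Qed.

Lemma EZ c f : int1 f -> \int[m]_x (c * f x) = c * \int[m]_x f x.
Proof. exact: RintegralZl. Qed.

Lemma eqE f g : f =1 g -> \int[m]_x f x = \int[m]_x g x.
Proof. by move=> fg; apply: eq_Rintegral => x _; exact: fg. Qed.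

Lemma E0 : \int[m]_x (0 : R) = 0.
Proof. by rewrite /Rintegral integral0. Qed.

Lemma E_sum I (r : seq I) (F : I -> T -> R) : (forall i, int1 (F i)) ->
  \int[m]_x (\sum_(i <- r) F i x) = \sum_(i <- r) \int[m]_x F i x.
Proof.
move=> iF; elim: r => [|i r IH].
  by rewrite big_nil -[RHS]E0; apply: eqE => x; rewrite big_nil.
rewrite big_cons -IH -ED//; last exact: int1_sum.
by apply: eqE => x; rewrite big_cons.
Qed.

Lemma E_le f g : int1 f -> int1 g -> (forall x, f x <= g x) ->
  \int[m]_x f x <= \int[m]_x g x.
Proof. by move=> fi gi fg; apply: le_Rintegral. Qed.

Lemma E_ge0 f : (forall x, 0 <= f x) -> 0 <= \int[m]_x f x.
Proof. by move=> f0; apply: Rintegral_ge0. Qed.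

Lemma E_fin f : int1 f -> (\int[m]_x (f x)%:E)%E = (\int[m]_x f x)%:E.
Proof. by move=> fi; rewrite /Rintegral fineK//; exact: integrable_fin_num fi. Qed.

Lemma E_norm f : int1 f -> `|\int[m]_x f x| <= \int[m]_x `|f x|.
Proof. by move=> fi; exact: le_normr_Rintegral. Qed.

Lemma int1_ge0 f : measurable_fun setT f -> (forall x, 0 <= f x) ->
  (\int[m]_x (f x)%:E < +oo)%E -> int1 f.
Proof.
move=> mf f0 fi; apply/integrableP; split; first exact/measurable_EFinP.
by under eq_integral do rewrite /= ger0_norm//.
Qed.

Lemma int1_ae_eq f g : measurable_fun setT g -> {ae m, forall x, f x = g x} ->
  int1 f -> int1 g.
Proof.
move=> mg fg /integrableP[mf fi]; apply/integrableP; split.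
  exact/measurable_EFinP.
suff <- : (\int[m]_x `|(f x)%:E| = \int[m]_x `|(g x)%:E|)%E by [].
apply: ae_eq_integral => //.
- exact: measurableT_comp.
- by apply: measurableT_comp => //; exact/measurable_EFinP.
- by apply: filterS fg => x /= -> _.
Qed.

Lemma E_ae_eq f g : measurable_fun setT f -> measurable_fun setT g ->
  {ae m, forall x, f x = g x} -> \int[m]_x f x = \int[m]_x g x.
Proof.
move=> mf mg fg; congr fine; apply: ae_eq_integral => //.
- exact/measurable_EFinP.
- exact/measurable_EFinP.
- by apply: filterS fg => x /= -> _.
Qed.

Definition sqint f := measurable_fun setT f /\ int1 (fun x => f x ^+ 2).

Lemma measurable_sqr f : measurable_fun setT f ->
  measurable_fun setT (fun x => f x ^+ 2).
Proof. by move=> mf; apply: measurable_funX. Qed.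

Lemma normM_le_sqr (a b : R) : `|a * b| <= a ^+ 2 + b ^+ 2.
Proof.
rewrite normrM -[a^+2]real_normK ?num_real// -[b^+2]real_normK ?num_real//.
have := normr_ge0 a; have := normr_ge0 b; move: `|a| `|b| => x y; nra.
Qed.

Lemma sqintM f g : sqint f -> sqint g -> int1 (fun x => f x * g x).
Proof.
move=> [mf f2] [mg g2]; apply: (int1_le _ (int1D f2 g2)).
  exact: measurable_funM.
by move=> x; exact: normM_le_sqr.
Qed.

Lemma sqintD f g : sqint f -> sqint g -> sqint (fun x => f x + g x).
Proof.
move=> [mf f2] [mg g2]; split; first exact: measurable_funD.
apply: (int1_le _ (int1Z 2 (int1D f2 g2))).
  by apply: measurable_sqr; exact: measurable_funD.
by move=> x; rewrite ger0_norm ?sqr_ge0// sqrD_le.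
Qed.

Lemma sqintZ c f : sqint f -> sqint (fun x => c * f x).
Proof.
move=> [mf f2]; split; first exact: measurable_funM.
rewrite (_ : (fun _ => _) = fun x => c ^+ 2 * f x ^+ 2); first exact: int1Z.
by apply/funext => x; rewrite exprMn.
Qed.

Lemma sqint0 : sqint (fun=> 0).
Proof.
split=> //; rewrite (_ : (fun _ => _) = fun=> 0); first exact: int10.
by apply/funext => x; rewrite expr0n.
Qed.

Lemma sqintB f g : sqint f -> sqint g -> sqint (fun x => f x - g x).
Proof.
move=> f2 g2; rewrite (_ : (fun _ => _) = fun x => f x + (-1) * g x).
  by apply: sqintD => //; exact: sqintZ.
by apply/funext => x; rewrite mulN1r.
Qed.

Lemma sqint_sum I (r : seq I) (F : I -> T -> R) :
  (forall i, sqint (F i)) -> sqint (fun x => \sum_(i <- r) F i x).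
Proof.
move=> iF; elim: r => [|i r IH].
  rewrite (_ : (fun _ => _) = fun=> 0); first exact: sqint0.
  by apply/funext => x; rewrite big_nil.
rewrite (_ : (fun _ => _) = fun x => F i x + \sum_(j <- r) F j x).
  exact: sqintD.
by apply/funext => x; rewrite big_cons.
Qed.

Lemma sqint_bdM f g c : measurable_fun setT f -> (forall x, `|f x| <= c) ->
  sqint g -> sqint (fun x => f x * g x).
Proof.
move=> mf fc [mg g2]; split; first exact: measurable_funM.
apply: (int1_le _ (int1Z (c ^+ 2) g2)).
  by apply: measurable_sqr; exact: measurable_funM.
move=> x; rewrite ger0_norm ?sqr_ge0// exprMn ler_wpM2r ?sqr_ge0//.
by rewrite -real_normK ?num_real// lerXn2r ?nnegrE// (le_trans _ (fc x)).
Qed.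

Lemma int1_bdM f g c : measurable_fun setT f -> (forall x, `|f x| <= c) ->
  int1 g -> int1 (fun x => f x * g x).
Proof.
move=> mf fc ig; have mg := int1_measurable ig.
apply: (int1_le _ (int1Z c (int1_norm ig))); first exact: measurable_funM.
by move=> x; rewrite normrM ler_wpM2r.
Qed.

(** Cauchy-Schwarz, from the nonnegativity of E (f + t g)^2 for every t. *)
Lemma E_CS f g : sqint f -> sqint g ->
  (\int[m]_x (f x * g x)) ^+ 2 <=
  (\int[m]_x (f x ^+ 2)) * \int[m]_x (g x ^+ 2).
Proof.
move=> f2 g2; set a := \int[m]_x _; set b := \int[m]_x _; set c := \int[m]_x _.
have fg := sqintM f2 g2.
have key t : 0 <= b + 2 * t * a + t ^+ 2 * c.
  have : 0 <= \int[m]_x ((f x + t * g x) ^+ 2) by apply: E_ge0 => x; exact: sqr_ge0.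
  rewrite (@eqE _ (fun x => (f x ^+ 2 + (2 * t) * (f x * g x)) + t ^+ 2 * (g x ^+ 2))).
    have i1 := f2.2; have i2 := int1Z (2 * t) fg.
    have i3 := int1Z (t ^+ 2) g2.2.
    by rewrite (ED (int1D i1 i2) i3) (ED i1 i2) (EZ _ fg) (EZ _ g2.2).
  by move=> x; ring.
have c0 : 0 <= c by apply: E_ge0 => x; exact: sqr_ge0.
have [c_eq0|cN0] := eqVneq c 0.
  have b0 : 0 <= b by apply: E_ge0 => x; exact: sqr_ge0.
  have [->|aN0] := eqVneq a 0; first by rewrite expr0n mulr_ge0.
  have := key (- (b + 1) / (2 * a)); rewrite c_eq0 mulr0 addr0.
  rewrite (_ : 2 * _ * a = - (b + 1)); last by field.
  by rewrite opprD addrA subrr add0r ler0N1.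
have := key (- a / c).
rewrite (_ : b + _ + _ = (b * c - a ^+ 2) / c); last by field.
have c_gt0 : 0 < c by rewrite lt_def cN0.
by rewrite pmulr_lge0 ?invr_gt0// subr_ge0.
Qed.

Lemma E_CS_norm f g : sqint f -> sqint g ->
  `|\int[m]_x (f x * g x)| <=
  Num.sqrt (\int[m]_x (f x ^+ 2)) * Num.sqrt (\int[m]_x (g x ^+ 2)).
Proof.
move=> f2 g2; rewrite -sqrtrM; last by apply: E_ge0 => x; exact: sqr_ge0.
by rewrite -sqrtr_sqr ler_wsqrtr// E_CS.
Qed.

Definition l2cvg (u : nat -> T -> R) f :=
  (fun k => \int[m]_x ((u k x - f x) ^+ 2)) @ \oo --> (0 : R).

(** Cauchy-Schwarz applied to uv - fg = (u - f)(v - g) + f(v - g) + (u - f)g. *)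
Lemma l2cvg_prod (u v : nat -> T -> R) f g :
  (forall k, sqint (u k)) -> (forall k, sqint (v k)) -> sqint f -> sqint g ->
  l2cvg u f -> l2cvg v g ->
  (fun k => \int[m]_x (u k x * v k x)) @ \oo --> \int[m]_x (f x * g x).
Proof.
move=> su sv sf sg uf vg.
have sub k : sqint (fun x => u k x - f x) by exact: sqintB.
have svb k : sqint (fun x => v k x - g x) by exact: sqintB.
set A := fun k => _.
have EA k : A k - \int[m]_x (f x * g x) =
    \int[m]_x ((u k x - f x) * (v k x - g x)) +
    (\int[m]_x (f x * (v k x - g x)) + \int[m]_x ((u k x - f x) * g x)).
  rewrite -EB; [|exact: sqintM|exact: sqintM].
  rewrite -ED; [|exact: sqintM|exact: sqintM].
  rewrite -ED; [|exact: sqintM|by apply: int1D; exact: sqintM].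
  by apply: eqE => x; ring.
set L := \int[m]_x _ in EA *.
pose nu k := Num.sqrt (\int[m]_x ((u k x - f x) ^+ 2)).
pose nv k := Num.sqrt (\int[m]_x ((v k x - g x) ^+ 2)).
pose nf := Num.sqrt (\int[m]_x (f x ^+ 2)).
pose ng := Num.sqrt (\int[m]_x (g x ^+ 2)).
have nu0 : nu @ \oo --> (0 : R).
  by rewrite -(sqrtr0 R); apply: continuous_cvg => //; exact: sqrt_continuous.
have nv0 : nv @ \oo --> (0 : R).
  by rewrite -(sqrtr0 R); apply: continuous_cvg => //; exact: sqrt_continuous.
suff : (fun k => A k - L) @ \oo --> (0 : R) by move/subr_cvg0.
apply: (@cvg0_squeeze _ _ (fun k => nu k * nv k + (nf * nv k + nu k * ng))) => [k|].
  rewrite EA (le_trans (ler_normD _ _))// lerD ?E_CS_norm//.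
  by rewrite (le_trans (ler_normD _ _))// lerD ?E_CS_norm.
rewrite [X in _ --> X](_ : _ = 0 * 0 + (nf * 0 + 0 * ng)); last by ring.
by apply: cvgD; [exact: cvgM|apply: cvgD; [exact: cvgMr|exact: cvgMl]].
Qed.

Lemma E_dct (u : nat -> T -> R) f g :
  (forall k, measurable_fun setT (u k)) -> measurable_fun setT f ->
  (forall x, u ^~ x @ \oo --> f x) -> int1 g ->
  (forall k x, `|u k x| <= g x) ->
  int1 f /\ (fun k => \int[m]_x u k x) @ \oo --> \int[m]_x f x.
Proof.
move=> mu mf uf ig ug.
have [] := @dominated_convergence _ _ _ m _ measurableT (fun k => EFin \o u k)
  (EFin \o f) (EFin \o g).
- by move=> k; exact/measurable_EFinP.
- exact/measurable_EFinP.
- by apply: aeW => x _; apply/cvg_EFin; [exact: nearW|exact: uf].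
- exact: ig.
- by apply: aeW => x k _ /=; rewrite lee_fin.
move=> fi _ /= lim; split=> //.
by apply: fine_cvg; rewrite -E_fin.
Qed.

Lemma E_dct0 (u : nat -> T -> R) g :
  (forall k, measurable_fun setT (u k)) ->
  (forall x, u ^~ x @ \oo --> (0 : R)) -> int1 g ->
  (forall k x, `|u k x| <= g x) ->
  (fun k => \int[m]_x u k x) @ \oo --> (0 : R).
Proof.
by move=> mu uf ig ug; have [] := E_dct mu (measurable_cst _) uf ig ug; rewrite E0.
Qed.

End integrable_functions.

Lemma measurable_le_indic {d} {T : measurableType d} {R : realType} (f : T -> R) (c : R) :
  measurable_fun setT f -> measurable_fun setT (fun x => (f x <= c)%R%:R : R).
Proof.
move=> mf; rewrite (_ : (fun _ => _) = \1_[set x | f x <= c]).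
  apply: measurable_indic; rewrite -[X in measurable X]setTI.
  have := mf measurableT `]-oo, c]%classic (measurable_itv _).
  by congr measurable; apply/seteqP; split=> x /=; rewrite in_itv.
apply/funext => x; rewrite indicE; congr (_ %:R); congr nat_of_bool.
by apply/idP/idP; rewrite ?inE.
Qed.

Section probability.
Context {d} {T : measurableType d} {R : realType}.
Variable P : probability T R.
Implicit Types f g h : T -> R.

Lemma sample_point : T.
Proof.
have : [set: T] !=set0.
  apply/set0P/eqP => h; have := @probability_setT _ _ _ P.
  by rewrite h measure0 => /eqP; rewrite eq_sym onee_eq0.
by move=> /cid[].
Qed.

Lemma int1_cst (c : R) : int1 P (fun=> c).
Proof. exact: finite_measure_integrable_cst. Qed.

Lemma E_cst (c : R) : \int[P]_x c = c.
Proof.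
transitivity (c * fine (P setT)); first exact: Rintegral_cst.
by rewrite probability_setT mulr1.
Qed.

Lemma int1_bounded f (c : R) : measurable_fun setT f -> (forall x, `|f x| <= c) ->
  int1 P f.
Proof. by move=> mf fc; apply: (int1_le mf (int1_cst c)). Qed.

Lemma sqint_bounded f (c : R) : measurable_fun setT f -> (forall x, `|f x| <= c) ->
  sqint P f.
Proof.
move=> mf fc; split=> //; apply: (@int1_bounded _ (c ^+ 2)).
  exact: measurable_sqr.
move=> x; rewrite normrX lerXn2r ?nnegrE//; exact: le_trans (fc x).
Qed.

Lemma sqint_int1 f : sqint P f -> int1 P f.
Proof.
move=> f2; rewrite (_ : f = fun x => f x * 1).
  by apply: sqintM => //; apply: (@sqint_bounded _ 1) => // x; rewrite normr1.
by apply/funext => x; rewrite mulr1.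
Qed.

Definition cvgP0 (Y : nat -> T -> R) := forall e : R, 0 < e ->
  (fun k => fine (P [set x | e <= `|Y k x|])) @ \oo --> (0 : R).

Lemma measurable_ge_norm f (e : R) : measurable_fun setT f ->
  measurable [set x | e <= `|f x|].
Proof.
move=> mf; rewrite -[X in measurable X]setTI.
have : measurable_fun setT (fun x => `|f x|) by exact: measurableT_comp.
move=> /(_ measurableT `[e, +oo[%classic) /(_ (measurable_itv _)).
by congr measurable; apply/seteqP; split=> x /=; rewrite in_itv/= andbT.
Qed.

Lemma E_indic (A : set T) : measurable A -> \int[P]_x (\1_A x) = fine (P A).
Proof. by move=> mA; rewrite /Rintegral integral_indic// setIT. Qed.

Lemma int1_indic (A : set T) : measurable A -> int1 P (\1_A : T -> R).
Proof.
move=> mA; apply: (@int1_bounded _ 1); first exact: measurable_indic.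
by move=> x; rewrite indicE; case: (x \in A); rewrite ?normr1 ?normr0.
Qed.

(** Fatou's lemma along convergence in probability, with a lossy factor 2
    that is harmless when the bound c tends to 0. *)
Lemma fatou_prob (Y : nat -> T -> R) f (c : R) :
  (forall k, sqint P (Y k)) -> measurable_fun setT f ->
  cvgP0 (fun k x => Y k x - f x) ->
  (\forall k \near \oo, \int[P]_x (Y k x ^+ 2) <= c) ->
  sqint P f /\ \int[P]_x (f x ^+ 2) <= 2 * c.
Proof.
move=> sY mf cv Yc.
pose tr (M : nat) x : R := Num.min (f x ^+ 2) M%:R.
have mtr M : measurable_fun setT (tr M).
  by apply: measurable_minr => //; exact: measurable_sqr.
have tr0 M x : 0 <= tr M x by rewrite le_min sqr_ge0/=.
have itr M : int1 P (tr M).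
  apply: (@int1_bounded _ M%:R) => // x.
  by rewrite ger0_norm// ge_min lexx orbT.
have bound M : \int[P]_x (tr M x) <= 2 * c.
  apply/ler_addgt0Pr => e e0.
  pose a := Num.sqrt (e / 2).
  have a0 : 0 < a by rewrite sqrtr_gt0 divr_gt0.
  have step k : \int[P]_x (tr M x) <= 2 * \int[P]_x (Y k x ^+ 2) + e +
      M%:R * fine (P [set x | a <= `|Y k x - f x|]).
    have mA : measurable [set x | a <= `|Y k x - f x|].
      by apply: measurable_ge_norm; apply: measurable_funB => //; exact: (sY k).1.
    have i1 := int1Z 2 (sY k).2.
    have i2 : int1 P (fun x => 2 * (Y k x ^+ 2) + e) by apply: int1D => //; exact: int1_cst.
    have i3 := int1Z (M%:R) (int1_indic mA).
    rewrite -(E_indic mA) -(EZ _ (int1_indic mA)) -[X in _ + X + _](E_cst e).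
    rewrite -(EZ _ (sY k).2) -(ED i1 (int1_cst e)) -(ED i2 i3).
    apply: E_le => //; first exact: int1D.
    move=> x; rewrite indicE; case: (boolP (x \in _)) => [_|].
      rewrite mulr1 /tr ge_min; apply/orP; right.
      by have := sqr_ge0 (Y k x); lra.
    rewrite notin_setE/= => /negP; rewrite -ltNge => lta.
    rewrite mulr0 addr0 /tr ge_min; apply/orP; left.
    have -> : f x = Y k x + - (Y k x - f x) by ring.
    rewrite (le_trans (sqrD_le _ _))// mulrDr lerD2l sqrrN.
    rewrite -[(_ - _) ^+ 2]real_normK ?num_real//.
    have : `|Y k x - f x| ^+ 2 <= a ^+ 2 by rewrite lerXn2r ?nnegrE// ltW.
    rewrite sqr_sqrtr; last by rewrite divr_ge0// ltW.
    by lra.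
  have lim : (fun k => 2 * c + e + M%:R * fine (P [set x | a <= `|Y k x - f x|]))
      @ \oo --> 2 * c + e.
    rewrite -[X in _ --> X]addr0; apply: cvgD; first exact: cvg_cst.
    by rewrite -(mulr0 M%:R); apply: cvgMr; exact: cv.
  rewrite -(cvg_lim _ lim)//; apply: limr_ge; first by apply/cvg_ex; eexists; exact: lim.
  near=> k; apply: (le_trans (step k)); rewrite !lerD2r ler_pM2l//.
  by near: k.
have f2 : (\int[P]_x (f x ^+ 2)%:E <= (2 * c)%:E)%E.
  have cvg : (fun M => \int[P]_x (tr M x)%:E)%E @ \oo --> (\int[P]_x (f x ^+ 2)%:E)%E.
    have -> : (\int[P]_x (f x ^+ 2)%:E = \int[P]_x (limn (fun M => (tr M x)%:E)))%E.
      apply: eq_integral => x _; apply/esym/cvg_lim => //.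
      apply: cvg_near_cst; near=> M; congr EFin; apply/min_idPl.
      by near: M; exact: nbhs_infty_ger.
    apply: cvg_monotone_convergence => //.
    - by move=> M; exact/measurable_EFinP.
    - by move=> M x _; rewrite lee_fin.
    - move=> x _ M N MN; rewrite lee_fin /tr le_min ge_min lexx/=.
      by rewrite ge_min ler_nat MN orbT.
  rewrite -(cvg_lim _ cvg)//; apply: lime_le; first by apply/cvg_ex; eexists; exact: cvg.
  by apply: nearW => M; rewrite E_fin// lee_fin.
have sf : sqint P f.
  split=> //; apply: int1_ge0 => //; first exact: measurable_sqr.
    by move=> x; exact: sqr_ge0.
  exact: le_lt_trans f2 (ltry _).
by split=> //; rewrite -lee_fin -E_fin//; exact: sf.2.
Unshelve. all: by end_near. Qed.

End probability.

(** * Matrix square roots and the Lyapunov inequality for the drift *)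

Section matrix_square_root.
Variable R : realType.

(** Newton's scheme: a multiple of the product of the linear factors already
    treated adjusts the value at one more node. *)
Lemma interpolating_poly (f : R -> R) (s : seq R) : uniq s ->
  exists p : {poly R}, {in s, forall x, p.[x] = f x}.
Proof.
elim: s => [|a s IH] /=; first by exists 0.
move=> /andP[as_ /IH[p ps]].
pose q := \prod_(b <- s) ('X - b%:P).
have qa : q.[a] != 0.
  rewrite horner_prod prodf_seq_neq0; apply/allP => b bs /=.
  by rewrite !hornerE subr_eq0; apply: contraNneq as_ => ->.
exists (p + ((f a - p.[a]) / q.[a]) *: q) => x; rewrite inE => /predU1P[->|xs].
  by rewrite !hornerE divfK// addrC subrK.
have qx : q.[x] = 0.
  by apply/eqP; rewrite -/(root q x) root_prod_XsubC.
by rewrite !hornerE qx mulr0 addr0 ps.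
Qed.

Lemma trmx_horner n (A : 'M[R]_n.+1) p : A^T = A ->
  (horner_mx A p)^T = horner_mx A p.
Proof.
move=> sA; elim/poly_ind: p => [|p c IH]; first by rewrite rmorph0 linear0.
rewrite rmorphD rmorphM /= horner_mx_X horner_mx_C linearD/= tr_scalar_mx.
rewrite [(_ * _)^T]trmx_mul IH sA; congr (_ + _).
transitivity (horner_mx A ('X * p)); first by rewrite rmorphM /= horner_mx_X.
by rewrite mulrC rmorphM /= horner_mx_X.
Qed.

Lemma mulmx_diagonalized (L : fieldType) n (A Q : 'M[L]_n) (d : 'rV[L]_n) :
  Q \in unitmx -> A = invmx Q *m diag_mx d *m Q -> Q *m A = diag_mx d *m Q.
Proof. by move=> Qu ->; rewrite !mulmxA mulmxV// mul1mx. Qed.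

(** A polynomial acts on a diagonalizable matrix through its eigenvalues. *)
Lemma horner_mx_fixed (L : fieldType) n (A Q : 'M[L]_n.+1) (d : 'rV[L]_n.+1) p :
  Q \in unitmx -> A = invmx Q *m diag_mx d *m Q -> (forall j, p.[d 0 j] = d 0 j) ->
  horner_mx A p = A.
Proof.
move=> Qu AE pd; rewrite [in LHS]AE [RHS]AE horner_mx_uconjC// horner_mx_diag.
congr (_ *m diag_mx _ *m _); apply/rowP => j; by rewrite mxE pd.
Qed.

Lemma dotvE n (x y : 'cV[R]_n) : dotv x y = \sum_i x i 0 * y i 0.
Proof. by rewrite /dotv mxE; apply: eq_bigr => i _; rewrite mxE. Qed.

Lemma dotv_sqr_ge0 n (x : 'cV[R]_n) : 0 <= dotv x x.
Proof. by rewrite dotvE sumr_ge0// => i _; rewrite -expr2 sqr_ge0. Qed.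

Lemma dotv_sqr_eq0 n (x : 'cV[R]_n) : dotv x x = 0 -> x = 0.
Proof.
move=> /eqP; rewrite dotvE psumr_eq0; last by move=> i _; rewrite -expr2 sqr_ge0.
move=> /allP h; apply/matrixP => i j; rewrite ord1 mxE.
by have := h i (mem_index_enum _); rewrite /= mulf_eq0 orbb => /eqP.
Qed.

Lemma dotv_mul n (A : 'M[R]_n) x y : dotv x (A *m y) = dotv (A^T *m x) y.
Proof. by rewrite /dotv trmx_mul trmxK mulmxA. Qed.

Import complex.

(** A positive semidefinite matrix is unitarily diagonalizable over the
    complexification, with real nonnegative eigenvalues. A real polynomial r
    interpolating the fourth root at these eigenvalues then yields the square
    root r(A)^2, which is symmetric and positive semidefinite by
    construction. *)
Lemma possemidef_sqrt_exists n (A : 'M[R]_n) : possemidef A ->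
  exists S, possemidef S /\ S *m S = A.
Proof.
case: n A => [|n] A [sA pA].
  exists 0; split; first split.
  - by rewrite trmx0.
  - by move=> x; rewrite mul0mx /dotv mulmx0 mxE.
  - by apply/matrixP => -[].
pose toC := real_complex R.
pose Ac := map_mx toC A.
have Ah : Ac \is hermsymmx.
  apply: realsym_hermsym.
    by apply/is_hermitianmxP; rewrite /= expr0 scale1r map_mx_id//; apply/matrixP => a b; rewrite !mxE -{1}sA mxE.
  by apply/mxOverP => i j; rewrite mxE; apply/complex_realP; eexists.
have Areal := hermitian_spectral_diag_real Ah.
have Adiag := orthomx_spectralP (hermitian_normalmx Ah).
have Punit := spectral_unit Ac.
set P := spectralmx Ac in Adiag Punit; set D := spectral_diag Ac in Areal Adiag.
have Dj j : exists2 c, D 0 j = toC c & 0 <= c.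
  have /complex_realP[c Dc] := mxOverP Areal 0 j.
  exists c => //.
  have : eigenvalue Ac (toC c).
    apply/eigenvalueP; exists (row j P); last first.
      apply/negP => /eqP rP0.
      have : delta_mx 0 j *m P *m invmx P = 0 :> 'rV_n.+1.
        by rewrite -rowE rP0 mul0mx.
      rewrite mulmxK// => /matrixP/(_ 0 j)/eqP.
      by rewrite !mxE !eqxx oner_eq0.
    have PA : P *m Ac = diag_mx D *m P by exact: mulmx_diagonalized Punit Adiag.
    by rewrite -row_mul PA row_mul row_diag_mx -scalemxAl -rowE Dc.
  rewrite eigenvalue_root_char /Ac -map_char_poly.
  rewrite fmorph_root -eigenvalue_root_char => /eigenvalueP[v vA v0].
  have := pA v^T; rewrite dotv_mul sA -[A]sA -trmx_mul vA.
  rewrite linearZ/= /dotv linearZ/= -scalemxAl mxE => h.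
  have vv : 0 < ((v^T)^T *m v^T) 0 0.
    rewrite lt_def; apply/andP; split; last exact: dotv_sqr_ge0.
    apply: contraNneq v0 => /dotv_sqr_eq0 /(congr1 trmx).
    by rewrite trmxK trmx0 => ->.
  by move: h; rewrite pmulr_lge0.
pose d j : R := sval (cid2 (Dj j)).
have dE j : D 0 j = toC (d j) by rewrite /d; case: cid2.
have d0 j : 0 <= d j by rewrite /d; case: cid2.
have [r rE] := interpolating_poly (fun x => Num.sqrt (Num.sqrt x)) (undup_uniq (codom d)).
have r4 j : r.[d j] ^+ 4 = d j.
  rewrite rE ?mem_undup ?codom_f// (exprM _ 2 2) sqr_sqrtr ?sqrtr_ge0//.
  by rewrite sqr_sqrtr.
pose N := horner_mx A r.
have NT : N^T = N by exact: trmx_horner.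
have N4 : N ^+ 4 = A.
  apply: (map_mx_inj (f := toC)); rewrite -/Ac.
  have NE : N ^+ 4 = horner_mx A (r ^+ 4) by rewrite rmorphXn.
  rewrite NE map_horner_mx -/Ac; apply: (horner_mx_fixed Punit Adiag) => j.
  by rewrite dE (horner_map toC) horner_exp r4.
exists (N *m N); split; last first.
  by rewrite -N4 (_ : N ^+ 4 = N *m (N *m (N *m N)))// !mulmxA.
split; first by rewrite trmx_mul NT.
move=> x; rewrite -mulmxA dotv_mul NT; exact: dotv_sqr_ge0.
Qed.

Lemma msqrtP n (A : 'M[R]_n) : possemidef A ->
  possemidef (msqrt A) /\ msqrt A *m msqrt A = A.
Proof.
by move=> /possemidef_sqrt_exists[S hS]; rewrite /msqrt; case: xgetP => [T _|/(_ S)].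
Qed.

End matrix_square_root.

Section lyapunov_bound.
Variable R : realType.

Lemma frobenius_sqr m n (A : 'M[R]_(m, n)) :
  frobenius A ^+ 2 = \sum_i \sum_j A i j ^+ 2.
Proof.
rewrite /frobenius sqr_sqrtr// sumr_ge0// => i _.
by rewrite sumr_ge0// => j _; exact: sqr_ge0.
Qed.

Lemma enorm_sqr n (x : 'cV[R]_n) : enorm x ^+ 2 = \sum_i x i 0 ^+ 2.
Proof.
rewrite /enorm sqr_sqrtr ?dotv_sqr_ge0// dotvE.
by apply: eq_bigr => i _; rewrite expr2.
Qed.

Lemma enorm_mulmx m n (A : 'M[R]_(m, n)) (x : 'cV[R]_n) :
  enorm (A *m x) ^+ 2 <= frobenius A ^+ 2 * enorm x ^+ 2.
Proof.
rewrite frobenius_sqr !enorm_sqr mulr_suml; apply: ler_sum => i _.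
rewrite mxE; set a := fun j => A i j; set b := fun j => x j 0.
have [B0|B_neq0] := eqVneq (\sum_j b j ^+ 2) 0.
  have b0 j : b j = 0.
    have /eqP := B0; rewrite psumr_eq0; last by move=> k _; exact: sqr_ge0.
    by move=> /allP/(_ j (mem_index_enum _)); rewrite /= sqrf_eq0 => /eqP.
  rewrite [X in X ^+ 2]big1 ?expr0n ?mulr_ge0 ?sumr_ge0//= => k _; rewrite ?sqr_ge0//.
  by rewrite -/(b k) b0 mulr0.
pose B := \sum_j b j ^+ 2; pose C := \sum_j a j * b j.
have B_gt0 : 0 < B.
  by rewrite lt_def B_neq0 sumr_ge0// => k _; exact: sqr_ge0.
have : 0 <= \sum_j (a j - C / B * b j) ^+ 2 by rewrite sumr_ge0// => k _; exact: sqr_ge0.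
have -> : \sum_j (a j - C / B * b j) ^+ 2 = \sum_j a j ^+ 2 - C ^+ 2 / B.
  transitivity (\sum_j (a j ^+ 2 - 2 * (C / B) * (a j * b j) + (C / B) ^+ 2 * b j ^+ 2)).
    by apply: eq_bigr => j _; ring.
  rewrite big_split/= sumrB -!mulr_sumr -/B -/C; field.
  by rewrite gt_eqF.
by rewrite subr_ge0 ler_pdivrMr.
Qed.

Variables (n m q : nat) (K : 'M[R]_q) (X : 'M[R]_n).
Variables (f : 'cV[R]_n -> 'cV[R]_n) (g : 'I_m -> 'cV[R]_n -> 'cV[R]_n).
Variable gamma : 'I_q -> 'cV[R]_n -> 'cV[R]_n.
Hypotheses (HK : possemidef K) (HX : posdef X).
Hypotheses (f0 : f 0 = 0) (g0 : forall i, g i 0 = 0).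
Hypothesis gamma0 : forall j, gamma j 0 = 0.

Let S := msqrt X.

Lemma posdef_possemidef : possemidef X.
Proof.
case: HX => sX pX; split=> // x; have [->|/pX/ltW//] := eqVneq x 0.
by rewrite mulmx0 /dotv mulmx0 mxE.
Qed.

Lemma quadV_sqrt (x : 'cV[R]_n) : quadV X x = \sum_l (S *m x) l 0 ^+ 2.
Proof.
have [[sS _] SS] := msqrtP posdef_possemidef.
rewrite /quadV -SS -mulmxA dotv_mul sS dotvE.
by apply: eq_bigr => i _; rewrite expr2.
Qed.

Lemma quadV_le (x : 'cV[R]_n) : quadV X x <= frobenius S ^+ 2 * enorm x ^+ 2.
Proof. by rewrite quadV_sqrt -enorm_sqr; exact: enorm_mulmx. Qed.

(** If S y = 0 then the form of X vanishes at y, so y = 0. *)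
Lemma msqrt_unit : S \in unitmx.
Proof.
have [[sS _] SS] := msqrtP posdef_possemidef.
rewrite -row_free_unit; apply/row_freeP.
suff : kermx S = 0.
  move=> /eqP; rewrite kermx_eq0 => /row_freeP[B SB]; by exists B.
apply/row_matrixP => i; rewrite row0; apply: contra_eq (mulmx_ker S) => h.
apply/negP => /eqP/row_matrixP/(_ i); rewrite row0 row_mul => e.
set r := row i _ in h e.
have Sr : S *m r^T = 0.
  by apply: trmx_inj; rewrite trmx_mul trmxK sS e trmx0.
have := HX.2 r^T; rewrite -SS -mulmxA Sr mulmx0.
have rN : r^T != 0 by apply: contra h => /eqP/(congr1 trmx); rewrite trmxK trmx0 => ->.
by move=> /(_ rN); rewrite /dotv mulmx0 mxE ltxx.
Qed.

Lemma enorm_le (x : 'cV[R]_n) :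
  enorm x ^+ 2 <= frobenius (invmx S) ^+ 2 * quadV X x.
Proof.
rewrite quadV_sqrt -enorm_sqr -{1}(mulKmx msqrt_unit x); exact: enorm_mulmx.
Qed.

(** The squared Frobenius norm of M K^(1/2) is the trace of M K M^T, which does
    not mention the square root any more. *)
Lemma frobenius_mul_sqrt p (M : 'M[R]_(p, q)) : frobenius (M *m msqrt K) ^+ 2 =
  \sum_l \sum_j \sum_j' K j j' * (M l j * M l j').
Proof.
have [[sQ _] QQ] := msqrtP HK.
rewrite frobenius_sqr; apply: eq_bigr => l _.
transitivity ((M *m K *m M^T) l l).
  have -> : M *m K *m M^T = (M *m msqrt K) *m (M *m msqrt K)^T.
    by rewrite trmx_mul sQ mulmxA -(mulmxA M (msqrt K)) QQ.
  rewrite [RHS]mxE.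
  by apply: eq_bigr => j _; rewrite !mxE expr2.
rewrite mxE exchange_big/=; apply: eq_bigr => j' _.
by rewrite !mxE mulr_suml; apply: eq_bigr => j _; ring.
Qed.

(** The control term 2 <S x, S G v> is bounded entrywise by Young's inequality
    2 z v h <= delta^2 h^2 + z^2 v^2 / delta^2; the first squares make up the
    delta-part of the Lyapunov operator. *)
Lemma drift_bound (lambda delta : R) : 0 < delta ->
  (forall x : 'cV[R]_n, LV f g gamma K X x 0 delta <= - lambda * quadV X x) ->
  forall (x : 'cV[R]_n) (v : 'cV[R]_m),
  2 * dotv (S *m x) (S *m (f x + cols g x *m v)) +
  \sum_l \sum_j \sum_j' K j j' * ((S *m cols gamma x) l j * (S *m cols gamma x) l j')
  <= (- lambda + enorm v ^+ 2 / delta ^+ 2) * quadV X x.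
Proof.
move=> d0 HLV x v; have [[sS _] SS] := msqrtP posdef_possemidef.
have cg0 : cols g 0 = 0 by apply/matrixP => i j; rewrite !mxE g0 mxE.
have cgam0 : cols gamma 0 = 0 by apply/matrixP => i j; rewrite !mxE gamma0 mxE.
have := HLV x; rewrite /LV f0 cg0 cgam0 !subr0 frobenius_mul_sqrt frobenius_sqr -/S.
have -> : dotv x (X *m f x) = dotv (S *m x) (S *m f x).
  by rewrite -SS -mulmxA dotv_mul sS.
have -> : dotv (S *m x) (S *m (f x + cols g x *m v)) =
    dotv (S *m x) (S *m f x) + dotv (S *m x) (S *m cols g x *m v).
  rewrite mulmxDr mulmxA !dotvE -big_split/=; apply: eq_bigr => i _.
  by rewrite !mxE mulrDr.
suff : 2 * dotv (S *m x) (S *m cols g x *m v) <=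
    delta ^+ 2 * (\sum_i \sum_j (S *m cols g x) i j ^+ 2) +
    enorm v ^+ 2 / delta ^+ 2 * quadV X x by move=> H1 H2; lra.
rewrite quadV_sqrt dotvE enorm_sqr !mulr_sumr -big_split/=; apply: ler_sum => l _.
rewrite [(_ *m v) _ _]mxE !mulr_sumr -mulrA mulr_suml -big_split/=.
apply: ler_sum => i _.
move: ((S *m x) l 0) ((S *m cols g x) l i) (v i 0) => z h b.
have dN : delta != 0 by rewrite gt_eqF.
have := sqr_ge0 (delta * h - z * b / delta).
have -> : (delta * h - z * b / delta) ^+ 2 =
  delta ^+ 2 * h ^+ 2 + b ^+ 2 * ((delta ^+ 2)^-1 * z ^+ 2) - 2 * (z * (h * b)) by field.
by rewrite subr_ge0.
Qed.

End lyapunov_bound.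

(** * Sub-sigma-algebras and independence *)

Section sub_sigma_algebra.
Context {d} {T : measurableType d} {R : realType}.
Variable G : set (set T).
Hypothesis sG : sigma_algebra setT G.

(** Measurability with respect to a sigma-algebra G given as a set of sets; for
    G = F t this is the measurability used for adapted processes. By [measGP] it
    is ordinary measurability on the type that carries the sigma-algebra G, so
    that the closure properties come for free. *)
Definition measG (Y : T -> R) := forall B : set R, measurable B -> G (Y @^-1` B).

Lemma measGP Y : measG Y <->
  measurable_fun setT (Y : g_sigma_algebraType G -> R).
Proof.
have GE : <<s G >> = G by exact: sigma_algebra_id.
split=> [mY _ B mB|mY B mB].
  by rewrite setTI /measurable/= GE; exact: mY.
by have := mY measurableT B mB; rewrite setTI /measurable/= GE.
Qed.

Lemma measG_cst c : measG (fun=> c).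
Proof. by apply/measGP; exact: measurable_cst. Qed.

Lemma measGM Y Z : measG Y -> measG Z -> measG (fun x => Y x * Z x).
Proof. by move=> /measGP mY /measGP mZ; apply/measGP; exact: measurable_funM. Qed.

Lemma measGB Y Z : measG Y -> measG Z -> measG (fun x => Y x - Z x).
Proof. by move=> /measGP mY /measGP mZ; apply/measGP; exact: measurable_funB. Qed.

Lemma measGD Y Z : measG Y -> measG Z -> measG (fun x => Y x + Z x).
Proof. by move=> /measGP mY /measGP mZ; apply/measGP; exact: measurable_funD. Qed.

Lemma measG_sum I (r : seq I) (Y : I -> T -> R) : (forall i, measG (Y i)) ->
  measG (fun x => \sum_(i <- r) Y i x).
Proof.
move=> mY; elim: r => [|i r IH].
  rewrite (_ : (fun _ => _) = fun=> 0); first exact: measG_cst.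
  by apply/funext => x; rewrite big_nil.
rewrite (_ : (fun _ => _) = fun x => Y i x + \sum_(j <- r) Y j x).
  exact: measGD.
by apply/funext => x; rewrite big_cons.
Qed.

Lemma measG_le_indic Y (c : R) : measG Y -> measG (fun x => ((Y x <= c)%R%:R : R)).
Proof.
move=> mY B mB.
have h : G [set x | Y x <= c].
  rewrite (_ : [set x | _] = Y @^-1` `]-oo, c]); first exact: mY.
  by apply/seteqP; split=> x /=; rewrite in_itv.
have [G0 GC _] := sG.
have GT : G setT by rewrite -(setD0 setT); exact: GC.
have hC : G [set x | ~ (Y x <= c)].
  rewrite (_ : [set x | _] = setT `\` [set x | Y x <= c]); first exact: GC.
  by rewrite setTD; apply/seteqP; split.
case: (pselect (B 1)) => B1; case: (pselect (B 0)) => B0.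
- rewrite (_ : _ @^-1` _ = setT)//; apply/seteqP; split=> // x _ /=.
  by case: (Y x <= c).
- rewrite (_ : _ @^-1` _ = [set x | Y x <= c])//; apply/seteqP; split=> x /=.
    by case: (Y x <= c).
  by move=> ->.
- rewrite (_ : _ @^-1` _ = [set x | ~ (Y x <= c)])//; apply/seteqP; split=> x /=.
    by case: (Y x <= c).
  by move=> /negP/negbTE ->.
- rewrite (_ : _ @^-1` _ = set0)//; apply/seteqP; split=> // x /=.
  by case: (Y x <= c).
Qed.

End sub_sigma_algebra.

Section independence.

Lemma int1_prod {R : realType} {d1 d2} {T1 : measurableType d1} {T2 : measurableType d2}
    (m1 : {sigma_finite_measure set T1 -> \bar R})
    (m2 : {sigma_finite_measure set T2 -> \bar R}) (f : T1 -> R) (g : T2 -> R) :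
  int1 m1 f -> int1 m2 g ->
  int1 (m1 \x m2)%E (fun z => f z.1 * g z.2) /\
  \int[(m1 \x m2)%E]_z (f z.1 * g z.2) = (\int[m1]_x f x) * (\int[m2]_y g y).
Proof.
move=> fi gi; have mf := int1_measurable fi; have mg := int1_measurable gi.
have mM : measurable_fun setT (fun z : T1 * T2 => (f z.1 * g z.2)%:E).
  by apply/measurable_EFinP; apply: measurable_funM; apply: measurableT_comp.
have iprod : (m1 \x m2)%E.-integrable setT (fun z => (f z.1 * g z.2)%:E).
  apply/(integrable12ltyP _ _ mM) => /=.
  rewrite (eq_integral (fun x => `|(f x)%:E| * \int[m2]_y `|(g y)%:E|)%E); last first.
    move=> x _; rewrite -ge0_integralZl//; last first.
      by apply/measurable_EFinP; exact: measurableT_comp.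
    by apply: eq_integral => y _; rewrite /= normrM EFinM.
  rewrite ge0_integralZr//; last 2 first.
  - by apply/measurable_EFinP; exact: measurableT_comp.
  - exact: integral_ge0.
  apply: lte_mul_pinfty.
  - exact: integral_ge0.
  - rewrite ge0_fin_numE; last exact: integral_ge0.
    by have /integrableP[] := fi.
  - by have /integrableP[] := gi.
split=> //; apply: EFin_inj; rewrite -E_fin// EFinM -!E_fin//.
rewrite -integral12_prod_meas1//=.
have gfin : (\int[m2]_y (g y)%:E)%E \is a fin_num by exact: integrable_fin_num gi.
transitivity (\int[m1]_x ((f x)%:E * (fine (\int[m2]_y (g y)%:E))%:E))%E.
  by apply: eq_integral => x _; rewrite fineK// /fubini_F/= -integralZl.
by rewrite integralZr// fineK.
Qed.

Context {d} {T : measurableType d} {R : realType}.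
Variable P : probability T R.

(** The joint law of two independent variables is the product of their laws,
    so the expectation of the product is computed by Fubini's theorem. *)
Lemma indep_mul (X Y : T -> R) : int1 P X -> int1 P Y ->
  (forall A B : set R, measurable A -> measurable B ->
     P (X @^-1` A `&` Y @^-1` B) = (P (X @^-1` A) * P (Y @^-1` B))%E) ->
  int1 P (fun x => X x * Y x) /\
  \int[P]_x (X x * Y x) = (\int[P]_x X x) * (\int[P]_x Y x).
Proof.
move=> iX iY ind.
have mX := int1_measurable iX; have mY := int1_measurable iY.
pose X' : {RV P >-> R} := mfun_Sub (mem_set mX).
pose Y' : {RV P >-> R} := mfun_Sub (mem_set mY).
have mXY : measurable_fun setT (fun x => (X x, Y x)).
  exact: measurable_fun_pair.
pose Z : {RV P >-> (R * R)%type} := mfun_Sub (mem_set mXY).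
have prodE A : measurable A ->
    (distribution P X' \x distribution P Y')%E A = distribution P Z A.
  apply: product_measure_unique => A1 A2 mA1 mA2.
  by rewrite -[RHS]ind//.
have law_int (U : {RV P >-> R}) : int1 P U ->
    int1 (distribution P U) id /\ \int[distribution P U]_x x = \int[P]_x U x.
  move=> iU; split.
    apply/integrableP; split; first exact/measurable_EFinP.
    rewrite ge0_integral_distribution//; last first.
      by apply: measurableT_comp => //; exact/measurable_EFinP.
    by have /integrableP[] := iU.
  congr fine.
  exact: (@integral_distribution _ _ _ _ _ P U _ (@EFin_measurable R setT) iU).
have [iX' EX'] := law_int X' iX; have [iY' EY'] := law_int Y' iY.
have [iprod Eprod] := int1_prod iX' iY'.
have mM : measurable_fun setT (fun z : R * R => (z.1 * z.2)%:E).
  by apply/measurable_EFinP; apply: measurable_funM.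
have mMn : measurable_fun setT (fun z : R * R => `|(z.1 * z.2)%:E|%E).
  exact: measurableT_comp.
have iXY : int1 P (fun x => X x * Y x).
  apply/integrableP; split; first by apply/measurable_EFinP; exact: measurable_funM.
  rewrite -[X in (X < _)%E](ge0_integral_distribution Z mMn)//.
  rewrite -(eq_measure_integral _ (fun A mA _ => prodE A mA)).
  by have /integrableP[] := iprod.
split=> //; rewrite -[in RHS]EX' -[in RHS]EY' -[RHS]Eprod; congr fine.
rewrite -[LHS](@integral_distribution _ _ _ _ _ P Z _ mM)//.
by rewrite -(eq_measure_integral _ (fun A mA _ => prodE A mA)).
Qed.

End independence.

(** * Increments of the Wiener process *)

Section wiener_increments.
Context {R : realType} {d : measure_display} {Omega : measurableType d}.
Variables (P : probability Omega R) (F : R -> set (set Omega)).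
Variables (q : nat) (K : 'M[R]_q) (w : R -> Omega -> 'cV[R]_q).
Hypotheses (HF : usual_filtration P F) (Hw : wiener_process P F K w).

Lemma F_sigma t : 0 <= t -> sigma_algebra setT (F t).
Proof. by case: HF => h _ _ _ _; exact: h. Qed.

Lemma F_mono s t : 0 <= s -> s <= t -> F s `<=` F t.
Proof. by case: HF => _ _ h _ _; exact: h. Qed.

Lemma measG_mono s t (Y : Omega -> R) : 0 <= s -> s <= t ->
  measG (F s) Y -> measG (F t) Y.
Proof. by move=> s0 st mY B mB; apply: (F_mono s0 st); exact: mY. Qed.

Lemma measG_measurable t (Y : Omega -> R) : 0 <= t -> measG (F t) Y ->
  measurable_fun setT Y.
Proof.
case: HF => _ h _ _ _ t0 mY _ B mB; rewrite setTI.
by apply: (h t t0); exact: mY.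
Qed.

Definition inc (j : 'I_q) s t (omega : Omega) : R := w t omega j 0 - w s omega j 0.

Lemma w_measG t j : 0 <= t -> measG (F t) (fun omega => w t omega j 0).
Proof. by move=> t0; case: Hw => _ h _ _ _; exact: (h j). Qed.

Lemma inc_measG j s t : 0 <= s -> s <= t -> measG (F t) (inc j s t).
Proof.
move=> s0 st; have t0 := le_trans s0 st; apply: measGB (F_sigma t0) _ _ _ _.
  exact: w_measG.
by apply: (measG_mono s0 st); exact: w_measG.
Qed.

Lemma w_sqint t j : 0 <= t -> sqint P (fun omega => w t omega j 0).
Proof.
move=> t0; have mw := measG_measurable t0 (w_measG j t0); split=> //.
apply: int1_ge0 => [|x|]; [exact: measurable_sqr|exact: sqr_ge0|].
case: Hw => _ _ _ _ [_ h _]; have := h t t0 j j.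
rewrite unlock => e; under eq_integral do rewrite expr2.
by rewrite e ltry.
Qed.

Lemma inc_sqint j s t : 0 <= s -> s <= t -> sqint P (inc j s t).
Proof. by move=> s0 st; apply: sqintB; apply: w_sqint => //; exact: le_trans st. Qed.

Lemma KC i j : K i j = K j i.
Proof. by case: Hw => -[sK _] _ _ _ _; rewrite -[in LHS]sK mxE. Qed.

Lemma w_cov t i j : 0 <= t ->
  \int[P]_omega (w t omega i 0 * w t omega j 0) = K i j * t.
Proof.
move=> t0; case: Hw => _ _ _ _ [_ h _]; have := h t t0 i j.
by rewrite unlock /Rintegral => ->.
Qed.

(** Both the increment and its opposite have the centred normal law of the
    same variance, so its mean is its own opposite. *)
Lemma inc_mean0 j s t : 0 <= s -> s <= t -> \int[P]_omega (inc j s t omega) = 0.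
Proof.
move=> s0 st; have h0 : 0 <= t - s by rewrite subr_ge0.
case: Hw => _ _ _ _ [law _ _].
have mI := measG_measurable (le_trans s0 st) (inc_measG j s0 st).
have iI := sqint_int1 (inc_sqint j s0 st).
have mN : measurable_fun setT (fun x => - inc j s t x) by exact: measurableT_comp mI.
pose U : {RV P >-> R} := mfun_Sub (mem_set mI).
pose U' : {RV P >-> R} := mfun_Sub (mem_set mN).
have dot (c : R) om : dotv (c *: delta_mx j 0) (w (s + (t - s)) om - w s om) =
    c * inc j s t om.
  rewrite subrKC dotvE (bigD1 j)//= big1 => [|i ij].
    by rewrite !mxE !eqxx mulr1 addr0.
  by rewrite !mxE (negbTE ij) mulr0 mul0r.
have UU' A : measurable A -> A `<=` setT -> distribution P U A = distribution P U' A.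
  move=> mA _.
  have h1 := law s (t - s) s0 h0 (1 *: delta_mx j 0) A mA.
  have h2 := law s (t - s) s0 h0 ((-1) *: delta_mx j 0) A mA.
  have var : dotv (1 *: delta_mx j 0) (K *m (1 *: delta_mx j 0)) =
    dotv ((-1) *: delta_mx j 0) (K *m ((-1) *: delta_mx j 0)).
    rewrite scale1r scaleN1r mulmxN !dotvE; apply: eq_bigr => i _.
    by rewrite [in RHS]mxE [X in _ = _ * X]mxE mulrNN.
  have e1 : U @^-1` A = [set om | A (dotv (1 *: delta_mx j 0) (w (s + (t - s)) om - w s om))].
    by apply/funext => om /=; rewrite dot mul1r.
  have e2 : U' @^-1` A = [set om | A (dotv ((-1) *: delta_mx j 0) (w (s + (t - s)) om - w s om))].
    by apply/funext => om /=; rewrite dot mulN1r.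
  change (P (U @^-1` A) = P (U' @^-1` A)).
  rewrite e1 e2; apply: (eq_trans h1); apply: esym; apply: (eq_trans h2).
  exact: (congr1 (fun z => centered_normal ((t - s) * z) A) (esym var)).
have : \int[P]_omega (inc j s t omega) = - \int[P]_omega (inc j s t omega).
  apply: EFin_inj; rewrite -mulN1r -EZ// -E_fin// -E_fin; last exact: int1Z.
  have := @integral_distribution _ _ _ _ _ P U _ (@EFin_measurable R setT) iI.
  rewrite (eq_measure_integral _ UU') => <-.
  have iN : int1 P (fun x => - inc j s t x).
    rewrite (_ : (fun _ => _) = fun x => (-1) * inc j s t x); first exact: int1Z.
    by apply/funext => x; rewrite mulN1r.
  rewrite (@integral_distribution _ _ _ _ _ P U' _ (@EFin_measurable R setT) iN).
  by apply: eq_integral => x _ /=; rewrite mulN1r.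
by lra.
Qed.

Lemma g_sigma_preimage_gen (D : 'I_q -> Omega -> R) j : measG (g_sigma_preimage D) (D j).
Proof.
move=> B mB; apply: sub_sigma_algebra; rewrite (bigD1 j)//=; left.
by exists B => //; rewrite setTI.
Qed.

Lemma inc_indep s t (X Y : Omega -> R) : 0 <= s -> s <= t ->
  measG (F s) X -> int1 P X ->
  measG (g_sigma_preimage (fun (j : 'I_q) => inc j s t)) Y -> int1 P Y ->
  int1 P (fun x => X x * Y x) /\
  \int[P]_x (X x * Y x) = (\int[P]_x X x) * (\int[P]_x Y x).
Proof.
move=> s0 st mX iX mY iY; apply: indep_mul => // A B mA mB.
case: Hw => _ _ _ _ [_ _ h]; apply: (h s (t - s)) => //.
- by rewrite subr_ge0.
- exact: mX.
- rewrite (_ : (fun j om => w (s + (t - s)) om j 0 - w s om j 0) = fun j => inc j s t).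
    exact: mY.
  by rewrite subrKC.
Qed.

(** An increment is centred and independent of the past. *)
Lemma inc_orth j s t (X : Omega -> R) : 0 <= s -> s <= t ->
  measG (F s) X -> sqint P X -> \int[P]_x (X x * inc j s t x) = 0.
Proof.
move=> s0 st mX sX.
have [_ ->] := inc_indep s0 st mX (sqint_int1 sX) (@g_sigma_preimage_gen (fun j => inc j s t) j)
  (sqint_int1 (inc_sqint j s0 st)).
by rewrite inc_mean0// mulr0.
Qed.

(** From the covariances of w t and w s alone: the cross terms
    E[w s (w t - w s)] vanish by [inc_orth]. *)
Lemma inc_cov a b s t : 0 <= s -> s <= t ->
  \int[P]_x (inc a s t x * inc b s t x) = K a b * (t - s).
Proof.
move=> s0 st; have t0 := le_trans s0 st.
have oa := inc_orth a s0 st (w_measG b s0) (w_sqint b s0).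
have ob := inc_orth b s0 st (w_measG a s0) (w_sqint a s0).
have swt j := w_sqint j t0; have sws j := w_sqint j s0.
have si j := inc_sqint j s0 st.
have i1 := sqintM (swt a) (swt b); have i2 := sqintM (sws a) (sws b).
have i3 := sqintM (sws a) (si b); have i4 := sqintM (sws b) (si a).
rewrite (@eqE _ _ _ _ _ (fun x => w t x a 0 * w t x b 0 - w s x a 0 * w s x b 0
  - w s x a 0 * inc b s t x - w s x b 0 * inc a s t x)); last first.
  by move=> x; rewrite /inc; ring.
rewrite (EB (int1B (int1B i1 i2) i3) i4) (EB (int1B i1 i2) i3) (EB i1 i2).
by rewrite oa ob !w_cov//; ring.
Qed.

Lemma inc_covX a b s t (X : Omega -> R) : 0 <= s -> s <= t ->
  measG (F s) X -> int1 P X ->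
  \int[P]_x (X x * (inc a s t x * inc b s t x)) = K a b * (t - s) * \int[P]_x X x.
Proof.
move=> s0 st mX iX.
have gs : sigma_algebra setT (g_sigma_preimage (fun (j : 'I_q) => inc j s t)).
  exact: smallest_sigma_algebra.
have mab : measG (g_sigma_preimage (fun j : 'I_q => inc j s t))
    (fun x => inc a s t x * inc b s t x).
  by apply: measGM => //; exact: g_sigma_preimage_gen.
have [_ ->] := inc_indep s0 st mX iX mab (sqintM (inc_sqint a s0 st) (inc_sqint b s0 st)).
by rewrite inc_cov// mulrC.
Qed.

(** The class of the values of simple processes. *)
Definition bmeas t (X : Omega -> R) :=
  measG (F t) X /\ exists C, forall x, `|X x| <= C.

Lemma bmeas_mono s t X : 0 <= s -> s <= t -> bmeas s X -> bmeas t X.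
Proof. by move=> s0 st [mX bX]; split=> //; exact: measG_mono st mX. Qed.

Lemma bmeasM t X Y : 0 <= t -> bmeas t X -> bmeas t Y -> bmeas t (fun x => X x * Y x).
Proof.
move=> t0 [mX [C XC]] [mY [D YD]]; split.
  by apply: measGM => //; exact: F_sigma.
by exists (C * D) => x; rewrite normrM ler_pM.
Qed.

Lemma bmeas_int1 t X : 0 <= t -> bmeas t X -> int1 P X.
Proof. by move=> t0 [/(measG_measurable t0) mX [C XC]]; exact: int1_bounded XC. Qed.

Lemma bmeas_sqint t X : 0 <= t -> bmeas t X -> sqint P X.
Proof. by move=> t0 [/(measG_measurable t0) mX [C XC]]; exact: sqint_bounded XC. Qed.

Lemma bmeas_mul_sqint t X Y : 0 <= t -> bmeas t X -> sqint P Y ->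
  sqint P (fun x => X x * Y x).
Proof.
by move=> t0 [/(measG_measurable t0) mX [C XC]] sY; exact: sqint_bdM XC sY.
Qed.

Lemma inc_split j s r t x : inc j s t x = inc j s r x + inc j r t x.
Proof. by rewrite /inc; ring. Qed.

(** The longer increment is split at t; its second part is orthogonal to what
    happens before t. *)
Lemma pair_same_start a b s t t' X : 0 <= s -> s <= t -> t <= t' -> bmeas s X ->
  \int[P]_x (X x * (inc a s t x * inc b s t' x)) = K a b * (t - s) * \int[P]_x X x.
Proof.
move=> s0 st tt' bX; have t0 := le_trans s0 st.
have bXt := bmeas_mono s0 st bX.
have sXa := bmeas_mul_sqint s0 bX (inc_sqint a s0 st).
have i1 := sqintM sXa (inc_sqint b s0 st).
have i2 := sqintM sXa (inc_sqint b t0 tt').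
rewrite (@eqE _ _ _ _ _ (fun x => X x * inc a s t x * inc b s t x +
   X x * inc a s t x * inc b t t' x)); last first.
  by move=> x; rewrite (inc_split b s t t'); ring.
rewrite (ED i1 i2) (inc_orth b t0 tt' _ sXa) ?addr0.
  rewrite -inc_covX//; [|exact: bX.1|exact: bmeas_int1 bX].
  by apply: eqE => x; rewrite mulrA.
apply: measGM (F_sigma t0) _ _ _ _; first exact: bXt.1.
exact: inc_measG.
Qed.

(** The part of the first increment before s' is orthogonal to the second one;
    from s' on both start together, as in [pair_same_start]. *)
Lemma pair_cov_le a b s t s' t' X X' : 0 <= s -> s <= s' -> s <= t -> s' <= t' ->
  bmeas s X -> bmeas s' X' ->
  \int[P]_x ((X x * inc a s t x) * (X' x * inc b s' t' x)) =
  K a b * Num.max 0 (Num.min t t' - Num.max s s') * \int[P]_x (X x * X' x).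
Proof.
move=> s0 ss' st s't' bX bX'; have s'0 := le_trans s0 ss'.
rewrite (max_idPr ss').
have bXX' := bmeasM s'0 (bmeas_mono s0 ss' bX) bX'.
have sX'b := bmeas_mul_sqint s'0 bX' (inc_sqint b s'0 s't').
have zero u : s <= u -> u <= s' ->
    \int[P]_x ((X x * inc a s u x) * (X' x * inc b s' t' x)) = 0.
  move=> su us'; have u0 := le_trans s0 su.
  have sX := bmeas_mul_sqint s0 bX (inc_sqint a s0 su).
  have sXX := bmeas_mul_sqint s'0 bX' sX.
  have mXX : measG (F s') (fun x => X' x * (X x * inc a s u x)).
    apply: measGM (F_sigma s'0) _ _ _ _; first exact: bX'.1.
    apply: measGM (F_sigma s'0) _ _ _ _; first exact: (bmeas_mono s0 ss' bX).1.
    by apply: (measG_mono u0 us'); exact: inc_measG.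
  apply: eq_trans (inc_orth b s'0 s't' mXX sXX).
  by apply: eqE => x; ring.
have [ts'|s't] := leP t s'.
  rewrite zero//; have -> : Num.max 0 (Num.min t t' - s') = 0.
    by apply/max_idPl; rewrite subr_le0 ge_min ts'.
  by rewrite mulr0 mul0r.
have -> : Num.max 0 (Num.min t t' - s') = Num.min t t' - s'.
  by apply/max_idPr; rewrite subr_ge0 le_min (ltW s't).
have i1 := sqintM (bmeas_mul_sqint s0 bX (inc_sqint a s0 ss')) sX'b.
have i2 := sqintM (bmeas_mul_sqint s0 bX (inc_sqint a s'0 (ltW s't))) sX'b.
rewrite (@eqE _ _ _ _ _ (fun x => (X x * inc a s s' x) * (X' x * inc b s' t' x) +
   (X x * inc a s' t x) * (X' x * inc b s' t' x))); last first.
  by move=> x; rewrite (inc_split a s s' t); ring.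
rewrite (ED i1 i2) zero// add0r.
have [tt'|t't] := leP t t'.
  rewrite -(pair_same_start a b s'0 (ltW s't) tt' bXX').
  by apply: eqE => x; ring.
rewrite KC -(pair_same_start b a s'0 s't' (ltW t't) bXX').
by apply: eqE => x; ring.
Qed.

Lemma pair_cov a b s t s' t' X X' : 0 <= s -> 0 <= s' -> s <= t -> s' <= t' ->
  bmeas s X -> bmeas s' X' ->
  \int[P]_x ((X x * inc a s t x) * (X' x * inc b s' t' x)) =
  K a b * Num.max 0 (Num.min t t' - Num.max s s') * \int[P]_x (X x * X' x).
Proof.
move=> s0 s'0 st s't' bX bX'; have [ss'|] := boolP (s <= s'); last first.
  rewrite -ltNge => s's; rewrite KC (minC t) (maxC s).
  transitivity (\int[P]_x ((X' x * inc b s' t' x) * (X x * inc a s t x))).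
    by apply: eqE => x; rewrite mulrC.
  rewrite (pair_cov_le b a s'0 (ltW s's) s't' st bX' bX); congr (_ * _).
  by apply: eqE => x; rewrite mulrC.
exact: pair_cov_le.
Qed.

End wiener_increments.

(** * Integrals of simple processes and their isometry *)

Section simple_isometry.
Context {R : realType} {d : measure_display} {Omega : measurableType d}.
Variables (P : probability Omega R) (F : R -> set (set Omega)).
Variables (q : nat) (K : 'M[R]_q) (w : R -> Omega -> 'cV[R]_q).
Hypotheses (HF : usual_filtration P F) (Hw : wiener_process P F K w).
Local Notation leb := (@lebesgue_measure R).
Local Notation inc := (inc w).

(** Integrals over time are integrals over the whole line against this
    indicator, which turns manipulations of intervals into algebra. *)
Definition tind (s t r : R) : R := \1_(`]s, t]) r.

Lemma tindE s t r : tind s t r = ((s < r) && (r <= t))%:R.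
Proof.
rewrite /tind indicE; congr (_ %:R); congr nat_of_bool.
by apply/idP/idP; rewrite ?inE/= ?in_itv//= => ?; rewrite in_itv.
Qed.

Lemma tind_ge0 s t r : 0 <= tind s t r.
Proof. by rewrite tindE. Qed.

Lemma tind_norm s t r : `|tind s t r| <= 1.
Proof. by rewrite tindE; case: (_ && _); rewrite ?normr1// normr0. Qed.

Lemma tind_meas s t : measurable_fun setT (tind s t).
Proof. exact: measurable_indic. Qed.

Lemma tindI s t s' t' r :
  tind s t r * tind s' t' r = tind (Num.max s s') (Num.min t t') r.
Proof.
rewrite !tindE gt_max le_min; case: (s < r); case: (s' < r); case: (r <= t);
by case: (r <= t'); rewrite /= ?mulr0 ?mul0r ?mulr1.
Qed.

Lemma tind_le (s s' t t' r : R) : s' <= s -> t <= t' -> tind s t r <= tind s' t' r :> R.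
Proof.
move=> ss tt; rewrite !tindE ler_nat; case: (ltP s r) => //= sr.
by rewrite (le_lt_trans ss sr)/=; case: (leP r t) => // rt; rewrite (le_trans rt tt).
Qed.

Lemma tind_add (s t u r : R) : s <= t -> t <= u -> tind s u r = tind s t r + tind t u r :> R.
Proof.
move=> st tu; rewrite !tindE; have [rt|tr] := leP r t.
  by rewrite (le_trans rt tu)/= addr0.
by rewrite (le_lt_trans st tr)/= add0r.
Qed.

Lemma tind_sqr_ge0 s t r y : 0 <= tind s t r * y ^+ 2.
Proof. by rewrite mulr_ge0 ?tind_ge0// sqr_ge0. Qed.

Lemma tind_int1 s t : int1 leb (tind s t).
Proof.
apply/integrableP; split; first by apply/measurable_EFinP; exact: tind_meas.
under eq_integral do rewrite /= ger0_norm ?tind_ge0//.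
rewrite /tind integral_indic// setIT [X in (X < _)%E](lebesgue_measure_itv `]s, t])/=; case: ifP => _; exact: ltry.
Qed.

Lemma tind_E s t : \int[leb]_r tind s t r = Num.max 0 (t - s).
Proof.
rewrite /Rintegral /tind integral_indic// setIT [X in fine X](lebesgue_measure_itv `]s, t])/= lte_fin.
case: ltP => st /=; first by apply/esym/max_idPr; rewrite subr_ge0 ltW.
by apply/esym/max_idPl; rewrite subr_le0.
Qed.

Local Notation SI S j := (sp_integral S (fun s omega => w s omega j 0)).

Variable S : simple_process F.

(** The partition of S restricted to [s, T]: the increment of the integral of S
    from s to T is the sum over the clipped cells. *)
Definition clip s T u : R := Num.max (Num.min u T) s.

Lemma clip_mono s T u v : u <= v -> clip s T u <= clip s T v.
Proof.
move=> uv; rewrite /clip ge_max !le_max lexx orbT andbT; apply/orP; left.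
by rewrite le_min !ge_min uv lexx orbT.
Qed.

Lemma clip_ge s T u : s <= clip s T u.
Proof. by rewrite /clip le_max lexx orbT. Qed.

(** The value of S on a cell of its partition, discarded when the cell lies
    beyond T, so that it is measurable at the start of the clipped cell. *)
Definition cval T i : Omega -> R :=
  if sp_time S i <= T then sp_val S i else fun=> 0.

Lemma cval_bmeas s T i : 0 <= s -> bmeas F (clip s T (sp_time S i)) (cval T i).
Proof.
move=> s0; have c0 := le_trans s0 (clip_ge s T (sp_time S i)).
rewrite /cval; case: ifP => tT; last first.
  split; first exact: measG_cst (F_sigma HF c0) _.
  by exists 0 => x; rewrite normr0.
split; last by have [C h] := sp_val_bounded S; exists C.
apply: (measG_mono HF (sp_time_ge0 S i)); last exact: sp_val_measurable.
by rewrite /clip (min_idPl tT) le_max lexx.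
Qed.

Lemma SI_diff j s T omega : s <= T -> SI S j T omega - SI S j s omega =
  \sum_(i < sp_size S) cval T i omega *
    inc j (clip s T (sp_time S i)) (clip s T (sp_time S i.+1)) omega.
Proof.
move=> sT; rewrite /sp_integral -sumrB; apply: eq_bigr => i _.
rewrite -mulrBr.
have key u : w (Num.min u T) omega j 0 - w (Num.min u s) omega j 0 =
    w (clip s T u) omega j 0 - w s omega j 0.
  rewrite /clip; have [us|su] := leP u s.
    have uT := le_trans us sT.
    by rewrite (min_idPl uT) (max_idPr us) !subrr.
  by congr (_ - _); rewrite (max_idPl _)// le_min (ltW su).
have -> : forall a b c d : R, a - b - (c - d) = (a - c) - (b - d) by move=> *; ring.
rewrite !key /cval; case: ifP => tT.
  by rewrite /inc; ring.
have e1 : Num.min (sp_time S i) T = T by apply/min_idPr; rewrite ltW// ltNge tT.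
have e2 : Num.min (sp_time S i.+1) T = T.
  apply/min_idPr; rewrite (le_trans _ (sp_time_nondecreasing S i))//.
  by rewrite ltW// ltNge tT.
by rewrite /clip e1 e2 !subrr mulr0 mul0r.
Qed.

Lemma clip0 s T u : 0 <= s -> 0 <= clip s T u.
Proof. by move=> s0; exact: le_trans (clip_ge s T u). Qed.

Lemma SI_diff_sqint j s T : 0 <= s -> s <= T ->
  sqint P (fun omega => SI S j T omega - SI S j s omega).
Proof.
move=> s0 sT; rewrite (_ : (fun _ => _) = fun omega => \sum_(i < sp_size S) cval T i omega *
    inc j (clip s T (sp_time S i)) (clip s T (sp_time S i.+1)) omega).
  apply: sqint_sum => i; apply: (bmeas_mul_sqint HF _ (cval_bmeas T i s0)).
    exact: clip0.
  apply: inc_sqint HF Hw _ _ _ _ _; first exact: clip0.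
  by apply: clip_mono; exact: sp_time_nondecreasing.
by apply/funext => omega; exact: SI_diff.
Qed.

Lemma SI0 j omega : SI S j 0 omega = 0.
Proof.
rewrite /sp_integral big1// => i _.
by rewrite !(min_idPr (sp_time_ge0 S _)) subrr mulr0.
Qed.

Lemma SI_sqint j T : 0 <= T -> sqint P (SI S j T).
Proof.
move=> T0; rewrite (_ : SI S j T = fun omega => SI S j T omega - SI S j 0 omega).
  exact: SI_diff_sqint.
by apply/funext => omega; rewrite SI0 subr0.
Qed.

Lemma sp_evalE r omega : sp_eval S r omega =
  \sum_(i < sp_size S) sp_val S i omega * tind (sp_time S i) (sp_time S i.+1) r.
Proof. by []. Qed.

Lemma sp_eval_clip s T r omega : s <= T ->
  tind s T r * sp_eval S r omega =
  \sum_(i < sp_size S) cval T i omega *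
    tind (clip s T (sp_time S i)) (clip s T (sp_time S i.+1)) r.
Proof.
move=> sT; rewrite sp_evalE mulr_sumr; apply: eq_bigr => i _.
rewrite mulrCA tindI maxC minC /cval; case: ifP => tT.
  congr (_ * _); rewrite !tindE /clip; congr (_ %:R); congr nat_of_bool.
  rewrite !gt_max !le_max !le_min (min_idPl tT).
  have [sr|rs] := ltP s r.
    by rewrite orbF.
  by rewrite !andbF.
rewrite mul0r (_ : tind _ _ _ = 0) ?mulr0// tindE gt_max le_min.
have [tr|//] := ltP (sp_time S i) r.
have Tt : T < sp_time S i by rewrite ltNge tT.
by rewrite [r <= T]leNgt (lt_trans Tt tr) /= !andbF.
Qed.

(** Each clipped cell starts after s, so its increment is orthogonal to Y times
    the value on the cell. *)
Lemma SI_martingale j s T Y : 0 <= s -> s <= T -> measG (F s) Y -> sqint P Y ->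
  \int[P]_omega (Y omega * (SI S j T omega - SI S j s omega)) = 0.
Proof.
move=> s0 sT mY sY.
pose a i := clip s T (sp_time S i).
have a0 i : 0 <= a i by exact: clip0.
have aa i : a i <= a i.+1 by apply: clip_mono; exact: sp_time_nondecreasing.
rewrite (@eqE _ _ _ _ _ (fun omega => \sum_(i < sp_size S)
   (cval T i omega * Y omega) * inc j (a i) (a i.+1) omega)); last first.
  move=> x; rewrite SI_diff// mulr_sumr; apply: eq_bigr => i _.
  by rewrite mulrCA mulrA.
have sYi i : sqint P (fun omega => cval T i omega * Y omega).
  exact: (bmeas_mul_sqint HF (a0 i) (cval_bmeas T i s0) sY).
rewrite E_sum; last first.
  by move=> i; apply: sqintM (sYi i) (inc_sqint HF Hw j (a0 i) (aa i)).
rewrite big1// => i _; apply: (inc_orth HF Hw) => //.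
apply: measGM (F_sigma HF (a0 i)) _ _ _ _; first exact: (cval_bmeas T i s0).1.
by apply: (measG_mono HF s0 (clip_ge s T _)).
Qed.

End simple_isometry.

Section isometry.
Context {R : realType} {d : measure_display} {Omega : measurableType d}.
Variables (P : probability Omega R) (F : R -> set (set Omega)).
Variables (q : nat) (K : 'M[R]_q) (w : R -> Omega -> 'cV[R]_q).
Hypotheses (HF : usual_filtration P F) (Hw : wiener_process P F K w).
Local Notation leb := (@lebesgue_measure R).
Local Notation SI S j := (sp_integral S (fun s omega => w s omega j 0)).

Local Notation M := (leb \x P)%E.

(** Ito's isometry, polarized: both sides expand over pairs of cells, and the
    covariance of two increments is the length of the overlap. *)
Lemma isometry (S S' : simple_process F) a b s T : 0 <= s -> s <= T ->
  \int[P]_omega ((SI S a T omega - SI S a s omega) * (SI S' b T omega - SI S' b s omega)) =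
  K a b * \int[M]_z ((tind s T z.1 * sp_eval S z.1 z.2) *
                      (tind s T z.1 * sp_eval S' z.1 z.2)).
Proof.
move=> s0 sT.
pose t i := clip s T (sp_time S i); pose t' i := clip s T (sp_time S' i).
have t0 i : 0 <= t i by exact: clip0.
have t'0 i : 0 <= t' i by exact: clip0.
have tt i : t i <= t i.+1 by apply: clip_mono; exact: sp_time_nondecreasing.
have tt' i : t' i <= t' i.+1 by apply: clip_mono; exact: sp_time_nondecreasing.
have bX i := cval_bmeas HF S T i s0.
have bX' i := cval_bmeas HF S' T i s0.
have iXX i k : int1 P (fun x => cval S T i x * cval S' T k x).
  by apply: sqintM; [exact (bmeas_sqint HF (t0 i) (bX i))|exact (bmeas_sqint HF (t'0 k) (bX' k))].
have prod i k := int1_prod (tind_int1 (Num.max (t i) (t' k)) (Num.min (t i.+1) (t' k.+1))) (iXX i k).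
transitivity (\sum_(i < sp_size S) \sum_(k < sp_size S')
   \int[P]_omega ((cval S T i omega * inc w a (t i) (t i.+1) omega) *
     (cval S' T k omega * inc w b (t' k) (t' k.+1) omega))).
  have sI i := bmeas_mul_sqint HF (t0 i) (bX i) (inc_sqint HF Hw a (t0 i) (tt i)).
  have sI' i := bmeas_mul_sqint HF (t'0 i) (bX' i) (inc_sqint HF Hw b (t'0 i) (tt' i)).
  rewrite (@eqE _ _ _ _ _ (fun omega => \sum_(i < sp_size S) \sum_(k < sp_size S')
     ((cval S T i omega * inc w a (t i) (t i.+1) omega) *
     (cval S' T k omega * inc w b (t' k) (t' k.+1) omega)))); last first.
    move=> x; rewrite !SI_diff// mulr_suml; apply: eq_bigr => i _.
    by rewrite mulr_sumr.
  rewrite E_sum; last by move=> i; apply: int1_sum => k; exact: sqintM.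
  by apply: eq_bigr => i _; rewrite E_sum// => k; exact: sqintM.
transitivity (K a b * \int[M]_z (\sum_(i < sp_size S) \sum_(k < sp_size S')
   (tind (Num.max (t i) (t' k)) (Num.min (t i.+1) (t' k.+1)) z.1 *
    (cval S T i z.2 * cval S' T k z.2)))); last first.
  congr (_ * _); apply: eqE => z; rewrite !sp_eval_clip// mulr_suml.
  apply: eq_bigr => i _; rewrite mulr_sumr; apply: eq_bigr => k _.
  by rewrite -tindI; ring.
rewrite E_sum; last by move=> i; apply: int1_sum => k; exact: (prod i k).1.
rewrite mulr_sumr; apply: eq_bigr => i _.
rewrite E_sum; last by move=> k; exact: (prod i k).1.
rewrite mulr_sumr; apply: eq_bigr => k _.
rewrite (prod i k).2 tind_E mulrA.
exact: (pair_cov HF Hw a b (t0 i) (t'0 k) (tt i) (tt' k) (bX i) (bX' k)).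
Qed.

Lemma sp_eval_sqint (S : simple_process F) s T : 0 <= s -> s <= T ->
  sqint M (fun z => tind s T z.1 * sp_eval S z.1 z.2).
Proof.
move=> s0 sT.
pose t i := clip s T (sp_time S i).
have t0 i : 0 <= t i by exact: clip0.
have bX i := cval_bmeas HF S T i s0.
rewrite (_ : (fun _ => _) = fun z => \sum_(i < sp_size S)
   (tind (t i) (t i.+1) z.1 * cval S T i z.2)); last first.
  by apply/funext => z; rewrite sp_eval_clip//; apply: eq_bigr => i _; rewrite mulrC.
apply: sqint_sum => i.
have sX := bmeas_sqint HF (t0 i) (bX i).
split.
  by have [/int1_measurable] := int1_prod (tind_int1 (t i) (t i.+1)) (sqint_int1 sX).
have [h _] := int1_prod (tind_int1 (t i) (t i.+1)) sX.2.
rewrite (_ : (fun _ => _) = fun z => tind (t i) (t i.+1) z.1 * (cval S T i z.2 ^+ 2))//.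
apply/funext => z; rewrite exprMn; congr (_ * _).
by rewrite tindE; case: (_ && _); rewrite ?expr0n ?expr1n.
Qed.

End isometry.

(** * Energy and refinement of simple processes *)

Section simple_process_cells.
Context {R : realType} {d : measure_display} {Omega : measurableType d}.
Variables (F : R -> set (set Omega)).
Local Notation leb := (@lebesgue_measure R).
Variable S : simple_process F.
Implicit Types (r T : R) (omega : Omega).

Local Notation t_ := (sp_time S).

Lemma sp_time_mono i j : (i <= j)%N -> t_ i <= t_ j.
Proof.
move=> /subnK <-; elim: (j - i)%N => [|k IH]//.
by rewrite addSn (le_trans IH)// sp_time_nondecreasing.
Qed.

Lemma tind_cell_disj i j r : i != j -> tind (t_ i) (t_ i.+1) r * tind (t_ j) (t_ j.+1) r = 0.
Proof.
rewrite neq_ltn => /orP[] ij; rewrite !tindE.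
  case: (boolP ((t_ j < r) && _)) => [/andP[jr _]|]; last by rewrite mulr0.
  by rewrite (leNgt r (t_ i.+1)) (le_lt_trans (sp_time_mono ij) jr) andbF mul0r.
case: (boolP ((t_ i < r) && _)) => [/andP[jr _]|]; last by rewrite mul0r.
by rewrite (leNgt r (t_ j.+1)) (le_lt_trans (sp_time_mono ij) jr) andbF mulr0.
Qed.

Lemma sp_eval_cell (i : 'I_(sp_size S)) r omega : t_ i < r -> r <= t_ i.+1 ->
  sp_eval S r omega = sp_val S i omega.
Proof.
move=> ir ri; have ti : tind (t_ i) (t_ i.+1) r = 1 by rewrite tindE ir ri.
rewrite sp_evalE (bigD1 i)//= ti mulr1 big1 ?addr0// => j ji.
by rewrite -[tind _ _ _]mulr1 -ti tind_cell_disj ?mulr0.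
Qed.

Lemma sp_eval_nocell r omega :
  (forall i : 'I_(sp_size S), ~ (t_ i < r /\ r <= t_ i.+1)) -> sp_eval S r omega = 0.
Proof.
move=> h; rewrite sp_evalE big1// => i _; rewrite tindE.
case: (boolP (_ && _)) => [/andP[a b]|]; last by rewrite mulr0.
by case: (h i).
Qed.

Lemma sp_eval_sqr r omega : sp_eval S r omega ^+ 2 =
  \sum_(i < sp_size S) sp_val S i omega ^+ 2 * tind (t_ i) (t_ i.+1) r.
Proof.
have [[i [ir ri]]|h] := pselect (exists i : 'I_(sp_size S), t_ i < r /\ r <= t_ i.+1).
  have ti : tind (t_ i) (t_ i.+1) r = 1 by rewrite tindE ir ri.
  rewrite (sp_eval_cell _ ir ri) (bigD1 i)//= ti mulr1 big1 ?addr0// => j ji.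
  by rewrite -[tind _ _ _]mulr1 -ti tind_cell_disj ?mulr0.
rewrite sp_eval_nocell; last by move=> i hi; apply: h; exists i.
rewrite expr0n/= big1// => i _; rewrite tindE.
case: (boolP (_ && _)) => [/andP[a b]|]; last by rewrite mulr0.
by exfalso; apply: h; exists i.
Qed.

Definition clen T i : R := Num.min (t_ i.+1) T - Num.min (t_ i) T.

Lemma clen_ge0 T i : 0 <= clen T i.
Proof.
rewrite subr_ge0 le_min !ge_min lexx orbT andbT; apply/orP; left.
exact: sp_time_nondecreasing.
Qed.

Lemma tind_cell_E T i : 0 <= T -> \int[leb]_r (tind 0 T r * tind (t_ i) (t_ i.+1) r) = clen T i.
Proof.
move=> T0; transitivity (\int[leb]_r tind (t_ i) (Num.min T (t_ i.+1)) r).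
  by apply: eqE => r; rewrite tindI (max_idPr (sp_time_ge0 S i)).
rewrite tind_E /clen minC; have [Ti|iT] := leP T (t_ i).
  have Ti1 := le_trans Ti (sp_time_nondecreasing S i).
  by rewrite (min_idPr Ti1) subrr; apply/max_idPl; rewrite subr_le0.
by apply/max_idPr; rewrite subr_ge0 le_min sp_time_nondecreasing ltW.
Qed.

(** It involves only the values on cells up to the i-th one, hence is known at
    the time sp_time S i, which makes it usable in a truncation. *)
Definition cenergy T i omega : R := \sum_(j < i.+1) sp_val S j omega ^+ 2 * clen T j.

Lemma cell_int1 T i (c : R) :
  int1 leb (fun r => c * (tind 0 T r * tind (t_ i) (t_ i.+1) r)).
Proof.
apply: int1Z; rewrite (_ : (fun _ => _) = tind (Num.max 0 (t_ i)) (Num.min T (t_ i.+1))).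
  exact: tind_int1.
by apply/funext => r; rewrite tindI.
Qed.

Lemma sp_eval_sqr_int1 T omega : int1 leb (fun r => tind 0 T r * sp_eval S r omega ^+ 2).
Proof.
rewrite (_ : (fun _ => _) = fun r => \sum_(i < sp_size S) sp_val S i omega ^+ 2 *
    (tind 0 T r * tind (t_ i) (t_ i.+1) r)).
  by apply: int1_sum => i; exact: cell_int1.
apply/funext => r; rewrite sp_eval_sqr mulr_sumr; apply: eq_bigr => i _.
by rewrite mulrCA.
Qed.

Lemma sp_eval_sqr_E T omega : 0 <= T -> \int[leb]_r (tind 0 T r * sp_eval S r omega ^+ 2) =
  \sum_(i < sp_size S) sp_val S i omega ^+ 2 * clen T i.
Proof.
move=> T0; transitivity (\int[leb]_r (\sum_(i < sp_size S) sp_val S i omega ^+ 2 *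
    (tind 0 T r * tind (t_ i) (t_ i.+1) r))).
  apply: eqE => r; rewrite sp_eval_sqr mulr_sumr; apply: eq_bigr => i _.
  by rewrite mulrCA.
rewrite E_sum; last by move=> i; exact: cell_int1.
apply: eq_bigr => i _; rewrite EZ ?tind_cell_E//.
by have := cell_int1 T i 1; under [X in int1 _ X]funext do rewrite mul1r.
Qed.

Lemma cenergy_le T (i : 'I_(sp_size S)) omega : 0 <= T -> cenergy T i omega <=
  \int[leb]_r (tind 0 (Num.min (t_ i.+1) T) r * sp_eval S r omega ^+ 2).
Proof.
move=> T0; rewrite sp_eval_sqr_E; last by rewrite le_min sp_time_ge0.
rewrite /cenergy (big_ord_widen _ (fun j => sp_val S j omega ^+ 2 * clen T j) (ltn_ord i)).
rewrite big_mkcond/=; apply: ler_sum => j _; case: ifP => ji; last first.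
  by rewrite mulr_ge0 ?sqr_ge0 ?clen_ge0.
rewrite ler_wpM2l ?sqr_ge0// /clen !minA (min_idPl (sp_time_mono ji)).
by rewrite (min_idPl (sp_time_mono (ltnW ji))).
Qed.

End simple_process_cells.

Section refinement.
Context {R : realType} {d : measure_display} {Omega : measurableType d}.
Variables (P : probability Omega R) (F : R -> set (set Omega)).
Hypothesis HF : usual_filtration P F.
Variables (S : simple_process F) (p : nat).
Local Notation p' := p.+1.

(** The points that cut the i-th cell into p + 1 equal parts, and below in rt
    their enumeration as one sequence. *)
Definition rtime i j : R :=
  sp_time S i + j%:R / p'%:R * (sp_time S i.+1 - sp_time S i).

Lemma rtime_le i j : rtime i j <= rtime i j.+1.
Proof.
rewrite /rtime lerD2l ler_wpM2r ?subr_ge0 ?sp_time_nondecreasing//.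
by rewrite ler_wpM2r ?invr_ge0// ler_nat.
Qed.

Lemma rtime_ge i j : sp_time S i <= rtime i j.
Proof.
by rewrite /rtime lerDl mulr_ge0 ?subr_ge0 ?sp_time_nondecreasing// divr_ge0.
Qed.

Lemma rtime0 i : rtime i 0 = sp_time S i.
Proof. by rewrite /rtime !mul0r addr0. Qed.

Lemma rtimep i : rtime i p' = sp_time S i.+1.
Proof. by rewrite /rtime divff ?pnatr_eq0// mul1r subrKC. Qed.

Definition rt l : R := rtime (l %/ p') (l %% p').

Lemma rtS l : rt l.+1 = rtime (l %/ p') (l %% p').+1.
Proof.
rewrite /rt; have := ltn_pmod l (ltn0Sn p).
rewrite leq_eqVlt => /predU1P[e|lt].
  have lE : (l.+1 = (l %/ p').+1 * p')%N by rewrite {1}(divn_eq l p') -addnS e mulSn addnC.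
  by rewrite lE mulnK// modnMl rtime0 e rtimep.
have lE : (l.+1 = (l %/ p') * p' + (l %% p').+1)%N by rewrite {1}(divn_eq l p') -addnS.
by rewrite lE divnMDl// (divn_small lt) addn0 modnMDl modn_small.
Qed.

Lemma rt_ge0 l : 0 <= rt l.
Proof. exact: le_trans (sp_time_ge0 S _) (rtime_ge _ _). Qed.

Lemma rt_nd l : rt l <= rt l.+1.
Proof. by rewrite rtS rtime_le. Qed.

Lemma rval_meas l : Fmeasurable F (rt l) (sp_val S (l %/ p')).
Proof.
apply: (measG_mono HF (sp_time_ge0 S (l %/ p')) (rtime_ge _ _)).
exact: sp_val_measurable.
Qed.

Lemma rval_bounded : exists C, forall l omega, `|sp_val S (l %/ p') omega| <= C.
Proof. by have [C h] := sp_val_bounded S; exists C. Qed.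

Definition refine : simple_process F := @SimpleProcess _ _ _ _
  (sp_size S * p')%N rt (fun l => sp_val S (l %/ p')) rt_ge0 rt_nd rval_meas
  rval_bounded.

(** Both the values and the integrals of a simple process are sums of products
    of a cell value with an increment of some function phi of time, and such
    sums telescope over the subdivision of each cell. *)
Lemma refine_sum (phi : R -> R) omega :
  \sum_(l < sp_size refine) sp_val refine l omega *
      (phi (sp_time refine l.+1) - phi (sp_time refine l)) =
  \sum_(i < sp_size S) sp_val S i omega * (phi (sp_time S i.+1) - phi (sp_time S i)).
Proof.
rewrite /=; elim: (sp_size S) => [|n IH]; first by rewrite mul0n !big_ord0.
rewrite mulSn addnC big_split_ord/= IH [RHS]big_ord_recr/=; congr (_ + _).
transitivity (\sum_(j < p') sp_val S n omega * (phi (rtime n j.+1) - phi (rtime n j))).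
  apply: eq_bigr => j _; rewrite rtS /rt divnMDl// divn_small// addn0.
  by rewrite modnMDl modn_small.
rewrite -mulr_sumr; congr (_ * _).
rewrite -(big_mkord xpredT (fun j => phi (rtime n j.+1) - phi (rtime n j))).
by rewrite telescope_sumr// rtimep rtime0.
Qed.

Lemma refine_eval r omega : sp_eval refine r omega = sp_eval S r omega.
Proof.
have h (U : simple_process F) : sp_eval U r omega = \sum_(l < sp_size U)
    sp_val U l omega * ((r <= sp_time U l.+1)%R%:R - (r <= sp_time U l)%R%:R).
  rewrite sp_evalE; apply: eq_bigr => i _; congr (_ * _); rewrite tindE.
  have := sp_time_nondecreasing U i; rewrite ltNge.
  case: (boolP (r <= sp_time U i)) => /= [h1|h1] h2.
    by rewrite (le_trans h1 h2) subrr.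
  by rewrite subr0.
by rewrite !h; exact: (refine_sum (fun u => (r <= u)%R%:R)).
Qed.

Lemma refine_integral b t omega :
  sp_integral refine b t omega = sp_integral S b t omega.
Proof. exact: (refine_sum (fun u => b (Num.min u t) omega)). Qed.

Lemma refine_mesh e : 0 < e -> (\sum_(i < sp_size S) (sp_time S i.+1 - sp_time S i)) / e <= p%:R ->
  forall l, (l < sp_size refine)%N -> sp_time refine l.+1 - sp_time refine l <= e.
Proof.
move=> e0 pe l /= lS; rewrite rtS /rt /rtime.
have li : (l %/ p' < sp_size S)%N by rewrite ltn_divLR.
set i := (l %/ p')%N in li *.
rewrite -natr1; set b := sp_time S i.+1 - sp_time S i.
have -> : sp_time S i + ((l %% p')%:R + 1) / p'%:R * b -
    (sp_time S i + (l %% p')%:R / p'%:R * b) = b / p'%:R by ring.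
rewrite ler_pdivrMr// -ler_pdivrMl// mulrC.
apply: le_trans (le_trans pe _); last by rewrite ler_nat.
rewrite ler_pM2r ?invr_gt0//.
rewrite (bigD1 (Ordinal li))//= lerDl sumr_ge0// => k _.
by rewrite subr_ge0 sp_time_nondecreasing.
Qed.

End refinement.

(** * Truncation of a simple process by a clock *)

Section clock_path.
Context {R : realType}.
Local Notation leb := (@lebesgue_measure R).
Variable c : R -> R.
Hypotheses (c0 : c 0 = 0) (cnd : {homo c : s t / s <= t}) (cc : continuous c).
Variables (N T : R).
Hypotheses (N0 : 0 <= N) (T0 : 0 <= T).

(** The supremum of the times with c r <= N; continuity of c lets it belong to
    them. *)
Lemma last_time : exists tau, [/\ 0 <= tau, tau <= T, c tau <= N &
  forall r, 0 <= r -> r <= T -> c r <= N -> r <= tau].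
Proof.
pose A := [set r | 0 <= r <= T /\ c r <= N].
have A0 : A 0 by split; rewrite ?lexx ?c0.
have ubA : ubound A T by move=> r [/andP[_ rT] _].
have supA : has_sup A by split; [exists 0|exists T].
exists (sup A); split.
- exact: (ub_le_sup supA.2).
- by apply: ge_sup; [exists 0|].
- rewrite leNgt; apply/negP => NcA.
  have gap : 0 < c (sup A) - N by rewrite subr_gt0.
  have /cvgrPdist_lt/(_ _ gap)[e /= e0 eh] := @cc (sup A).
  have [r [rT rN] ler] := sup_adherent e0 supA.
  have rs : r <= sup A by apply: (ub_le_sup supA.2); split.
  have := eh r; rewrite /= ger0_norm ?subr_ge0// ltrBlDr -ltrBlDl => /(_ ler).
  rewrite ger0_norm ?subr_ge0; last exact: cnd.
  by rewrite ltrD2l ltrN2 ltNge rN.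
- by move=> r r0 rT rN; apply: (ub_le_sup supA.2); split => //; rewrite r0.
Qed.

(** The times at which c is at most N form an interval [0, tau] by continuity,
    and there the integral of g is at most c tau <= N. *)
Lemma clock_bound (g : R -> R) : (forall r, 0 <= g r) ->
  (forall s t, 0 <= s -> s <= t -> int1 leb (fun r => tind s t r * g r) /\
    \int[leb]_r (tind s t r * g r) <= c t - c s) ->
  int1 leb (fun r => tind 0 T r * ((c r <= N)%R%:R * g r)) /\
  \int[leb]_r (tind 0 T r * ((c r <= N)%R%:R * g r)) <= N.
Proof.
move=> g0 hg; have [tau [tau0 tauT ctau htau]] := last_time.
have [itau Etau] := hg 0 tau (lexx _) tau0.
have eqB r : tind 0 T r * ((c r <= N)%R%:R * g r) = tind 0 tau r * g r.
  rewrite !tindE; have [r0|//] := ltP 0 r; last by rewrite !mul0r.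
  have [rT|Tr] := leP r T; last by rewrite mul0r leNgt (le_lt_trans tauT Tr) mul0r.
  rewrite mul1r; case: (boolP (c r <= N)) => [rN|].
    by rewrite (htau r (ltW r0) rT rN).
  by rewrite -ltNge => Nr; case: (leP r tau) => // /cnd; rewrite leNgt (le_lt_trans ctau Nr).
split; first by rewrite (_ : (fun _ => _) = fun r => tind 0 tau r * g r)//; exact/funext.
by rewrite (eqE leb eqB) (le_trans Etau)// c0 subr0.
Qed.

End clock_path.

Section truncation.
Context {R : realType} {d : measure_display} {Omega : measurableType d}.
Variables (P : probability Omega R) (F : R -> set (set Omega)).
Hypothesis HF : usual_filtration P F.
Local Notation leb := (@lebesgue_measure R).
Variable C : R -> Omega -> R.
Hypothesis C0 : forall omega, C 0 omega = 0.
Hypothesis Cnd : forall omega, {homo C ^~ omega : s t / s <= t}.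
Hypothesis Cc : forall omega, continuous (C ^~ omega).
Hypothesis Cad : forall t, 0 <= t -> measG (F t) (C t).
Variables (N T : R).
Hypotheses (N0 : 0 <= N) (T0 : 0 <= T).

(** The indicator that the clock has not passed the level N. It replaces
    stopping at the passage time: r |-> Bind r omega is the indicator of a time
    interval starting at 0. *)
Definition Bind r omega : R := (C r omega <= N)%R%:R.

(** The energy of S up to a time u with C u <= N + 1 is at most
    2 (eps + N + 1) with eps <= 1 the squared distance from S to its target;
    this is the resulting bound. *)
Definition trunc_level : R := 2 * N + 4.

Section trunc_process.
Variable S : simple_process F.
Local Notation t_ := (sp_time S).

(** The value is erased once the clock has passed N, or once the energy of S
    exceeds the level that it cannot reach when S is close to its target. The
    truncated process thus has bounded energy on every path. *)
Definition tval i omega : R := sp_val S i omega * Bind (t_ i) omega *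
  (cenergy S T i omega <= trunc_level)%R%:R.

Lemma tval_meas i : Fmeasurable F (t_ i) (tval i).
Proof.
have ti := sp_time_ge0 S i; have sF := F_sigma HF ti.
have mv j : (j <= i)%N -> measG (F (t_ i)) (sp_val S j).
  move=> ji; apply: (measG_mono HF (sp_time_ge0 S j)); last exact: sp_val_measurable.
  exact: sp_time_mono.
apply: (measGM sF); first apply: (measGM sF).
- exact: mv.
- by apply: (measG_le_indic sF); exact: Cad.
- apply: (measG_le_indic sF); apply: (measG_sum sF) => j.
  apply: (measGM sF); last exact: measG_cst.
  by apply: (measGM sF); apply: mv; rewrite -ltnS.
Qed.

Lemma nat01 (b : bool) : `|b%:R : R| <= 1.
Proof. by case: b; rewrite ?normr1 ?normr0. Qed.

Lemma tval_bounded : exists c, forall i omega, `|tval i omega| <= c.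
Proof.
have [c h] := sp_val_bounded S; exists c => i omega.
rewrite /tval !normrM -[c]mulr1 ler_pM ?mulr_ge0 ?nat01//.
by rewrite -[c]mulr1 ler_pM ?nat01.
Qed.

Definition trunc : simple_process F := @SimpleProcess _ _ _ _ (sp_size S) t_ tval
  (sp_time_ge0 S) (sp_time_nondecreasing S) tval_meas tval_bounded.

Lemma trunc_level_ge0 : 0 <= trunc_level.
Proof. by rewrite /trunc_level addr_ge0// mulr_ge0. Qed.

Lemma trunc_energy omega :
  \int[leb]_r (tind 0 T r * sp_eval trunc r omega ^+ 2) <= trunc_level.
Proof.
rewrite sp_eval_sqr_E//=; elim: (sp_size S) => [|n IH].
  by rewrite big_ord0; exact: trunc_level_ge0.
have tle i : tval i omega ^+ 2 <= sp_val S i omega ^+ 2.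
  rewrite /tval !exprMn /Bind; case: (C _ _ <= N)%R;
  case: (cenergy _ _ _ _ <= _)%R => /=; by rewrite ?expr0n ?expr1n ?mulr1 ?mulr0 ?mul0r ?sqr_ge0.
case: (boolP (cenergy S T n omega <= trunc_level)) => h.
  apply: le_trans h; rewrite /cenergy; apply: ler_sum => i _.
  by rewrite ler_wpM2r ?tle// clen_ge0.
by rewrite big_ord_recr/= {2}/tval (negbTE h) mulr0 expr0n mul0r addr0.
Qed.

Definition stopped i omega := C (Num.min (t_ i) T) omega.

Definition cross i omega : R :=
  (stopped i omega <= N)%R%:R - (stopped i.+1 omega <= N)%R%:R.

(** The increment of the clock over the one cell in which it passes N, the only
    cell where truncating S and truncating its target may differ. *)
Definition overshoot omega : R := \sum_(i < sp_size S)
  cross i omega * (stopped i.+1 omega - stopped i omega).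

Lemma stopped_le i omega : stopped i omega <= stopped i.+1 omega.
Proof.
apply: Cnd; rewrite le_min !ge_min lexx orbT andbT; apply/orP; left.
exact: sp_time_nondecreasing.
Qed.

Lemma cross_ge0 i omega : 0 <= cross i omega.
Proof.
rewrite /cross subr_ge0 ler_nat; have := stopped_le i omega.
by case: (leP (stopped i.+1 omega) N) => // h1 h2; rewrite (le_trans h2 h1).
Qed.

Lemma overshoot_ge0 omega : 0 <= overshoot omega.
Proof.
by rewrite sumr_ge0// => i _; rewrite mulr_ge0 ?cross_ge0// subr_ge0 stopped_le.
Qed.

(** The factors cross sum up to at most 1, by telescoping. *)
Lemma overshoot_le omega e : 0 <= e ->
  (forall i, (i < sp_size S)%N -> stopped i omega <= N -> N < stopped i.+1 omega ->
     stopped i.+1 omega - stopped i omega <= e) ->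
  overshoot omega <= e.
Proof.
move=> e0 h; apply: (@le_trans _ _ (\sum_(i < sp_size S) cross i omega * e)).
  apply: ler_sum => i _; have [h1|h1] := boolP (stopped i omega <= N); last first.
    have h2 : (stopped i.+1 omega <= N) = false.
      by apply: contraNF h1; apply: le_trans; exact: stopped_le.
    by rewrite /cross (negbTE h1) h2 subrr !mul0r.
  have [h2|h2] := boolP (stopped i.+1 omega <= N).
    by rewrite /cross h1 h2 subrr !mul0r.
  by rewrite ler_wpM2l ?cross_ge0// h// ltNge.
rewrite -mulr_suml -[leRHS]mul1r ler_wpM2r// /cross sumrB.
rewrite -sumrB.
have -> : \sum_(i < sp_size S) ((stopped i omega <= N)%R%:R - (stopped i.+1 omega <= N)%R%:R) =
    - \sum_(0 <= i < sp_size S) ((stopped i.+1 omega <= N)%R%:R - (stopped i omega <= N)%R%:R) :> R.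
  by rewrite big_mkord -sumrN; apply: eq_bigr => i _; rewrite opprB.
by rewrite telescope_sumr//; case: (stopped (sp_size S) omega <= N)%R; case: (stopped 0 omega <= N)%R => /=; lra.
Qed.

Lemma overshoot_meas : measurable_fun setT overshoot.
Proof.
have ms i : measurable_fun setT (stopped i).
  have m0 : 0 <= Num.min (t_ i) T by rewrite le_min sp_time_ge0.
  exact: (measG_measurable HF m0 (Cad m0)).
have mi i : measurable_fun setT (fun omega => (stopped i omega <= N)%R%:R : R).
  have m0 : 0 <= Num.min (t_ i) T by rewrite le_min sp_time_ge0.
  by apply: (measG_measurable HF m0); apply: (measG_le_indic (F_sigma HF m0)); exact: Cad.
apply: measurable_sum => i; apply: measurable_funM; apply: measurable_funB => //.
Qed.

Lemma cross_le_overshoot (i : 'I_(sp_size S)) omega : stopped i omega <= N ->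
  N < stopped i.+1 omega -> stopped i.+1 omega - stopped i omega <= overshoot omega.
Proof.
move=> h1 h2; rewrite /overshoot (bigD1 i)//= /cross h1 (leNgt (stopped _ _)) h2/= subr0 mul1r.
by rewrite lerDl sumr_ge0// => k _; rewrite mulr_ge0 ?cross_ge0// subr_ge0 stopped_le.
Qed.

End trunc_process.

Section path_estimate.
Variables (S : simple_process F) (H : R -> Omega -> R) (omega : Omega).
Local Notation t_ := (sp_time S).
Hypothesis mH : measurable_fun setT (H ^~ omega).
Hypothesis HC : forall s t, 0 <= s -> s <= t ->
  int1 leb (fun r => tind s t r * H r omega ^+ 2) /\
  \int[leb]_r (tind s t r * H r omega ^+ 2) <= C t omega - C s omega.

Let sigma r := sp_eval S r omega.
Let h r := H r omega.
Let eps := \int[leb]_r (tind 0 T r * (sigma r - h r) ^+ 2).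

Lemma sp_eval_path_meas (U : simple_process F) : measurable_fun setT (fun r => sp_eval U r omega).
Proof.
apply: measurable_sum => i; apply: measurable_funM => //; exact: tind_meas.
Qed.

Lemma eps_int1 : int1 leb (fun r => tind 0 T r * (sigma r - h r) ^+ 2).
Proof.
have i1 := sp_eval_sqr_int1 S T omega; have i2 := (HC (lexx 0) T0).1.
apply: (int1_le _ (int1Z 2 (int1D i1 i2))).
  apply: measurable_funM; first exact: tind_meas.
  by apply: measurable_funX; apply: measurable_funB => //; exact: sp_eval_path_meas.
move=> r /=; rewrite ger0_norm ?tind_sqr_ge0//.
apply: (@le_trans _ _ (tind 0 T r * (2 * (sigma r ^+ 2 + (- h r) ^+ 2)))).
  by rewrite ler_wpM2l ?tind_ge0// sqrD_le.
by rewrite le_eqVlt; apply/orP; left; apply/eqP; rewrite /sigma /h; ring.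
Qed.

Hypothesis eps1 : eps <= 1.

Lemma energy_ok (i : 'I_(sp_size S)) : C (Num.min (t_ i.+1) T) omega <= N + 1 ->
  cenergy S T i omega <= trunc_level.
Proof.
move=> hC; apply: (le_trans (cenergy_le i omega T0)).
set u := Num.min _ T in hC *.
have u0 : 0 <= u by rewrite le_min sp_time_ge0.
have uT : u <= T by rewrite ge_min lexx orbT.
have [i2 E2] := HC (lexx 0) u0.
have tu r : tind 0 u r <= tind 0 T r.
  rewrite !tindE ler_nat; case: (0 < r)%R => //=.
  by case: (leP r u) => // ru; rewrite (le_trans ru uT).
apply: (@le_trans _ _ (2 * (eps + \int[leb]_r (tind 0 u r * h r ^+ 2)))); last first.
  by rewrite /trunc_level; move: E2 eps1 hC; rewrite C0 -/h; lra.
rewrite /eps -(ED eps_int1 i2) -(EZ _ (int1D eps_int1 i2)).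
apply: E_le => [||r]; [exact: sp_eval_sqr_int1|by apply: int1Z; exact: int1D eps_int1 i2|].
have : tind 0 u r * sigma r ^+ 2 <= 2 * (tind 0 u r * (sigma r - h r) ^+ 2 + tind 0 u r * h r ^+ 2).
  have -> : 2 * (tind 0 u r * (sigma r - h r) ^+ 2 + tind 0 u r * h r ^+ 2) =
    tind 0 u r * (2 * ((sigma r - h r) ^+ 2 + h r ^+ 2)) by ring.
  rewrite ler_wpM2l ?tind_ge0//.
  by rewrite -{1}(subrK (h r) (sigma r)) sqrD_le.
move/le_trans; apply; rewrite ler_pM2l// lerD2r ler_wpM2r ?sqr_ge0//.
Qed.

Lemma trunc_integral b : C T omega <= N ->
  sp_integral (trunc S) b T omega = sp_integral S b T omega.
Proof.
move=> CTN; apply: eq_bigr => i _ /=.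
have [Ti|iT] := leP T (t_ i).
  have Ti1 := le_trans Ti (sp_time_nondecreasing S i).
  by rewrite (min_idPr Ti1) subrr !mulr0.
congr (_ * _); rewrite /tval /Bind (le_trans (Cnd omega (ltW iT)) CTN).
rewrite energy_ok ?mulr1// (le_trans _ (_ : N <= N + 1)) ?lerDl//.
by apply: le_trans CTN; apply: Cnd; rewrite ge_min lexx orbT.
Qed.

Let zeta r := sp_eval (trunc S) r omega.

Hypothesis over1 : overshoot S omega <= 1.

(** Off the cell in which the clock passes N, the truncated process is S where
    its target is H, and 0 where its target is 0. *)
Lemma trunc_pointwise r : tind 0 T r * (zeta r - Bind r omega * h r) ^+ 2 <=
  2 * (tind 0 T r * (sigma r - h r) ^+ 2) + 2 * \sum_(i < sp_size S)
   cross S i omega * (tind (Num.min (t_ i) T) (Num.min (t_ i.+1) T) r * h r ^+ 2).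
Proof.
set Q := \sum_(i < _) _.
have Q0 : 0 <= Q.
  by apply: sumr_ge0 => i _; rewrite mulr_ge0 ?cross_ge0 ?tind_sqr_ge0.
have R0 : 0 <= 2 * (tind 0 T r * (sigma r - h r) ^+ 2) + 2 * Q.
  by apply: addr_ge0; apply: mulr_ge0 => //; exact: tind_sqr_ge0.
rewrite [tind 0 T r]tindE; case: (boolP ((0 < r) && (r <= T))) => /=; last first.
  by move=> _; rewrite !mul0r mulr0 add0r mulr_ge0.
move=> /andP[r0 rT]; rewrite !mul1r.
have B01 : Bind r omega = 0 \/ Bind r omega = 1.
  by rewrite /Bind; case: (C r omega <= N)%R; [right|left].
have [[i [ir ri]]|nocell] := pselect (exists i : 'I_(sp_size S), t_ i < r /\ r <= t_ i.+1); last first.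
  have z0 : zeta r = 0 by apply: sp_eval_nocell => i hi; apply: nocell; exists i.
  have s0 : sigma r = 0 by apply: sp_eval_nocell => i hi; apply: nocell; exists i.
  rewrite z0 s0 !sub0r !sqrrN; have := sqr_ge0 (h r).
  by case: B01 => ->; rewrite ?mul0r ?mul1r ?expr0n/=; lra.
have zi : zeta r = tval S i omega by exact: (@sp_eval_cell _ _ _ _ (trunc S) i).
have si : sigma r = sp_val S i omega by exact: sp_eval_cell.
have iT : t_ i < T by exact: lt_le_trans rT.
have sti : stopped S i omega = C (t_ i) omega by rewrite /stopped (min_idPl (ltW iT)).
have sti1 : C r omega <= stopped S i.+1 omega.
  by apply: Cnd; rewrite le_min ri rT.
have d0 := sqr_ge0 (sigma r - h r).
have [CiN|NCi] := leP (C (t_ i) omega) N; last first.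
  have z0 : zeta r = 0 by rewrite zi /tval /Bind leNgt NCi/= mulr0 mul0r.
  have B0 : Bind r omega = 0.
    by rewrite /Bind leNgt (lt_le_trans NCi) //; apply: Cnd; exact: ltW.
  by rewrite z0 B0 mul0r subr0 expr0n/=; lra.
have next : stopped S i.+1 omega <= N + 1.
  have [le1|lt1] := boolP (stopped S i.+1 omega <= N).
    by apply: le_trans le1 _; rewrite lerDl.
  have h1 : stopped S i omega <= N by rewrite sti.
  have h2 : N < stopped S i.+1 omega by rewrite ltNge.
  by have h3 := cross_le_overshoot h1 h2; move: (stopped _ _ _) (stopped S i omega) (overshoot S omega) h1 h2 h3 over1 => *; lra.
have zs : zeta r = sigma r.
  by rewrite zi si /tval /Bind CiN energy_ok ?mulr1.
rewrite zs; case: B01 => B; rewrite B ?mul1r; last by lra.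
rewrite mul0r subr0.
have CrN : N < C r omega by move/eqP: B; rewrite /Bind pnatr_eq0 eqb0 -ltNge.
have QH : h r ^+ 2 <= Q.
  rewrite /Q (bigD1 i)//= /cross sti CiN (leNgt (stopped _ _ _)) (lt_le_trans CrN sti1)/= subr0 mul1r.
  rewrite tindE gt_min ir le_min ri rT/= mul1r lerDl sumr_ge0// => k _.
  by rewrite -/(cross S k omega) mulr_ge0 ?cross_ge0 ?tind_sqr_ge0.
by rewrite -{1}(subrK (h r) (sigma r)) (le_trans (sqrD_le _ _))//; lra.
Qed.

(** The only cell where truncating costs something is the one in which the clock
    passes N; the energy of H on this cell is at most the overshoot. *)
Lemma trunc_path_estimate :
  \int[leb]_r (tind 0 T r * (zeta r - Bind r omega * h r) ^+ 2) <= 2 * eps + 2 * overshoot S omega.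
Proof.
pose m i := Num.min (t_ i) T.
have m0 i : 0 <= m i by rewrite le_min sp_time_ge0.
have mm i : m i <= m i.+1.
  by rewrite le_min !ge_min lexx orbT andbT sp_time_nondecreasing.
have HCi i := HC (m0 i) (mm i).
have iQ : int1 leb (fun r => \sum_(i < sp_size S)
   cross S i omega * (tind (m i) (m i.+1) r * h r ^+ 2)).
  by apply: int1_sum => i; apply: int1Z; exact: (HCi i).1.
have iR := int1D (int1Z 2 eps_int1) (int1Z 2 iQ).
apply: (@le_trans _ _ (\int[leb]_r (2 * (tind 0 T r * (sigma r - h r) ^+ 2) + 2 * \sum_(i < sp_size S)
   cross S i omega * (tind (m i) (m i.+1) r * h r ^+ 2)))).
  apply: E_le => //; last exact: trunc_pointwise.
  apply: (int1_le _ iR); last first.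
    move=> r; rewrite ger0_norm ?tind_sqr_ge0//; exact: trunc_pointwise.
  apply: measurable_funM; first exact: tind_meas.
  apply: measurable_funX; apply: measurable_funB; first exact: sp_eval_path_meas.
  apply: measurable_funM => //; apply: measurable_le_indic.
  by apply: continuous_measurable_fun => x; exact: Cc.
rewrite (ED (int1Z 2 eps_int1) (int1Z 2 iQ)) (EZ _ eps_int1) (EZ _ iQ) -/eps lerD2l ler_pM2l//.
rewrite E_sum; last by move=> i; apply: int1Z; exact: (HCi i).1.
apply: ler_sum => i _; rewrite (EZ _ (HCi i).1) ler_wpM2l ?cross_ge0//.
exact: (HCi i).2.
Qed.

End path_estimate.

End truncation.

(** * Mean-square approximation of the stopped integrand *)

Section tonelli.
Context {R : realType} {d : measure_display} {Omega : measurableType d}.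
Variable P : probability Omega R.
Local Notation leb := (@lebesgue_measure R).
Local Notation M := (leb \x P)%E.
Variable g : R * Omega -> R.
Hypotheses (mg : measurable_fun setT g) (g0 : forall z, 0 <= g z).
Hypothesis ig : forall omega, int1 leb (fun r => g (r, omega)).

Let mgE : measurable_fun setT (EFin \o g).
Proof. exact/measurable_EFinP. Qed.

Lemma tonelli_meas : measurable_fun setT (fun omega => \int[leb]_r g (r, omega)).
Proof.
have := @measurable_fun_fubini_tonelli_G _ _ _ _ R leb (EFin \o g) mgE
  (fun z => g0 z).
move=> h; rewrite (_ : (fun _ => _) = fun omega => fine (fubini_G leb (EFin \o g) omega)) //.
exact: measurableT_comp h.
Qed.

Lemma tonelli_E : int1 P (fun omega => \int[leb]_r g (r, omega)) ->
  int1 M g /\ \int[M]_z g z = \int[P]_omega \int[leb]_r g (r, omega).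
Proof.
move=> iG.
have E : (\int[M]_z (g z)%:E = (\int[P]_omega \int[leb]_r g (r, omega))%:E)%E.
  rewrite (@fubini_tonelli2 _ _ _ _ R leb P (EFin \o g) mgE (fun z => g0 z)).
  rewrite -E_fin//; apply: eq_integral => omega _.
  by rewrite /fubini_G -E_fin.
split; last by rewrite /Rintegral E.
by apply: int1_ge0 => //; rewrite E ltry.
Qed.

End tonelli.

Lemma E_sqrB {R : realType} {d} {U : measurableType d} (m : {measure set U -> \bar R})
    (f g : U -> R) : sqint m f -> sqint m g -> \int[m]_x ((f x - g x) ^+ 2) =
  \int[m]_x (f x * f x) - 2 * \int[m]_x (f x * g x) + \int[m]_x (g x * g x).
Proof.
move=> sf sg; have i1 := sqintM sf sf; have i2 := sqintM sf sg.
have i3 := sqintM sg sg.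
rewrite -(EZ 2 i2) -(EB i1 (int1Z 2 i2)) -(ED (int1B i1 (int1Z 2 i2)) i3).
by apply: eqE => x; ring.
Qed.

Section ito_approximation.
Context {R : realType} {d : measure_display} {Omega : measurableType d}.
Variables (P : probability Omega R) (F : R -> set (set Omega)).
Variables (q : nat) (K : 'M[R]_q) (w : R -> Omega -> 'cV[R]_q).
Hypotheses (HF : usual_filtration P F) (Hw : wiener_process P F K w).
Local Notation leb := (@lebesgue_measure R).
Local Notation M := (leb \x P)%E.
Local Notation SI S j := (sp_integral S (fun s omega => w s omega j 0)).

Lemma sp_eval_meas (S : simple_process F) :
  measurable_fun setT (fun z : R * Omega => sp_eval S z.1 z.2).
Proof.
apply: measurable_sum => i; apply: measurable_funM.
  have mv : measurable_fun setT (sp_val S i).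
    apply: (measG_measurable HF (sp_time_ge0 S i)); exact: sp_val_measurable.
  by apply: (measurableT_comp mv); exact: measurable_snd.
apply: (measurableT_comp (tind_meas (sp_time S i) (sp_time S i.+1))).
exact: measurable_fst.
Qed.

Lemma tind_fst_meas (s t : R) : measurable_fun setT (fun z : R * Omega => tind s t z.1).
Proof. by apply: (measurableT_comp (tind_meas s t)); exact: measurable_fst. Qed.

Lemma tind_sqr (s t r : R) : tind s t r ^+ 2 = tind s t r.
Proof. by rewrite tindE; case: (_ && _); rewrite ?expr1n ?expr0n. Qed.

Lemma iso_diff (Z Z' : simple_process F) j T : 0 <= T ->
  \int[P]_omega ((SI Z j T omega - SI Z' j T omega) ^+ 2) =
  K j j * \int[M]_z ((tind 0 T z.1 * sp_eval Z z.1 z.2 - tind 0 T z.1 * sp_eval Z' z.1 z.2) ^+ 2).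
Proof.
move=> T0; have e a b := isometry HF Hw a b j j (lexx 0) T0.
have s1 := SI_sqint HF Hw Z j T0; have s2 := SI_sqint HF Hw Z' j T0.
have u1 := sp_eval_sqint HF Z (lexx 0) T0; have u2 := sp_eval_sqint HF Z' (lexx 0) T0.
rewrite (E_sqrB s1 s2) (E_sqrB u1 u2).
have e' (a b : simple_process F) : \int[P]_x (SI a j T x * SI b j T x) =
    K j j * \int[M]_z ((tind 0 T z.1 * sp_eval a z.1 z.2) *
                      (tind 0 T z.1 * sp_eval b z.1 z.2)).
  by rewrite -e; apply: eqE => x; rewrite !SI0 !subr0.
by rewrite !e'; ring.
Qed.

Lemma Kjj_ge0 j : 0 <= K j j.
Proof.
have := inc_cov HF Hw j j (lexx 0) ler01; rewrite subr0 mulr1 => <-.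
by apply: E_ge0 => x; rewrite -expr2 sqr_ge0.
Qed.

Variable C : R -> Omega -> R.
Hypothesis C0 : forall omega, C 0 omega = 0.
Hypothesis Cnd : forall omega, {homo C ^~ omega : s t / s <= t}.
Hypothesis Cc : forall omega, continuous (C ^~ omega).
Hypothesis Cad : forall t, 0 <= t -> measG (F t) (C t).
Hypothesis Cm : measurable_fun setT (fun z : R * Omega => C z.1 z.2).
Variable N : R.
Hypothesis N0 : 0 <= N.
Local Notation B := (Bind C N).

Lemma B_meas : measurable_fun setT (fun z : R * Omega => B z.1 z.2).
Proof. exact: measurable_le_indic. Qed.

Lemma B_F t : 0 <= t -> bmeas F t (B t).
Proof.
move=> t0; split; first by apply: (measG_le_indic (F_sigma HF t0)); exact: Cad.
by exists 1 => x; exact: nat01.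
Qed.

Lemma B_sqr r omega : B r omega ^+ 2 = B r omega.
Proof. by rewrite /Bind; case: (C r omega <= N)%R; rewrite ?expr1n ?expr0n. Qed.

Lemma B_ge0 r omega : 0 <= B r omega.
Proof. by rewrite /Bind. Qed.

Lemma B_le1 r omega : B r omega <= 1.
Proof. by rewrite /Bind; case: (C r omega <= N)%R. Qed.

Variable H : R -> Omega -> R.
Hypothesis mH : measurable_fun setT (fun z : R * Omega => H z.1 z.2).
Hypothesis HC : forall omega s t, 0 <= s -> s <= t ->
  int1 leb (fun r => tind s t r * H r omega ^+ 2) /\
  \int[leb]_r (tind s t r * H r omega ^+ 2) <= C t omega - C s omega.

(** Together with ito_lim below, the real-valued counterpart of the definition
    of an Ito integral: J is a limit in probability of integrals of simple
    processes that converge to H in probability in L^2([0, T]). *)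
Definition gap_energy (S : simple_process F) T omega : R :=
  \int[leb]_r (tind 0 T r * (sp_eval S r omega - H r omega) ^+ 2).

Lemma mH_path omega : measurable_fun setT (H ^~ omega).
Proof. exact: (measurableT_comp mH (measurable_pair2 omega)). Qed.

Definition ito_lim j T (J : Omega -> R) := measurable_fun setT J /\
  exists S : nat -> simple_process F,
  cvgP0 P (fun k omega => gap_energy (S k) T omega) /\
  cvgP0 P (fun k omega => SI (S k) j T omega - J omega).

Section fixed_horizon.
Variables (j : 'I_q) (T : R) (J : Omega -> R).
Hypothesis T0 : 0 <= T.

Lemma gap_energy_meas S : measurable_fun setT (gap_energy S T).
Proof.
apply: (@tonelli_meas _ _ _ (fun z : R * Omega => tind 0 T z.1 * (sp_eval S z.1 z.2 - H z.1 z.2) ^+ 2)).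
  apply: measurable_funM; first exact: tind_fst_meas.
  by apply: measurable_funX; apply: measurable_funB => //; exact: sp_eval_meas.
by move=> z; exact: tind_sqr_ge0.
Qed.

(** The approximations aim at B H, the integrand stopped by the clock, whose
    energy is at most N on every path. *)
Definition target_gap (Z : simple_process F) omega :=
  \int[leb]_r (tind 0 T r * (sp_eval Z r omega - B r omega * H r omega) ^+ 2).

Lemma BH_path omega :
  int1 leb (fun r => tind 0 T r * (B r omega * H r omega) ^+ 2) /\
  \int[leb]_r (tind 0 T r * (B r omega * H r omega) ^+ 2) <= N.
Proof.
have [i E] := @clock_bound _ (C ^~ omega) (C0 omega) (@Cnd omega) (@Cc omega) N T N0 T0
  (fun r => H r omega ^+ 2) (fun r => sqr_ge0 _) (HC omega).
have e r : tind 0 T r * (B r omega * H r omega) ^+ 2 =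
    tind 0 T r * ((C r omega <= N)%R%:R * H r omega ^+ 2).
  by rewrite exprMn B_sqr.
rewrite (eqE leb e); split=> //.
by rewrite (_ : (fun _ => _) = fun r => tind 0 T r * ((C r omega <= N)%R%:R * H r omega ^+ 2))//; exact/funext.
Qed.

Lemma gap_meas_fun (Z : simple_process F) :
  measurable_fun setT (fun z : R * Omega => tind 0 T z.1 * (sp_eval Z z.1 z.2 - B z.1 z.2 * H z.1 z.2) ^+ 2).
Proof.
apply: measurable_funM; first exact: tind_fst_meas.
apply: measurable_funX; apply: measurable_funB; first exact: sp_eval_meas.
by apply: measurable_funM => //; exact: B_meas.
Qed.

Lemma target_gap_int1 (Z : simple_process F) omega :
  int1 leb (fun r => tind 0 T r * (sp_eval Z r omega - B r omega * H r omega) ^+ 2) /\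
  target_gap Z omega <= 2 * \int[leb]_r (tind 0 T r * sp_eval Z r omega ^+ 2) + 2 * N.
Proof.
have i1 := sp_eval_sqr_int1 Z T omega; have [i2 E2] := BH_path omega.
have le r : tind 0 T r * (sp_eval Z r omega - B r omega * H r omega) ^+ 2 <=
    2 * (tind 0 T r * sp_eval Z r omega ^+ 2) + 2 * (tind 0 T r * (B r omega * H r omega) ^+ 2).
  apply: (@le_trans _ _ (tind 0 T r * (2 * (sp_eval Z r omega ^+ 2 + (- (B r omega * H r omega)) ^+ 2)))).
    by rewrite ler_wpM2l ?tind_ge0// sqrD_le.
  by rewrite le_eqVlt; apply/orP; left; apply/eqP; ring.
have i3 := int1D (int1Z 2 i1) (int1Z 2 i2).
have i : int1 leb (fun r => tind 0 T r * (sp_eval Z r omega - B r omega * H r omega) ^+ 2).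
  apply: (int1_le _ i3); last by move=> r; rewrite ger0_norm ?tind_sqr_ge0//; exact: le.
  exact: (measurableT_comp (gap_meas_fun Z) (measurable_pair2 omega)).
split=> //; apply: le_trans (E_le i i3 le) _.
by rewrite (ED (int1Z 2 i1) (int1Z 2 i2)) (EZ _ i1) (EZ _ i2) lerD2l ler_pM2l.
Qed.

Lemma target_gap_meas Z : measurable_fun setT (target_gap Z).
Proof.
apply: (@tonelli_meas _ _ _ (fun z : R * Omega => tind 0 T z.1 * (sp_eval Z z.1 z.2 - B z.1 z.2 * H z.1 z.2) ^+ 2)).
  exact: gap_meas_fun.
by move=> z; exact: tind_sqr_ge0.
Qed.

Lemma target_gap_ge0 Z omega : 0 <= target_gap Z omega.
Proof. by apply: E_ge0 => r; exact: tind_sqr_ge0. Qed.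

Local Notation tr S := (trunc HF Cad N T S).

Lemma gap_cap S omega : target_gap (tr S) omega <= 2 * trunc_level N + 2 * N.
Proof.
apply: le_trans (target_gap_int1 _ _).2 _.
by rewrite lerD2r ler_pM2l// trunc_energy.
Qed.

(** On the event that S is within e of H, the path estimate applies as soon as
    the overshoot is at most 1; otherwise the bound on the energies is used. *)
Lemma gap_est S omega e : 0 < e -> e <= 1 -> target_gap (tr S) omega <=
  2 * e + (2 + (2 * trunc_level N + 2 * N)) * Num.min (overshoot C N T S omega) 1 +
  (2 * trunc_level N + 2 * N) * \1_[set x | e <= `|gap_energy S T x|] omega.
Proof.
move=> e0 e1; set Mc := 2 * trunc_level N + 2 * N.
have Mc0 : 0 <= Mc by rewrite addr_ge0 ?mulr_ge0 ?trunc_level_ge0.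
have o0 := overshoot_ge0 Cnd N T S omega.
have m0 : 0 <= Num.min (overshoot C N T S omega) 1 by rewrite le_min o0 ler01.
have cap := gap_cap S omega; rewrite -/Mc in cap.
rewrite indicE; have [|] := boolP (omega \in _).
  move=> _; rewrite mulr1; apply: (le_trans cap); rewrite lerDr.
  by move: m0 Mc0; move: (Mc) (Num.min _ _) => x y; nra.
rewrite notin_setE/= => /negP; rewrite -ltNge ger0_norm; last first.
  by apply: E_ge0 => r; exact: tind_sqr_ge0.
move=> lte; rewrite mulr0 addr0.
have [v1|v1] := leP (overshoot C N T S omega) 1; last first.
  rewrite mulr1; apply: (le_trans cap); move: (Mc) => x; lra.
have := trunc_path_estimate HF C0 Cnd Cc Cad T0 (mH_path omega) (HC omega)
  (le_trans (ltW lte) e1) v1.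
rewrite -/(gap_energy S T omega) -/(target_gap (tr S) omega).
move=> /le_trans; apply; move: lte Mc0 o0.
move: (Mc) (gap_energy _ _ _) (overshoot _ _ _ _ _) => x y z; nra.
Qed.

(** A cell in which the clock passes N contains the last time tau with
    C tau <= N, and C is continuous at tau. *)
Lemma overshoot_cvg (S : nat -> simple_process F) omega :
  (forall k l, (l < sp_size (S k))%N ->
     sp_time (S k) l.+1 - sp_time (S k) l <= k.+1%:R^-1) ->
  (fun k => overshoot C N T (S k) omega) @ \oo --> (0 : R).
Proof.
move=> mesh.
have [tau [tau0 tauT ctau htau]] := @last_time _ (C ^~ omega) (C0 omega) (@Cnd omega) (@Cc omega) N T N0 T0.
apply/cvgrPdist_le => e e0.
have e20 : 0 < e / 2 by rewrite divr_gt0.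
have /cvgrPdist_lt/(_ _ e20)[del /= del0 delh] := @Cc omega tau.
near=> k; rewrite sub0r normrN ger0_norm ?overshoot_ge0//.
apply: (overshoot_le Cnd (ltW e0)) => i iS.
rewrite /stopped; set u := Num.min _ T; set v := Num.min _ T => uN Nv.
have u0 : 0 <= u by rewrite le_min sp_time_ge0.
have uT : u <= T by rewrite ge_min lexx orbT.
have uv : v - u <= k.+1%:R^-1.
  apply: le_trans (mesh _ _ iS); rewrite /u /v.
  have := sp_time_nondecreasing (S k) i.
  move: (sp_time _ i) (sp_time _ i.+1) => a b ab.
  by have [aT|Ta] := leP a T; have [bT|Tb] := leP b T; lra.
have utau : u <= tau by apply: htau.
have tauv : tau <= v.
  have [//|vt] := leP tau v.
  by have := Cnd omega (ltW vt); rewrite leNgt (le_lt_trans ctau Nv).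
have small : k.+1%:R^-1 < del.
  by near: k; exact: near_infty_natSinv_lt (PosNum del0).
have h1 : `|C tau omega - C u omega| < e / 2.
  apply: delh; rewrite /= ger0_norm ?subr_ge0//.
  by apply: le_lt_trans small; apply: le_trans uv; rewrite lerD2r.
have h2 : `|C tau omega - C v omega| < e / 2.
  apply: delh; rewrite /= ler0_norm ?subr_le0// opprB.
  by apply: le_lt_trans small; apply: le_trans uv; rewrite lerD2l lerN2.
by move: h1 h2; rewrite !ltr_norml => /andP[? ?] /andP[? ?]; lra.
Unshelve. all: by end_near. Qed.

Lemma BH_sqint : sqint M (fun z => tind 0 T z.1 * (B z.1 z.2 * H z.1 z.2)).
Proof.
have mBH : measurable_fun setT (fun z : R * Omega => B z.1 z.2 * H z.1 z.2).
  by apply: measurable_funM => //; exact: B_meas.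
have mg : measurable_fun setT (fun z : R * Omega => tind 0 T z.1 * (B z.1 z.2 * H z.1 z.2) ^+ 2).
  by apply: measurable_funM; [exact: tind_fst_meas|exact: measurable_funX].
split; first by apply: measurable_funM => //; exact: tind_fst_meas.
rewrite (_ : (fun _ => _) = fun z : R * Omega => tind 0 T z.1 * (B z.1 z.2 * H z.1 z.2) ^+ 2); last first.
  by apply/funext => z; rewrite exprMn tind_sqr.
apply: (tonelli_E mg (fun z => tind_sqr_ge0 _ _ _ _) (fun omega => (BH_path omega).1) _).1.
apply: (@int1_bounded _ _ _ _ _ N).
  exact: (tonelli_meas mg (fun z => tind_sqr_ge0 _ _ _ _)).
move=> omega; rewrite ger0_norm; first exact: (BH_path omega).2.
by apply: E_ge0 => r; exact: tind_sqr_ge0.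
Qed.

(** The squared distance to the stopped integrand in L^2 of time times
    probability. *)
Definition gapM (Z : simple_process F) := \int[M]_z
  ((tind 0 T z.1 * sp_eval Z z.1 z.2 - tind 0 T z.1 * (B z.1 z.2 * H z.1 z.2)) ^+ 2).

Lemma gapM_trunc S : gapM (tr S) = \int[P]_omega target_gap (tr S) omega.
Proof.
rewrite /gapM; transitivity (\int[M]_z (tind 0 T z.1 *
   (sp_eval (tr S) z.1 z.2 - B z.1 z.2 * H z.1 z.2) ^+ 2)).
  by apply: eqE => z; rewrite -mulrBr exprMn tind_sqr.
apply: (tonelli_E (gap_meas_fun (tr S)) (fun z => tind_sqr_ge0 _ _ _ _)
  (fun omega => (target_gap_int1 (tr S) omega).1) _).2.
apply: (@int1_bounded _ _ _ _ _ (2 * trunc_level N + 2 * N)).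
  exact: target_gap_meas.
by move=> omega; rewrite ger0_norm ?target_gap_ge0//; exact: gap_cap.
Qed.

Lemma exists_refinement (S : nat -> simple_process F) :
  exists S' : nat -> simple_process F, [/\
   forall k r omega, sp_eval (S' k) r omega = sp_eval (S k) r omega,
   forall k b t omega, sp_integral (S' k) b t omega = sp_integral (S k) b t omega &
   forall k l, (l < sp_size (S' k))%N ->
     sp_time (S' k) l.+1 - sp_time (S' k) l <= k.+1%:R^-1].
Proof.
pose tot k := \sum_(i < sp_size (S k)) (sp_time (S k) i.+1 - sp_time (S k) i).
have tot0 k : 0 <= tot k.
  by apply: sumr_ge0 => i _; rewrite subr_ge0 sp_time_nondecreasing.
exists (fun k => refine HF (S k) (Num.bound (tot k / k.+1%:R^-1))); split.
- by move=> *; exact: refine_eval.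
- by move=> *; exact: refine_integral.
- move=> k l; apply: refine_mesh; first by rewrite invr_gt0.
  apply: ltW; apply: archi_boundP; apply: divr_ge0; first exact: tot0.
  by rewrite invr_ge0.
Qed.

(** The stopped integrand is approximated in mean square: the truncated
    processes have uniformly bounded energy, so convergence in probability is
    dominated. *)
Lemma ito_trunc : ito_lim j T J -> exists Z : nat -> simple_process F, [/\
  forall k omega, \int[leb]_r (tind 0 T r * sp_eval (Z k) r omega ^+ 2) <= trunc_level N,
  (fun k => gapM (Z k)) @ \oo --> (0 : R) &
  cvgP0 P (fun k omega => B T omega * SI (Z k) j T omega - B T omega * J omega)].
Proof.
move=> [mJ [S0 [eps0 SJ0]]].
have [S [Sev Sint mesh]] := exists_refinement S0.
have epsE k omega : gap_energy (S k) T omega = gap_energy (S0 k) T omega.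
  by apply: eqE => r; rewrite Sev.
have eps : cvgP0 P (fun k omega => gap_energy (S k) T omega).
  move=> e e0; apply: cvg_trans (eps0 e e0); apply: near_eq_cvg.
  apply: nearW => k; congr (fine (P _)).
  by apply/seteqP; split=> x /=; rewrite epsE.
exists (fun k => tr (S k)); split.
- by move=> k omega; apply: trunc_energy.
- have o_lim : (fun k => \int[P]_omega Num.min (overshoot C N T (S k) omega) 1) @ \oo --> (0 : R).
    apply: (@E_dct0 _ _ _ P _ (fun=> 1)).
    + move=> k; apply: measurable_minr => //; exact: (overshoot_meas HF).
    + move=> omega; apply: (@cvg0_squeeze _ _ (fun k => overshoot C N T (S k) omega)).
        move=> k; rewrite ger0_norm; first by rewrite ge_min lexx.
        by rewrite le_min overshoot_ge0 ?ler01.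
      exact: overshoot_cvg.
    + exact: int1_cst.
    + move=> k omega; rewrite ger0_norm; first by rewrite ge_min lexx orbT.
      by rewrite le_min overshoot_ge0 ?ler01.
  set Mc := 2 * trunc_level N + 2 * N.
  have bound e k : 0 < e -> e <= 1 -> gapM (tr (S k)) <= 2 * e +
      (2 + Mc) * \int[P]_omega Num.min (overshoot C N T (S k) omega) 1 +
      Mc * fine (P [set x | e <= `|gap_energy (S k) T x|]).
    move=> e0 e1; rewrite gapM_trunc.
    have mA : measurable [set x | e <= `|gap_energy (S k) T x|].
      by apply: measurable_ge_norm; exact: gap_energy_meas.
    have i1 : int1 P (fun omega => Num.min (overshoot C N T (S k) omega) 1).
      apply: (@int1_bounded _ _ _ _ _ 1).
        by apply: measurable_minr => //; exact: (overshoot_meas HF).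
      move=> omega; rewrite ger0_norm; first by rewrite ge_min lexx orbT.
      by rewrite le_min overshoot_ge0 ?ler01.
    have i2 := int1Z (2 + Mc) i1; have i3 := int1Z Mc (int1_indic P mA).
    rewrite -(E_indic P mA) -(EZ _ (int1_indic P mA)) -[X in X + _ + _](E_cst P (2 * e)).
    rewrite -(EZ _ i1) -(ED (int1_cst P (2 * e)) i2) -(ED (int1D (int1_cst P (2 * e)) i2) i3).
    apply: E_le; last by move=> omega; exact: gap_est.
      apply: (@int1_bounded _ _ _ _ _ Mc); first exact: target_gap_meas.
      by move=> omega; rewrite ger0_norm ?target_gap_ge0//; exact: gap_cap.
    by apply: int1D => //; apply: int1D => //; exact: int1_cst.
  apply/cvgrPdist_le => e e0.
  pose e' := Num.min (e / 4) 1.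
  have e'0 : 0 < e' by rewrite lt_min divr_gt0/=.
  have e'1 : e' <= 1 by rewrite ge_min lexx orbT.
  have e'e : 2 * e' <= e / 2.
    by have : e' <= e / 4; [rewrite ge_min lexx|lra].
  have lim : (fun k => (2 + Mc) * \int[P]_omega Num.min (overshoot C N T (S k) omega) 1 +
      Mc * fine (P [set x | e' <= `|gap_energy (S k) T x|])) @ \oo --> (0 : R).
    rewrite -[X in _ --> X]addr0 -[X in _ --> X + _](mulr0 (2 + Mc)) -[X in _ --> _ + X](mulr0 Mc).
    by apply: cvgD; apply: cvgMr => //; exact: eps.
  have e20 : 0 < e / 2 by rewrite divr_gt0.
  move/cvgrPdist_le: lim => /(_ _ e20) lim.
  near=> k; rewrite sub0r normrN ger0_norm; last by apply: E_ge0 => z; exact: sqr_ge0.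
  apply: (le_trans (bound e' k e'0 e'1)).
  have : `|0 - ((2 + Mc) * \int[P]_omega Num.min (overshoot C N T (S k) omega) 1 +
      Mc * fine (P [set x | e' <= `|gap_energy (S k) T x|]))| <= e / 2.
    by near: k; exact: lim.
  rewrite sub0r normrN => h; rewrite -addrA.
  by have := le_trans (ler_norm _) h; lra.
- move=> e e0.
  have mA k : measurable [set x | e <= `|SI (S0 k) j T x - J x|].
    apply: measurable_ge_norm; apply: measurable_funB => //.
    exact: (SI_sqint HF Hw _ j T0).1.
  have mE k : measurable [set x | 1 <= `|gap_energy (S k) T x|].
    by apply: measurable_ge_norm; exact: gap_energy_meas.
  apply: (@cvg0_squeeze _ _ (fun k => fine (P [set x | e <= `|SI (S0 k) j T x - J x|]) +
     fine (P [set x | 1 <= `|gap_energy (S k) T x|]))); last first.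
    by rewrite -[X in _ --> X]addr0; apply: cvgD; [exact: SJ0|exact: eps].
  move=> k; rewrite ger0_norm ?fine_ge0//.
  rewrite -fineD; [|exact: fin_num_measure|exact: fin_num_measure].
  have mB : measurable [set x | e <= `|B T x * SI (tr (S k)) j T x - B T x * J x|].
    apply: measurable_ge_norm; have mBT := measG_measurable HF T0 (B_F T0).1.
    apply: measurable_funB; apply: measurable_funM => //.
    exact: (SI_sqint HF Hw _ j T0).1.
  rewrite fine_le//; [exact: fin_num_measure|by rewrite fin_numD !fin_num_measure|].
  apply: le_trans (measureU2 _ (mA k) (mE k)).
  apply: le_measure; rewrite ?inE//; first exact: measurableU.
  move=> x /= h; have [g1|g1] := leP 1 `|gap_energy (S k) T x|; [by right|left].
  move: h; rewrite /Bind; case: (boolP (C T x <= N)) => CTN; last first.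
    by rewrite !mul0r subrr normr0 leNgt e0.
  rewrite !mul1r (trunc_integral HF C0 Cnd Cad T0 (mH_path x) (HC x))// ?Sint//.
  by apply: le_trans (ltW g1); exact: ler_norm.
Unshelve. all: by end_near. Qed.

End fixed_horizon.
End ito_approximation.

(** * Iterated integrals, and approximation at all times *)

Section fubini_real.
Context {R : realType} {d1 d2} {T1 : measurableType d1} {T2 : measurableType d2}.
Variables (m1 : {sigma_finite_measure set T1 -> \bar R}).
Variables (m2 : {sigma_finite_measure set T2 -> \bar R}).
Local Notation M := (m1 \x m2)%E.
Implicit Type g : T1 * T2 -> R.

Lemma fubini_fst g : int1 M g -> (forall x, int1 m2 (fun y => g (x, y))) ->
  int1 m1 (fun x => \int[m2]_y g (x, y)) /\
  \int[M]_z g z = \int[m1]_x \int[m2]_y g (x, y).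
Proof.
move=> ig i2.
have E x : (fubini_F m2 (EFin \o g) x = (\int[m2]_y g (x, y))%:E)%E.
  by rewrite /fubini_F -E_fin.
have i1 := integrable_fubini_F ig.
split; first by rewrite /int1 (_ : _ \o _ = fubini_F m2 (EFin \o g))//; apply/funext => x; rewrite E.
congr fine; rewrite -(integral12_prod_meas1 ig).
by apply: eq_integral => x _; rewrite E.
Qed.

Lemma fubini_snd g : int1 M g -> (forall y, int1 m1 (fun x => g (x, y))) ->
  \int[M]_z g z = \int[m2]_y \int[m1]_x g (x, y).
Proof.
move=> ig i2; congr fine; rewrite -(integral21_prod_meas1 ig).
by apply: eq_integral => y _; rewrite /fubini_G -E_fin.
Qed.

Lemma tonelli_fst g : measurable_fun setT g -> (forall z, 0 <= g z) ->
  (forall x, int1 m2 (fun y => g (x, y))) ->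
  int1 m1 (fun x => \int[m2]_y g (x, y)) -> int1 M g.
Proof.
move=> mg g0 i2 i1; have mgE : measurable_fun setT (EFin \o g) by exact/measurable_EFinP.
apply: int1_ge0 => //.
rewrite (@fubini_tonelli1 _ _ _ _ R m1 m2 (EFin \o g) mgE (fun z => g0 z)).
rewrite (eq_integral (fun x => (\int[m2]_y g (x, y))%:E)%E).
  by rewrite E_fin// ltry.
by move=> x _; rewrite /fubini_F -E_fin.
Qed.

Lemma int1_posneg {d} {T : measurableType d} (m : {measure set T -> \bar R}) (f : T -> R) :
  int1 m f -> [/\ int1 m (fun x => Num.max (f x) 0), int1 m (fun x => Num.max (- f x) 0) &
  \int[m]_x f x = \int[m]_x Num.max (f x) 0 - \int[m]_x Num.max (- f x) 0].
Proof.
move=> fi; have mf := int1_measurable fi; have ni := int1_norm fi.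
have i1 : int1 m (fun x => Num.max (f x) 0).
  apply: (int1_le _ ni); first exact: measurable_maxr.
  by move=> x; rewrite ger0_norm ?le_max ?lexx ?orbT// ge_max normr_ge0 ler_norm.
have i2 : int1 m (fun x => Num.max (- f x) 0).
  apply: (int1_le _ ni); first by apply: measurable_maxr => //; exact: measurableT_comp mf.
  by move=> x; rewrite ger0_norm ?le_max ?lexx ?orbT// ge_max normr_ge0 -normrN ler_norm.
split=> //; rewrite -(EB i1 i2); apply: eqE => x.
have [h|h] := leP (f x) 0; first by rewrite max_l ?sub0r ?opprK// oppr_ge0.
by rewrite max_r ?subr0// oppr_le0 ltW.
Qed.

(** For a signed integrand the parts f^+ and f^- are treated separately. *)
Lemma param_int_meas g : measurable_fun setT g ->
  (forall y, int1 m1 (fun x => g (x, y))) ->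
  measurable_fun setT (fun y => \int[m1]_x g (x, y)).
Proof.
move=> mg ig.
have pos (f : T1 * T2 -> R) : measurable_fun setT f -> (forall z, 0 <= f z) ->
    measurable_fun setT (fun y => \int[m1]_x f (x, y)).
  move=> mf f0; have mfE : measurable_fun setT (EFin \o f) by exact/measurable_EFinP.
  have h := @measurable_fun_fubini_tonelli_G _ _ _ _ R m1 (EFin \o f) mfE (fun z => f0 z).
  rewrite (_ : (fun _ => _) = fun y => fine (fubini_G m1 (EFin \o f) y)) //.
  exact: measurableT_comp h.
rewrite (_ : (fun _ => _) = fun y => \int[m1]_x Num.max (g (x, y)) 0 -
   \int[m1]_x Num.max (- g (x, y)) 0); last first.
  by apply/funext => y; have [_ _ ->] := int1_posneg (ig y).
apply: measurable_funB.
  apply: (pos (fun z => Num.max (g z) 0)); first exact: measurable_maxr.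
  by move=> z; rewrite le_max lexx orbT.
apply: (pos (fun z => Num.max (- g z) 0)).
  by apply: measurable_maxr => //; exact: measurableT_comp mg.
by move=> z; rewrite le_max lexx orbT.
Qed.

End fubini_real.

Section approximation_at_all_times.
Context {R : realType} {d : measure_display} {Omega : measurableType d}.
Variables (P : probability Omega R) (F : R -> set (set Omega)).
Variables (q : nat) (K : 'M[R]_q) (w : R -> Omega -> 'cV[R]_q).
Hypotheses (HF : usual_filtration P F) (Hw : wiener_process P F K w).
Local Notation leb := (@lebesgue_measure R).
Local Notation M := (leb \x P)%E.
Local Notation SI S j := (sp_integral S (fun s omega => w s omega j 0)).
Variable C : R -> Omega -> R.
Hypothesis C0 : forall omega, C 0 omega = 0.
Hypothesis Cnd : forall omega, {homo C ^~ omega : s t / s <= t}.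
Hypothesis Cc : forall omega, continuous (C ^~ omega).
Hypothesis Cad : forall t, 0 <= t -> measG (F t) (C t).
Hypothesis Cm : measurable_fun setT (fun z : R * Omega => C z.1 z.2).
Variable N : R.
Hypothesis N0 : 0 <= N.
Local Notation B := (Bind C N).
Variable H : R -> Omega -> R.
Hypothesis mH : measurable_fun setT (fun z : R * Omega => H z.1 z.2).
Hypothesis HC : forall omega s t, 0 <= s -> s <= t ->
  int1 leb (fun r => tind s t r * H r omega ^+ 2) /\
  \int[leb]_r (tind s t r * H r omega ^+ 2) <= C t omega - C s omega.
Variables (j : 'I_q) (T : R) (J : R -> Omega -> R).
Hypothesis T0 : 0 <= T.
Hypothesis HJ : forall r, 0 <= r -> r <= T -> ito_lim P F w H j r (J r).

Local Notation gap Z T := (gapM P C N H T Z).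

Lemma gap_sqint s t (Z : simple_process F) : 0 <= s -> s <= t ->
  sqint M (fun z => tind s t z.1 * sp_eval Z z.1 z.2 - tind s t z.1 * (B z.1 z.2 * H z.1 z.2)).
Proof.
move=> s0 st; apply: sqintB; first exact: (sp_eval_sqint HF).
have := @sqint_bdM _ _ _ M (fun z : R * Omega => tind s t z.1) _ 1 (tind_fst_meas s t)
  (fun z => tind_norm _ _ _) (BH_sqint P C0 Cnd Cc Cm N0 mH HC (le_trans s0 st)).
congr sqint; apply/funext => z; rewrite mulrA; congr (_ * _).
by rewrite tindI (max_idPl s0) minxx.
Qed.

Lemma gap_mono s t (Z : simple_process F) : 0 <= s -> s <= t -> t <= T ->
  \int[M]_z ((tind s t z.1 * sp_eval Z z.1 z.2 -
    tind s t z.1 * (B z.1 z.2 * H z.1 z.2)) ^+ 2) <= gap Z T.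
Proof.
move=> s0 st tT; apply: E_le; [exact: (gap_sqint Z s0 st).2|exact: (gap_sqint Z (lexx 0) T0).2|].
move=> z; rewrite -!mulrBr !exprMn !tind_sqr ler_wpM2r ?sqr_ge0//.
exact: tind_le.
Qed.

(** By the isometry, and the triangle inequality through the common target. *)
Lemma iso_gap (Z Z' : simple_process F) r : 0 <= r -> r <= T ->
  \int[P]_omega ((SI Z j r omega - SI Z' j r omega) ^+ 2) <=
  2 * K j j * (gap Z T + gap Z' r).
Proof.
move=> r0 rT; rewrite (iso_diff HF Hw)// [2 * _]mulrC -mulrA ler_wpM2l ?(Kjj_ge0 HF Hw)//.
have s1 := gap_sqint Z (lexx 0) r0; have s2 := gap_sqint Z' (lexx 0) r0.
apply: (@le_trans _ _ (2 * (\int[M]_z ((tind 0 r z.1 * sp_eval Z z.1 z.2 -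
    tind 0 r z.1 * (B z.1 z.2 * H z.1 z.2)) ^+ 2) + gap Z' r))); last first.
  by rewrite ler_pM2l// lerD2r; exact: gap_mono.
rewrite -(ED s1.2 s2.2) -(EZ _ (int1D s1.2 s2.2)); apply: E_le.
- exact: (sqintB (sp_eval_sqint HF Z (lexx 0) r0) (sp_eval_sqint HF Z' (lexx 0) r0)).2.
- by apply: int1Z; exact: int1D s1.2 s2.2.
move=> z; set a := tind _ _ _ * _; set b := tind _ _ _ * sp_eval Z' _ _.
set c := tind _ _ _ * (_ * _).
have -> : a - b = (a - c) + - (b - c) by ring.
by rewrite (le_trans (sqrD_le _ _))// sqrrN.
Qed.

Lemma SI_sqr_bound (Z : simple_process F) r : 0 <= r -> r <= T ->
  (forall omega, \int[leb]_r (tind 0 T r * sp_eval Z r omega ^+ 2) <= trunc_level N) ->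
  \int[P]_omega (SI Z j r omega ^+ 2) <= K j j * trunc_level N.
Proof.
move=> r0 rT eZ.
have -> : \int[P]_omega (SI Z j r omega ^+ 2) =
    \int[P]_omega ((SI Z j r omega - SI Z j 0 omega) * (SI Z j r omega - SI Z j 0 omega)).
  by apply: eqE => x; rewrite SI0 subr0 expr2.
rewrite (isometry HF Hw)// ler_wpM2l ?(Kjj_ge0 HF Hw)//.
have mg : measurable_fun setT (fun z : R * Omega => tind 0 T z.1 * sp_eval Z z.1 z.2 ^+ 2).
  apply: measurable_funM; first exact: tind_fst_meas.
  by apply: measurable_funX; exact: (sp_eval_meas HF).
have i1 : int1 P (fun omega => \int[leb]_r (tind 0 T r * sp_eval Z r omega ^+ 2)).
  apply: (@int1_bounded _ _ _ _ _ (trunc_level N)).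
    exact: (tonelli_meas mg (fun z => tind_sqr_ge0 _ _ _ _)).
  by move=> omega; rewrite ger0_norm//; apply: E_ge0 => u; exact: tind_sqr_ge0.
have [iM EM] := tonelli_E mg (fun z => tind_sqr_ge0 _ _ _ _)
  (fun omega => sp_eval_sqr_int1 Z T omega) i1.
apply: (@le_trans _ _ (\int[M]_z (tind 0 T z.1 * sp_eval Z z.1 z.2 ^+ 2))).
  apply: E_le => //.
    exact: sqintM (sp_eval_sqint HF Z (lexx 0) r0) (sp_eval_sqint HF Z (lexx 0) r0).
  move=> z; rewrite -expr2 exprMn tind_sqr ler_wpM2r ?sqr_ge0//.
  exact: tind_le.
rewrite EM -[leRHS](E_cst P); apply: E_le => //; exact: int1_cst.
Qed.

(** One sequence of simple processes, built for the horizon T, approximates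
    the stochastic integrals at all earlier times: at time r it is compared
    with the sequence built for the horizon r, through the isometry. *)
Lemma approx_all : exists Z : nat -> simple_process F, [/\
  forall k omega, \int[leb]_r (tind 0 T r * sp_eval (Z k) r omega ^+ 2) <= trunc_level N,
  (fun k => gap (Z k) T) @ \oo --> (0 : R) &
  forall r, 0 <= r -> r <= T -> [/\ sqint P (fun omega => B r omega * J r omega),
    l2cvg P (fun k omega => B r omega * SI (Z k) j r omega) (fun omega => B r omega * J r omega) &
    \int[P]_omega ((B r omega * J r omega) ^+ 2) <= K j j * trunc_level N]].
Proof.
have [Z [eZ gZ _]] := ito_trunc HF Hw C0 Cnd Cc Cad Cm N0 mH HC T0 (HJ T0 (lexx T)).
exists Z; split=> // r r0 rT.
have [Z' [_ gZ' cZ']] := ito_trunc HF Hw C0 Cnd Cc Cad Cm N0 mH HC r0 (HJ r0 rT).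
have mB := B_F HF Cad N r0 : bmeas F r (B r).
have mBm := measG_measurable HF r0 mB.1.
have mJ := (HJ r0 rT).1.
have sSI (U : simple_process F) : sqint P (fun omega => B r omega * SI U j r omega).
  by apply: (bmeas_mul_sqint HF r0 mB); exact: (SI_sqint HF Hw).
pose delta k := k.+1%:R^-1 : R.
have delta0 k : 0 < delta k by rewrite invr_gt0.
have key k : sqint P (fun omega => B r omega * SI (Z k) j r omega - B r omega * J r omega) /\
   \int[P]_omega ((B r omega * SI (Z k) j r omega - B r omega * J r omega) ^+ 2) <=
   2 * (2 * K j j * (gap (Z k) T + delta k)).
  apply: (@fatou_prob _ _ _ P (fun k' omega => B r omega * SI (Z k) j r omega - B r omega * SI (Z' k') j r omega)).
  - by move=> k'; exact: sqintB.
  - by apply: measurable_funB; [exact: (sSI _).1|exact: measurable_funM].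
  - move=> e e0; apply: cvg_trans (cZ' e e0); apply: near_eq_cvg; apply: nearW => k'.
    congr (fine (P _)); apply/seteqP.
    have h x : B r x * SI (Z k) j r x - B r x * SI (Z' k') j r x -
        (B r x * SI (Z k) j r x - B r x * J r x) = - (B r x * SI (Z' k') j r x - B r x * J r x).
      by ring.
    by split=> x /=; rewrite h normrN.
  - move/cvgrPdist_le: gZ' => /(_ _ (delta0 k)) small.
    near=> k'.
    apply: (@le_trans _ _ (2 * K j j * (gap (Z k) T + gap (Z' k') r))).
      apply: le_trans (iso_gap (Z k) (Z' k') r0 rT).
      apply: E_le.
      + exact: (sqintB (sSI (Z k)) (sSI (Z' k'))).2.
      + exact: (sqintB (SI_sqint HF Hw (Z k) j r0) (SI_sqint HF Hw (Z' k') j r0)).2.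
      + move=> x; rewrite -mulrBr exprMn B_sqr -[leRHS]mul1r ler_wpM2r ?sqr_ge0//.
        exact: B_le1.
    rewrite ler_wpM2l ?mulr_ge0 ?(Kjj_ge0 HF Hw)// lerD2l.
    have : `|0 - gap (Z' k') r| <= delta k by near: k'.
    by rewrite sub0r normrN; exact: le_trans (ler_norm _).
have sBJ : sqint P (fun omega => B r omega * J r omega).
  rewrite (_ : (fun _ => _) = fun omega => B r omega * SI (Z 0%N) j r omega -
     (B r omega * SI (Z 0%N) j r omega - B r omega * J r omega)).
    by apply: sqintB => //; exact: (key 0%N).1.
  by apply/funext => x; ring.
have l2 : l2cvg P (fun k omega => B r omega * SI (Z k) j r omega) (fun omega => B r omega * J r omega).
  apply: (@cvg0_squeeze _ _ (fun k => 2 * (2 * K j j * (gap (Z k) T + delta k)))).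
    move=> k; rewrite ger0_norm; first exact: (key k).2.
    by apply: E_ge0 => x; exact: sqr_ge0.
  rewrite [X in _ --> X](_ : _ = 2 * (2 * K j j * (0 + 0))); last by ring.
  apply: cvgMr; apply: cvgMr; apply: cvgD; first exact: gZ.
  exact: (@cvg_harmonic R).
split=> //.
have lim := l2cvg_prod (fun k => sSI (Z k)) (fun k => sSI (Z k)) sBJ sBJ l2 l2.
have -> : \int[P]_omega ((B r omega * J r omega) ^+ 2) =
    \int[P]_omega (B r omega * J r omega * (B r omega * J r omega)).
  by apply: eqE => x; rewrite expr2.
rewrite -(cvg_lim _ lim)//; apply: limr_le; first by apply/cvg_ex; eexists; exact: lim.
apply: nearW => k; apply: le_trans (SI_sqr_bound r0 rT (eZ k)).
apply: E_le; [exact: sqintM (sSI _) (sSI _)|exact: (SI_sqint HF Hw (Z k) j r0).2|].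
move=> x; rewrite -expr2 exprMn B_sqr -[leRHS]mul1r ler_wpM2r ?sqr_ge0//.
exact: B_le1.
Unshelve. all: by end_near. Qed.

End approximation_at_all_times.

(** * The square of an integral, and limits in mean square *)

Section square_of_integral.
Context {R : realType}.
Local Notation leb := (@lebesgue_measure R).

Lemma le_fst_meas : measurable_fun setT (fun z : R * R => (z.1 <= z.2)%R%:R : R).
Proof.
rewrite (_ : (fun _ => _) = fun z : R * R => (z.1 - z.2 <= 0)%R%:R).
  by apply: measurable_le_indic; apply: measurable_funB.
by apply/funext => z; rewrite subr_le0.
Qed.

(** Fubini and symmetry: the triangles u <= r and r <= u contribute equally to
    the double integral of h(u) h(r), and they overlap in a null set. *)
Lemma sqr_integral (h : R -> R) : int1 leb h ->
  (\int[leb]_r h r) ^+ 2 = 2 * \int[leb]_r (h r * \int[leb]_u ((u <= r)%R%:R * h u)).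
Proof.
move=> ih; have mh := int1_measurable ih.
have tri_meas (r : R) : measurable_fun setT (fun u : R => (u <= r)%R%:R : R).
  exact: measurable_le_indic.
have tri (r : R) : int1 leb (fun u => (u <= r)%R%:R * h u).
  apply: (@int1_bdM _ _ _ leb _ _ 1 _ _ ih); first exact: tri_meas.
  by move=> u; exact: nat01.
have tri' (u : R) : int1 leb (fun r => (u <= r)%R%:R * h r).
  apply: (@int1_bdM _ _ _ leb _ _ 1 _ _ ih) => [|r]; last exact: nat01.
  rewrite (_ : (fun _ => _) = fun r : R => (u - r <= 0)%R%:R : R).
    by apply: measurable_le_indic; exact: measurable_funB.
  by apply/funext => r; rewrite subr_le0.
pose f (z : R * R) := (z.1 <= z.2)%R%:R * (h z.1 * h z.2).
have [ihh _] := int1_prod ih ih.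
have iF : int1 (leb \x leb)%E f.
  apply: (@int1_bdM _ _ _ _ _ _ 1 _ _ ihh); first exact: le_fst_meas.
  by move=> z; exact: nat01.
pose X := \int[leb]_r (h r * \int[leb]_u ((u <= r)%R%:R * h u)).
have fE1 : \int[(leb \x leb)%E]_z f z = X.
  rewrite (fubini_snd iF); last first.
    move=> r; rewrite (_ : (fun _ => _) = fun u => h r * ((u <= r)%R%:R * h u)).
      exact: int1Z.
    by apply/funext => u; rewrite /f/=; ring.
  apply: eqE => r; rewrite -(EZ _ (tri r)); apply: eqE => u.
  by rewrite /f/=; ring.
have i2 (u : R) : int1 leb (fun r => f (u, r)).
  rewrite (_ : (fun _ => _) = fun r => h u * ((u <= r)%R%:R * h r)).
    exact: int1Z.
  by apply/funext => r; rewrite /f/=; ring.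
have fE2 : \int[(leb \x leb)%E]_z f z = \int[leb]_u (h u * \int[leb]_r ((u <= r)%R%:R * h r)).
  rewrite (fubini_fst iF i2).2.
  apply: eqE => u; rewrite -(EZ _ (tri' u)); apply: eqE => r.
  by rewrite /f/=; ring.
have inner (u : R) : \int[leb]_r ((u <= r)%R%:R * h r) =
    \int[leb]_r h r - \int[leb]_r ((r <= u)%R%:R * h r).
  rewrite -(EB ih (tri u)); apply: E_ae_eq.
  - exact: int1_measurable (tri' u).
  - by apply: measurable_funB => //; exact: int1_measurable (tri u).
  - exists [set u]; split => //; first exact: lebesgue_measure_set1.
    move=> r /= hr; apply: contrapT => ru; apply: hr.
    have [ur|ur|/esym//] := ltgtP u r; first by rewrite mul1r mul0r subr0.
    by rewrite mul1r mul0r subrr.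
have ihI : int1 leb (fun u => h u * \int[leb]_r ((r <= u)%R%:R * h r)).
  have i1 := (fubini_fst iF i2).1.
  rewrite (_ : (fun _ => _) = fun u => h u * \int[leb]_r h r - \int[leb]_r f (u, r)).
    apply: int1B => //.
    rewrite (_ : (fun _ => _) = fun u => (\int[leb]_r h r) * h u); first exact: int1Z.
    by apply/funext => u; rewrite mulrC.
  apply/funext => u.
  have -> : \int[leb]_r f (u, r) = h u * \int[leb]_r ((u <= r)%R%:R * h r).
    by rewrite -(EZ _ (tri' u)); apply: eqE => r; rewrite /f/=; ring.
  by rewrite inner; ring.
have : X = (\int[leb]_r h r) ^+ 2 - X.
  rewrite -{1}fE1 fE2 /X.
  transitivity (\int[leb]_u ((\int[leb]_r h r) * h u - h u * \int[leb]_r ((r <= u)%R%:R * h r))).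
    by apply: eqE => u; rewrite inner; ring.
  by rewrite (EB (int1Z _ ih) ihI) (EZ _ ih) expr2.
rewrite -/X; lra.
Qed.

End square_of_integral.

Lemma cvgn_sum (R : realType) I (r : seq I) (u : I -> nat -> R) (l : I -> R) :
  (forall i, u i @ \oo --> l i) ->
  (fun k => \sum_(i <- r) u i k) @ \oo --> \sum_(i <- r) l i.
Proof.
move=> ul; elim: r => [|i r IH].
  rewrite big_nil (_ : (fun k => _) = fun=> 0); first exact: cvg_cst.
  by apply/funext => k; rewrite big_nil.
rewrite big_cons (_ : (fun k => _) = fun k => u i k + \sum_(j <- r) u j k).
  by apply: cvgD.
by apply/funext => k; rewrite big_cons.
Qed.

Section l2_limits.
Context {d} {T : measurableType d} {R : realType}.
Variable m : {measure set T -> \bar R}.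

Lemma l2cvg_cst (f : T -> R) : l2cvg m (fun=> f) f.
Proof.
rewrite /l2cvg (_ : (fun _ => _) = fun=> 0); first exact: cvg_cst.
apply/funext => k; rewrite -[RHS](E0 m); apply: eqE => x.
by rewrite subrr expr0n.
Qed.

Lemma l2cvgD (u v : nat -> T -> R) f g :
  (forall k, sqint m (u k)) -> (forall k, sqint m (v k)) -> sqint m f -> sqint m g ->
  l2cvg m u f -> l2cvg m v g ->
  l2cvg m (fun k x => u k x + v k x) (fun x => f x + g x).
Proof.
move=> su sv sf sg uf vg.
have s1 k := sqintB (su k) sf; have s2 k := sqintB (sv k) sg.
apply: (@cvg0_squeeze _ _ (fun k => 2 * (\int[m]_x ((u k x - f x) ^+ 2) +
    \int[m]_x ((v k x - g x) ^+ 2)))); last first.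
  rewrite [X in _ --> X](_ : _ = 2 * (0 + 0)); last by ring.
  by apply: cvgMr; apply: cvgD.
move=> k; rewrite ger0_norm; last by apply: E_ge0 => x; exact: sqr_ge0.
rewrite -(ED (s1 k).2 (s2 k).2) -(EZ _ (int1D (s1 k).2 (s2 k).2)).
apply: E_le.
- exact: (sqintB (sqintD (su k) (sv k)) (sqintD sf sg)).2.
- by apply: int1Z; exact: int1D (s1 k).2 (s2 k).2.
- move=> x; rewrite (_ : u k x + v k x - _ = (u k x - f x) + (v k x - g x)); last by ring.
  exact: sqrD_le.
Qed.

Lemma l2cvgZ c (u : nat -> T -> R) f :
  (forall k, sqint m (u k)) -> sqint m f -> l2cvg m u f ->
  l2cvg m (fun k x => c * u k x) (fun x => c * f x).
Proof.
move=> su sf uf; rewrite /l2cvg -(mulr0 (c ^+ 2)).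
rewrite (_ : (fun _ => _) = fun k => c ^+ 2 * \int[m]_x ((u k x - f x) ^+ 2)).
  exact: cvgMr.
apply/funext => k; rewrite -(EZ _ (sqintB (su k) sf).2); apply: eqE => x.
by rewrite -mulrBr exprMn.
Qed.

Lemma l2cvg_sum I (r : seq I) (u : I -> nat -> T -> R) (f : I -> T -> R) :
  (forall i k, sqint m (u i k)) -> (forall i, sqint m (f i)) ->
  (forall i, l2cvg m (u i) (f i)) ->
  l2cvg m (fun k x => \sum_(i <- r) u i k x) (fun x => \sum_(i <- r) f i x).
Proof.
move=> su sf uf; elim: r => [|i r IH].
  rewrite (_ : (fun _ => _) = fun=> fun=> 0); last by apply/funext => k; apply/funext => x; rewrite big_nil.
  rewrite [X in l2cvg _ _ X](_ : _ = fun=> 0); last by apply/funext => x; rewrite big_nil.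
  exact: l2cvg_cst.
have h := l2cvgD (su i) (fun k => sqint_sum r (fun j => su j k)) (sf i) (sqint_sum r sf) (uf i) IH.
have e1 : (fun k x => \sum_(j <- i :: r) u j k x) = fun k x => u i k x + \sum_(j <- r) u j k x.
  by apply/funext => k; apply/funext => x; rewrite big_cons.
have e2 : (fun x => \sum_(j <- i :: r) f j x) = fun x => f i x + \sum_(j <- r) f j x.
  by apply/funext => x; rewrite big_cons.
by rewrite e1 e2.
Qed.

Lemma l2cvg_bdM (b : T -> R) (u : nat -> T -> R) f : measurable_fun setT b ->
  (forall x, `|b x| <= 1) -> (forall k, sqint m (u k)) -> sqint m f ->
  l2cvg m u f -> l2cvg m (fun k x => b x * u k x) (fun x => b x * f x).
Proof.
move=> mb b1 su sf uf; apply: cvg0_squeeze uf => k.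
rewrite ger0_norm; last by apply: E_ge0 => x; exact: sqr_ge0.
have s := sqintB (su k) sf; have sb := sqint_bdM mb b1 s.
rewrite (@eqE _ _ _ m _ (fun x => (b x * (u k x - f x)) ^+ 2)); last by move=> x; rewrite mulrBr.
apply: E_le; [exact: sb.2|exact: s.2|].
move=> x; rewrite exprMn -[leRHS]mul1r ler_wpM2r ?sqr_ge0//.
by rewrite -real_normK ?num_real// exprn_ile1.
Qed.

Lemma l2cvg_ae (u : nat -> T -> R) f g :
  (forall k, sqint m (u k)) -> sqint m f -> sqint m g ->
  {ae m, forall x, f x = g x} -> l2cvg m u f -> l2cvg m u g.
Proof.
move=> su sf sg fg; rewrite /l2cvg.
rewrite [in X in _ -> X](_ : (fun k => _) = fun k => \int[m]_x ((u k x - f x) ^+ 2))//.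
apply/funext => k; apply: E_ae_eq.
- by apply: measurable_sqr; exact: (sqintB (su k) sg).1.
- by apply: measurable_sqr; exact: (sqintB (su k) sf).1.
- by apply: filterS fg => x ->.
Qed.

Lemma sqint_ae (f g : T -> R) : measurable_fun setT g -> {ae m, forall x, f x = g x} ->
  sqint m f -> sqint m g.
Proof.
move=> mg fg [mf f2]; split=> //; apply: int1_ae_eq f2; first exact: measurable_sqr.
by apply: filterS fg => x ->.
Qed.

End l2_limits.

(** * The energy inequality for a scalar Ito process *)

Section scalar_ito.
Context {R : realType} {d : measure_display} {Omega : measurableType d}.
Variables (P : probability Omega R) (F : R -> set (set Omega)).
Variables (q : nat) (K : 'M[R]_q) (w : R -> Omega -> 'cV[R]_q).
Hypotheses (HF : usual_filtration P F) (Hw : wiener_process P F K w).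
Local Notation leb := (@lebesgue_measure R).
Local Notation M := (leb \x P)%E.
Local Notation SI S j := (sp_integral S (fun s omega => w s omega j 0)).
Variable C : R -> Omega -> R.
Hypothesis C0 : forall omega, C 0 omega = 0.
Hypothesis Cnd : forall omega, {homo C ^~ omega : s t / s <= t}.
Hypothesis Cc : forall omega, continuous (C ^~ omega).
Hypothesis Cad : forall t, 0 <= t -> measG (F t) (C t).
Hypothesis Cm : measurable_fun setT (fun z : R * Omega => C z.1 z.2).
Variable N : R.
Hypothesis N0 : 0 <= N.
Local Notation B := (Bind C N).
Variables (I : finType) (jj : I -> 'I_q) (c : I -> R) (H : I -> R -> Omega -> R).
Variable J : I -> R -> Omega -> R.
Hypothesis mH : forall a, measurable_fun setT (fun z : R * Omega => H a z.1 z.2).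
Hypothesis HC : forall a omega s t, 0 <= s -> s <= t ->
  int1 leb (fun r => tind s t r * H a r omega ^+ 2) /\
  \int[leb]_r (tind s t r * H a r omega ^+ 2) <= C t omega - C s omega.
Variables D zeta : R -> Omega -> R.
Hypothesis mD : measurable_fun setT (fun z : R * Omega => D z.1 z.2).
Hypothesis Dad : forall r, 0 <= r -> measG (F r) (D r).
Hypothesis DC : forall omega s t, 0 <= s -> s <= t ->
  int1 leb (fun r => tind s t r * `|D r omega|) /\
  \int[leb]_r (tind s t r * `|D r omega|) <= C t omega - C s omega.
Hypothesis mzeta : measurable_fun setT (fun z : R * Omega => zeta z.1 z.2).
Hypothesis zetaad : forall r, 0 <= r -> measG (F r) (zeta r).
Variables (T z0 : R).
Hypothesis T0 : 0 <= T.
Hypothesis HJ : forall a r, 0 <= r -> r <= T -> ito_lim P F w (H a) (jj a) r (J a r).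
Hypothesis sde : forall r, 0 <= r -> r <= T -> {ae P, forall omega,
  zeta r omega = z0 + (\int[leb]_u (tind 0 r u * D u omega)) + \sum_a c a * J a r omega}.

Lemma path_meas (f : R -> Omega -> R) omega :
  measurable_fun setT (fun z : R * Omega => f z.1 z.2) -> measurable_fun setT (f ^~ omega).
Proof. by move=> mf; exact: (measurableT_comp mf (measurable_pair2 omega)). Qed.

Lemma sect_meas (f : R -> Omega -> R) r :
  measurable_fun setT (fun z : R * Omega => f z.1 z.2) -> measurable_fun setT (f r).
Proof. by move=> mf; exact: (measurableT_comp mf (measurable_pair1 r)). Qed.

Lemma tD_int1 s t omega : 0 <= s -> s <= t -> int1 leb (fun r => tind s t r * D r omega).
Proof.
move=> s0 st; apply: (int1_le _ (DC omega s0 st).1).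
  by apply: measurable_funM; [exact: tind_meas|exact: path_meas].
by move=> r; rewrite normrM ger0_norm ?tind_ge0.
Qed.

Lemma B_one_before s r omega : s <= r -> B r omega = 1 -> B s omega = 1.
Proof.
move=> sr; rewrite /Bind; case: (boolP (C r omega <= N)) => [h _|_ /eqP].
  by rewrite (le_trans (Cnd omega sr) h).
by rewrite eq_sym oner_eq0.
Qed.

Lemma B_mul s r omega : s <= r -> B r omega * B s omega = B r omega.
Proof.
move=> sr; case: (boolP (C r omega <= N)) => h.
  have B1 : B r omega = 1 by rewrite /Bind h.
  by rewrite (B_one_before sr B1) mulr1.
by rewrite /Bind (negbTE h) mul0r.
Qed.

Lemma B01 r omega : B r omega = 0 \/ B r omega = 1.
Proof. by rewrite /Bind; case: (C r omega <= N); [right|left]. Qed.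

(** The clock dominates the variation of the drift, so as long as it shows at
    most N the accumulated drift is at most N. *)
Lemma drift_clock s t omega : 0 <= s -> s <= t -> t <= T ->
  int1 leb (fun r => tind s t r * (B r omega * `|D r omega|)) /\
  \int[leb]_r (tind s t r * (B r omega * `|D r omega|)) <= N.
Proof.
move=> s0 st tT.
have [i E] := @clock_bound _ (C ^~ omega) (C0 omega) (@Cnd omega) (@Cc omega) N T N0 T0
  (fun r => `|D r omega|) (fun r => normr_ge0 _) (DC omega).
have le r : tind s t r * (B r omega * `|D r omega|) <= tind 0 T r * (B r omega * `|D r omega|).
  by rewrite ler_wpM2r ?mulr_ge0 ?B_ge0//; exact: tind_le.
have i1 : int1 leb (fun r => tind s t r * (B r omega * `|D r omega|)).
  apply: (int1_le _ i); last first.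
    by move=> r; rewrite ger0_norm ?le// !mulr_ge0 ?tind_ge0 ?B_ge0.
  apply: measurable_funM; first exact: tind_meas.
  apply: measurable_funM; first exact: (path_meas _ (B_meas Cm N)).
  by apply: measurableT_comp => //; exact: path_meas.
by split=> //; apply: le_trans (E_le i1 i le) _.
Qed.

Lemma sum_sqr_le (s : seq I) (f : I -> R) :
  (\sum_(i <- s) f i) ^+ 2 <= 2 ^+ size s * \sum_(i <- s) f i ^+ 2.
Proof.
elim: s => [|i s IH]; first by rewrite !big_nil expr0n mulr0.
rewrite !big_cons/= (le_trans (sqrD_le _ _))// [2 ^+ _.+1]exprS -mulrA ler_pM2l// mulrDr.
apply: lerD => //; apply: ler_peMl; first exact: sqr_ge0.
by apply: exprn_ege1; rewrite ler1n.
Qed.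

(** Below the level N the drift contributes at most N, and each stochastic
    integral has second moment at most K_jj (2 N + 4) by [approx_all]. *)
Lemma zeta_stopped_bound : exists Kb : R, forall r, 0 <= r -> r <= T ->
  sqint P (fun omega => B r omega * zeta r omega) /\
  \int[P]_omega ((B r omega * zeta r omega) ^+ 2) <= Kb.
Proof.
have /choice[Z hZ] a := approx_all HF Hw C0 Cnd Cc Cad Cm N0 (mH a) (HC a) T0 (HJ a).
pose s := index_enum I.
exists (2 * ((`|z0| + N) ^+ 2 + 2 ^+ size s * \sum_(a <- s) (c a) ^+ 2 * (K (jj a) (jj a) * trunc_level N))).
move=> r r0 rT.
have mBr := measG_measurable HF r0 (B_F HF Cad N r0).1.
have sBJ a : sqint P (fun omega => c a * (B r omega * J a r omega)).
  by apply: sqintZ; have [_ _ /(_ r r0 rT)[]] := hZ a.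
have eBJ a : \int[P]_omega ((B r omega * J a r omega) ^+ 2) <= K (jj a) (jj a) * trunc_level N.
  by have [_ _ /(_ r r0 rT)[]] := hZ a.
have sBJ' a : int1 P (fun omega => (B r omega * J a r omega) ^+ 2).
  by have [_ _ /(_ r r0 rT)[[]]] := hZ a.
pose a0 omega := B r omega * (z0 + \int[leb]_u (tind 0 r u * D u omega)).
have a0b omega : `|a0 omega| <= `|z0| + N.
  rewrite /a0; case: (B01 r omega) => Br; rewrite Br ?mul0r ?normr0 ?addr_ge0// mul1r.
  rewrite (le_trans (ler_normD _ _))// lerD2l.
  rewrite (le_trans (E_norm (tD_int1 omega (lexx 0) r0)))//.
  apply: le_trans (drift_clock omega (lexx 0) r0 rT).2.
  apply: E_le; [exact: int1_norm (tD_int1 omega (lexx 0) r0)|exact: (drift_clock omega (lexx 0) r0 rT).1|].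
  move=> u; rewrite normrM ger0_norm ?tind_ge0//.
  rewrite tindE; case: (boolP ((0 < u) && (u <= r))) => [/andP[_ ur]|]; last by rewrite !mul0r.
  by rewrite !mul1r (B_one_before ur Br) mul1r.
have ma0 : measurable_fun setT a0.
  apply: measurable_funM => //; apply: measurable_funD => //.
  apply: (@param_int_meas _ _ _ _ _ leb (fun z => tind 0 r z.1 * D z.1 z.2)).
    by apply: measurable_funM => //; exact: tind_fst_meas.
  by move=> omega; exact: (tD_int1 omega (lexx 0) r0).
have sa0 : sqint P a0 by exact: sqint_bounded a0b.
have sS := sqint_sum s sBJ.
have aeq : {ae P, forall omega, a0 omega + \sum_(a <- s) c a * (B r omega * J a r omega) =
    B r omega * zeta r omega}.
  apply: filterS (sde r0 rT) => omega ->.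
  rewrite /a0 [in RHS]mulrDr; congr (_ + _).
  by rewrite mulr_sumr; apply: eq_bigr => a _; rewrite mulrCA.
have sz : sqint P (fun omega => B r omega * zeta r omega).
  apply: sqint_ae aeq (sqintD sa0 sS); apply: measurable_funM => //.
  exact: (sect_meas _ mzeta).
split=> //.
rewrite (@E_ae_eq _ _ _ P _ (fun omega => (a0 omega + \sum_(a <- s) c a * (B r omega * J a r omega)) ^+ 2)); last 3 first.
- exact: measurable_sqr sz.1.
- exact: measurable_sqr (sqintD sa0 sS).1.
- by apply: filterS aeq => omega ->.
have i1 : int1 P (fun omega => \sum_(a <- s) (c a) ^+ 2 * (B r omega * J a r omega) ^+ 2).
  by apply: int1_sum => a; exact: int1Z.
have i2 := int1Z (2 ^+ size s) i1.
have i3 := int1D (int1_cst P ((`|z0| + N) ^+ 2)) i2.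
apply: (@le_trans _ _ (\int[P]_omega (2 * ((`|z0| + N) ^+ 2 + 2 ^+ size s *
   \sum_(a <- s) (c a) ^+ 2 * (B r omega * J a r omega) ^+ 2)))).
  apply: E_le; [exact: (sqintD sa0 sS).2|exact: int1Z|].
  move=> omega; apply: (le_trans (sqrD_le _ _)); rewrite ler_pM2l// lerD//.
    rewrite -real_normK ?num_real// lerXn2r ?nnegrE// (le_trans _ (a0b omega))//.
  apply: (le_trans (sum_sqr_le _ _)); rewrite ler_wpM2l ?exprn_ge0//.
  by apply: ler_sum => a _; rewrite exprMn.
rewrite (EZ _ i3) (ED (int1_cst P _) i2) (E_cst P) (EZ _ i1) ler_pM2l// lerD2l.
rewrite ler_wpM2l ?exprn_ge0// E_sum; last by move=> a; exact: int1Z.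
by apply: ler_sum => a _; rewrite (EZ _ (sBJ' a)) ler_wpM2l ?sqr_ge0.
Qed.

Section energy_inequality.
Variables (kap : R -> Omega -> R) (Np s : R).
Hypothesis mkap : measurable_fun setT (fun z : R * Omega => kap z.1 z.2).
Hypothesis kapad : forall r, 0 <= r -> measG (F r) (kap r).
Hypothesis kap0 : forall r omega, 0 <= kap r omega.
Hypothesis kap1 : forall r omega, kap r omega <= 1.
Hypothesis kapD : forall r omega, `|kap r omega * D r omega| <= Np.
Hypotheses (s0 : 0 <= s) (sT : s <= T).

Let h r omega := B r omega * (kap r omega * D r omega).
Let BD r omega := B r omega * D r omega.

(** The kept part of the drift has a bounded adapted integrand, so the
    martingale property can be used against it; the lost part vanishes as kap
    increases to 1. *)
Definition drift_int r omega := \int[leb]_u (tind s r u * BD u omega).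
Definition drift_kept r omega := \int[leb]_u (tind s r u * h u omega).
Definition drift_lost r omega := drift_int r omega - drift_kept r omega.

Let mh : measurable_fun setT (fun z : R * Omega => h z.1 z.2).
Proof. by apply: measurable_funM; [exact: B_meas|exact: measurable_funM]. Qed.

Let mBD : measurable_fun setT (fun z : R * Omega => BD z.1 z.2).
Proof. by apply: measurable_funM; first exact: B_meas. Qed.

Let h_bd r omega : `|h r omega| <= Np.
Proof.
rewrite /h normrM -[leRHS]mul1r ler_pM// ger0_norm ?B_ge0//; exact: B_le1.
Qed.

Let Np0 (omega : Omega) : 0 <= Np.
Proof. exact: le_trans (kapD 0 omega). Qed.

Let h_le r omega : `|h r omega| <= B r omega * `|D r omega|.
Proof.
rewrite /h !normrM (ger0_norm (B_ge0 _ _ _ _)) ler_wpM2l ?B_ge0//.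
by rewrite (ger0_norm (kap0 _ _)) ler_piMl.
Qed.

Let BD_le r omega : `|BD r omega| <= B r omega * `|D r omega|.
Proof. by rewrite /BD normrM (ger0_norm (B_ge0 _ _ _ _)). Qed.

Let dom_int (f : R -> Omega -> R) t omega :
  measurable_fun setT (fun z : R * Omega => f z.1 z.2) ->
  (forall r omega, `|f r omega| <= B r omega * `|D r omega|) -> s <= t -> t <= T ->
  int1 leb (fun u => tind s t u * f u omega) /\
  `|\int[leb]_u (tind s t u * f u omega)| <= N.
Proof.
move=> mf fle st tT; have [i E] := drift_clock omega s0 st tT.
have le r : `|tind s t r * f r omega| <= tind s t r * (B r omega * `|D r omega|).
  by rewrite normrM ger0_norm ?tind_ge0// ler_wpM2l ?tind_ge0.
have ifn : int1 leb (fun u => tind s t u * f u omega).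
  apply: (int1_le _ i) => //.
  by apply: measurable_funM; [exact: tind_meas|exact: path_meas].
split=> //; apply: (le_trans (E_norm ifn)); apply: le_trans E.
by apply: E_le => //; exact: int1_norm.
Qed.

Let h_int t omega (st : s <= t) (tT : t <= T) := dom_int (t := t) omega mh h_le st tT.
Let BD_int t omega (st : s <= t) (tT : t <= T) := dom_int (t := t) omega mBD BD_le st tT.

(** Off the range of times considered, integrands are cut off by tind s T, so
    that jointly measurable bounded versions suffice. *)
Let cut r := Num.min (Num.max s r) T.

Let cut_s r : s <= cut r.
Proof. by rewrite /cut le_min sT le_max lexx. Qed.

Let cut_T r : cut r <= T.
Proof. by rewrite /cut ge_min lexx orbT. Qed.

Let cutE r : s <= r -> r <= T -> cut r = r.
Proof. by move=> sr rT; rewrite /cut (max_idPr sr) (min_idPl rT). Qed.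

Let joint_int (f : R -> Omega -> R) :
  measurable_fun setT (fun z : R * Omega => f z.1 z.2) ->
  (forall r omega, `|f r omega| <= B r omega * `|D r omega|) ->
  measurable_fun setT (fun z : R * Omega => \int[leb]_u (tind s (cut z.1) u * f u z.2)).
Proof.
move=> mf fle.
apply: (@param_int_meas _ _ _ _ _ leb (fun y : R * (R * Omega) => tind s (cut y.2.1) y.1 * f y.1 y.2.2)).
  apply: measurable_funM; last first.
    have mp : measurable_fun setT (fun y : R * (R * Omega) => (y.1, y.2.2)).
      apply: measurable_fun_pair; first exact: measurable_fst.
      by apply: (measurableT_comp measurable_snd); exact: measurable_snd.
    exact: (measurableT_comp mf mp).
  rewrite (_ : (fun _ => _) = fun y : R * (R * Omega) =>
     (1 - (y.1 <= s)%R%:R) * (y.1 - cut y.2.1 <= 0)%R%:R).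
    apply: measurable_funM.
      by apply: measurable_funB => //; apply: measurable_le_indic; exact: measurable_fst.
    apply: measurable_le_indic; apply: measurable_funB; first exact: measurable_fst.
    apply: measurable_minr => //; apply: measurable_maxr => //.
    by apply: (measurableT_comp measurable_fst); exact: measurable_snd.
  apply/funext => y; rewrite tindE subr_le0 ltNge.
  by case: (y.1 <= s)%R; case: (y.1 <= cut y.2.1)%R; rewrite /= ?subrr ?subr0 ?mul0r ?mul1r.
move=> z /=; exact: (dom_int _ mf fle (cut_s _) (cut_T _)).1.
Qed.

Let U omega := B s omega * zeta s omega.

Let sU : sqint P U.
Proof. by have [Kb h'] := zeta_stopped_bound; have [] := h' s s0 sT. Qed.

Let szeta r : 0 <= r -> r <= T -> sqint P (fun omega => B r omega * zeta r omega).
Proof. by move=> r0 rT; have [Kb h'] := zeta_stopped_bound; have [] := h' r r0 rT. Qed.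

Let tind_sqintM : sqint M (fun z : R * Omega => tind s T z.1).
Proof.
split; first exact: tind_fst_meas.
have [i _] := int1_prod (tind_int1 s T) (int1_cst P 1).
by congr int1 : i; apply/funext => z; rewrite tind_sqr mulr1.
Qed.

Let th_sqint : sqint M (fun z => tind s T z.1 * h z.1 z.2).
Proof.
have := @sqint_bdM _ _ _ M (fun z : R * Omega => h z.1 z.2) _ Np mh (fun z => h_bd z.1 z.2) tind_sqintM.
by congr sqint; apply/funext => z; rewrite mulrC.
Qed.

Let tY_sqint (Y : Omega -> R) : sqint P Y -> sqint M (fun z => tind s T z.1 * Y z.2).
Proof.
move=> sY; split.
  by apply: measurable_funM; [exact: tind_fst_meas|exact: (measurableT_comp sY.1 measurable_snd)].
have [i _] := int1_prod (tind_int1 s T) sY.2.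
by congr int1 : i; apply/funext => z; rewrite exprMn tind_sqr.
Qed.

Let tzeta_sqint : sqint M (fun z => tind s T z.1 * (B z.1 z.2 * zeta z.1 z.2)).
Proof.
have mBz : measurable_fun setT (fun z : R * Omega => B z.1 z.2 * zeta z.1 z.2).
  by apply: measurable_funM => //; exact: B_meas.
split; first by apply: measurable_funM => //; exact: tind_fst_meas.
have [Kb hKb] := zeta_stopped_bound.
pose g (z : R * Omega) := tind s T z.1 * (B z.1 z.2 * zeta z.1 z.2) ^+ 2.
have mg : measurable_fun setT g.
  by apply: measurable_funM; [exact: tind_fst_meas|exact: measurable_funX].
have g0 z : 0 <= g z by exact: tind_sqr_ge0.
have i2 r : int1 P (fun omega => g (r, omega)).
  rewrite /g/=; case: (boolP ((s < r) && (r <= T))) => [/andP[sr rT]|h'].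
    by apply: int1Z; exact: (szeta (le_trans s0 (ltW sr)) rT).2.
  rewrite (_ : (fun _ => _) = fun=> 0); first exact: int10.
  by apply/funext => omega; rewrite tindE (negbTE h') mul0r.
have : int1 M g.
  apply: tonelli_fst => //.
  apply: (int1_le _ (int1Z Kb (tind_int1 s T))).
    have mg' : measurable_fun setT (fun z : Omega * R => g (z.2, z.1)).
      by apply: (measurableT_comp mg); exact: measurable_swap.
    exact: (@param_int_meas _ _ _ _ _ P (fun z => g (z.2, z.1)) mg').
  move=> r; rewrite ger0_norm; last by apply: E_ge0 => omega.
  rewrite /g/=; case: (boolP ((s < r) && (r <= T))) => [/andP[sr rT]|h'].
    have [sz Ez] := hKb r (le_trans s0 (ltW sr)) rT.
    by rewrite (EZ _ sz.2) mulrC ler_wpM2r ?tind_ge0.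
  rewrite (@eqE _ _ _ P _ (fun=> 0)); first by rewrite E0 tindE (negbTE h') mulr0.
  by move=> omega; rewrite tindE (negbTE h') mul0r.
by congr int1; apply/funext => z; rewrite /g [in RHS]exprMn tind_sqr.
Qed.

(** Fubini's theorem; the cut-off keeps the drift bounded, hence square
    integrable against any Y. *)
Let swap (Y : Omega -> R) : sqint P Y ->
  \int[P]_omega (drift_kept T omega * Y omega) =
  \int[leb]_r (tind s T r * \int[P]_omega (h r omega * Y omega)) /\
  \int[P]_omega (drift_kept T omega * Y omega) =
  \int[M]_z (tind s T z.1 * h z.1 z.2 * Y z.2).
Proof.
move=> sY.
pose g (z : R * Omega) := tind s T z.1 * h z.1 z.2 * Y z.2.
have ig : int1 M g.
  have := sqintM th_sqint (tY_sqint sY); congr int1; apply/funext => z; rewrite /g.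
  by rewrite [in RHS]mulrAC -[in RHS](tind_sqr s T); ring.
have i2 r : int1 P (fun omega => h r omega * Y omega).
  exact: (int1_bdM (sect_meas r mh) (h_bd r) (sqint_int1 sY)).
have e2 : \int[M]_z g z = \int[P]_omega (drift_kept T omega * Y omega).
  rewrite fubini_snd//; last first.
    move=> omega; rewrite /g/=.
    rewrite (_ : (fun _ => _) = fun r => Y omega * (tind s T r * h r omega)).
      by apply: int1Z; exact: (h_int omega sT (lexx T)).1.
    by apply/funext => r; ring.
  apply: eqE => omega; rewrite mulrC -(EZ _ (h_int omega sT (lexx T)).1).
  by apply: eqE => r; rewrite /g/=; ring.
split; last by rewrite -e2.
rewrite -e2 (fubini_fst ig _).2.
  apply: eqE => r; rewrite -(EZ _ (i2 r)); apply: eqE => omega; rewrite /g/=; ring.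
move=> r; rewrite /g/= (_ : (fun _ => _) = fun omega => tind s T r * (h r omega * Y omega)).
  exact: int1Z.
by apply/funext => omega; rewrite mulrA.
Qed.

Let h_F r : 0 <= r -> measG (F r) (h r).
Proof.
move=> r0; have sF := F_sigma HF r0.
apply: (measGM sF); first exact: (B_F HF Cad N r0).1.
by apply: (measGM sF); [exact: kapad|exact: Dad].
Qed.

Variable Z : I -> nat -> simple_process F.
Hypothesis hZ : forall a, [/\
  forall k omega, \int[leb]_r (tind 0 T r * sp_eval (Z a k) r omega ^+ 2) <= trunc_level N,
  (fun k => gapM P C N (H a) T (Z a k)) @ \oo --> (0 : R) &
  forall r, 0 <= r -> r <= T -> [/\ sqint P (fun omega => B r omega * J a r omega),
    l2cvg P (fun k omega => B r omega * SI (Z a k) (jj a) r omega) (fun omega => B r omega * J a r omega) &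
    \int[P]_omega ((B r omega * J a r omega) ^+ 2) <= K (jj a) (jj a) * trunc_level N]].

(** The martingale part of zeta between s and r, for the k-th approximations. *)
Let W k r omega := \sum_a c a *
  (SI (Z a k) (jj a) r omega - SI (Z a k) (jj a) s omega).

Let sW k r : s <= r -> sqint P (W k r).
Proof. by move=> sr; apply: sqint_sum => a; apply: sqintZ; exact: (SI_diff_sqint HF Hw). Qed.

(** Subtracting the equations at s and r identifies the limit of the martingale
    approximations W k. Where B r = 1 also B s = 1, so multiplying by B r makes
    both approximations available at once. *)
Let W_cvg r : s <= r -> r <= T ->
  sqint P (fun omega => B r omega * (zeta r omega - zeta s omega - drift_int r omega)) /\
  l2cvg P (fun k omega => B r omega * W k r omega)
    (fun omega => B r omega * (zeta r omega - zeta s omega - drift_int r omega)).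
Proof.
move=> sr rT; have r0 := le_trans s0 sr.
have mBr := measG_measurable HF r0 (B_F HF Cad N r0).1.
have Brb omega : `|B r omega| <= 1 by rewrite ger0_norm ?B_ge0 ?B_le1.
pose f a omega := B r omega * J a r omega - B r omega * (B s omega * J a s omega).
have sBJ a t : 0 <= t -> t <= T -> sqint P (fun omega => B t omega * J a t omega).
  by move=> t0 tT; have [_ _ /(_ t t0 tT)[]] := hZ a.
have lBJ a t : 0 <= t -> t <= T -> l2cvg P (fun k omega => B t omega * SI (Z a k) (jj a) t omega)
    (fun omega => B t omega * J a t omega).
  by move=> t0 tT; have [_ _ /(_ t t0 tT)[]] := hZ a.
have sSI a k t : 0 <= t -> sqint P (fun omega => B t omega * SI (Z a k) (jj a) t omega).
  move=> t0; apply: (bmeas_mul_sqint HF t0 (B_F HF Cad N t0)); exact: (SI_sqint HF Hw).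
have sf a : sqint P (f a).
  by apply: sqintB; [exact: sBJ|apply: (sqint_bdM mBr Brb); exact: sBJ].
pose u a k omega := B r omega * SI (Z a k) (jj a) r omega -
    B r omega * (B s omega * SI (Z a k) (jj a) s omega).
have su a k : sqint P (u a k).
  by apply: sqintB; [exact: sSI|apply: (sqint_bdM mBr Brb); exact: sSI].
have uf a : l2cvg P (u a) (f a).
  have h1 := lBJ a r r0 rT.
  have sSs k : sqint P (fun omega => B s omega * SI (Z a k) (jj a) s omega) by exact: sSI.
  have h2 := l2cvgZ (-1) (fun k => sqint_bdM mBr Brb (sSs k))
    (sqint_bdM mBr Brb (sBJ a s s0 sT)) (l2cvg_bdM mBr Brb sSs (sBJ a s s0 sT) (lBJ a s s0 sT)).
  have h3 := l2cvgD (fun k => sSI a k r r0) (fun k => sqintZ (-1) (sqint_bdM mBr Brb (sSs k)))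
     (sBJ a r r0 rT) (sqintZ (-1) (sqint_bdM mBr Brb (sBJ a s s0 sT))) h1 h2.
  have e1 : u a = fun k omega => B r omega * SI (Z a k) (jj a) r omega +
      -1 * (B r omega * (B s omega * SI (Z a k) (jj a) s omega)).
    by apply/funext => k; apply/funext => x; rewrite mulN1r.
  have e2 : f a = fun omega => B r omega * J a r omega + -1 * (B r omega * (B s omega * J a s omega)).
    by apply/funext => x; rewrite mulN1r.
  by rewrite e1 e2.
have lim := l2cvg_sum (index_enum I) (fun a k => sqintZ (c a) (su a k))
  (fun a => sqintZ (c a) (sf a)) (fun a => l2cvgZ (c a) (su a) (sf a) (uf a)).
have sF := sqint_sum (index_enum I) (fun a => sqintZ (c a) (sf a)).
have sWW k := sqint_sum (index_enum I) (fun a => sqintZ (c a) (su a k)).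
have WE : (fun k omega => \sum_a c a * u a k omega) = (fun k omega => B r omega * W k r omega).
  apply/funext => k; apply/funext => omega; rewrite /W mulr_sumr; apply: eq_bigr => a _.
  by rewrite /u [B r omega * (B s omega * _)]mulrA (B_mul omega sr); ring.
have mdi : measurable_fun setT (drift_int r).
  apply: (@param_int_meas _ _ _ _ _ leb (fun z => tind s r z.1 * BD z.1 z.2)).
    by apply: measurable_funM => //; exact: tind_fst_meas.
  by move=> omega; exact: (BD_int omega sr rT).1.
have mG : measurable_fun setT (fun omega => B r omega * (zeta r omega - zeta s omega - drift_int r omega)).
  apply: measurable_funM => //; apply: measurable_funB => //; apply: measurable_funB; exact: (sect_meas _ mzeta).
have ae : {ae P, forall omega, \sum_a c a * f a omega =
    B r omega * (zeta r omega - zeta s omega - drift_int r omega)}.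
  apply: filterS2 (sde r0 rT) (sde s0 sT) => omega er es.
  case: (B01 r omega) => Br.
    rewrite Br mul0r big1// => a _; by rewrite /f Br !mul0r subr0 mulr0.
  have Bs := B_one_before sr Br.
  have -> : \sum_a c a * f a omega = \sum_a c a * J a r omega - \sum_a c a * J a s omega.
    by rewrite -sumrB; apply: eq_bigr => a _; rewrite /f Br Bs !mul1r mulrBr.
  have -> : drift_int r omega = \int[leb]_v (tind s r v * D v omega).
    apply: eqE => v; rewrite tindE; case: (boolP ((s < v) && (v <= r))) => [/andP[_ vr]|].
      by rewrite /BD /= !mul1r (B_one_before vr Br) mul1r.
    by rewrite !mul0r.
  rewrite er es Br mul1r.
  have -> : \int[leb]_v (tind 0 r v * D v omega) =
     \int[leb]_v (tind 0 s v * D v omega) + \int[leb]_v (tind s r v * D v omega).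
    rewrite -(ED (tD_int1 omega (lexx 0) s0) (tD_int1 omega s0 sr)).
    by apply: eqE => v; rewrite (tind_add _ s0 sr) mulrDl.
  by ring.
have sG := sqint_ae mG ae sF.
split=> //; rewrite -WE; exact: l2cvg_ae sWW sF sG ae lim.
Qed.

(** The density of the quadratic variation of zeta. *)
Definition qvar (z : R * Omega) : R := \sum_a \sum_b
  c a * c b * K (jj a) (jj b) * (H a z.1 z.2 * H b z.1 z.2).

Let tBH a (z : R * Omega) := tind s T z.1 * (B z.1 z.2 * H a z.1 z.2).
Let tZ a k (z : R * Omega) := tind s T z.1 * sp_eval (Z a k) z.1 z.2.

Let stZ a k : sqint M (tZ a k).
Proof. exact: (sp_eval_sqint HF). Qed.

Let sgap a k : sqint M (fun z => tZ a k z - tBH a z).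
Proof. exact: (gap_sqint HF C0 Cnd Cc Cm N0 (mH a) (HC a) (Z a k) s0 sT). Qed.

Let stBH a : sqint M (tBH a).
Proof.
rewrite (_ : tBH a = fun z => tZ a 0%N z - (tZ a 0%N z - tBH a z)).
  exact: sqintB (stZ a 0%N) (sgap a 0%N).
by apply/funext => z; ring.
Qed.

Let tZ_cvg a : l2cvg M (tZ a) (tBH a).
Proof.
have [_ g0 _] := hZ a; apply: cvg0_squeeze g0 => k.
rewrite ger0_norm; last by apply: E_ge0 => z; exact: sqr_ge0.
exact: (gap_mono HF C0 Cnd Cc Cm N0 (mH a) (HC a) T0 (Z a k) s0 sT (lexx T)).
Qed.

Let tBQ_E : int1 M (fun z => tind s T z.1 * (B z.1 z.2 * qvar z)) /\
  \int[M]_z (tind s T z.1 * (B z.1 z.2 * qvar z)) =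
  \sum_a \sum_b c a * c b * K (jj a) (jj b) * \int[M]_z (tBH a z * tBH b z).
Proof.
have e : (fun z => tind s T z.1 * (B z.1 z.2 * qvar z)) =
    fun z => \sum_a \sum_b c a * c b * K (jj a) (jj b) * (tBH a z * tBH b z).
  apply/funext => z; rewrite /qvar !mulr_sumr; apply: eq_bigr => a _.
  rewrite !mulr_sumr; apply: eq_bigr => b _; rewrite /tBH.
  by rewrite -[in LHS](tind_sqr s T) -[in LHS](B_sqr C N); ring.
have ib a b : int1 M (fun z => c a * c b * K (jj a) (jj b) * (tBH a z * tBH b z)).
  by apply: int1Z; exact: sqintM (stBH a) (stBH b).
rewrite e; split; first by apply: int1_sum => a; apply: int1_sum => b.
rewrite E_sum; last by move=> a; apply: int1_sum => b.
apply: eq_bigr => a _; rewrite E_sum//; apply: eq_bigr => b _.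
by rewrite (EZ _ (sqintM (stBH a) (stBH b))).
Qed.

(** Both sides expand, by the isometry, into products of integrands. *)
Let W_energy : (fun k => \int[P]_omega (W k T omega ^+ 2)) @ \oo -->
  \int[M]_z (tind s T z.1 * (B z.1 z.2 * qvar z)).
Proof.
rewrite tBQ_E.2.
have -> : (fun k => \int[P]_omega (W k T omega ^+ 2)) = fun k =>
   \sum_a \sum_b c a * c b * K (jj a) (jj b) * \int[M]_z (tZ a k z * tZ b k z).
  apply/funext => k.
  pose Y a omega := SI (Z a k) (jj a) T omega - SI (Z a k) (jj a) s omega.
  have sY a : sqint P (Y a) by exact: (SI_diff_sqint HF Hw).
  have iY a b : int1 P (fun omega => c a * c b * (Y a omega * Y b omega)).
    by apply: int1Z; exact: sqintM (sY a) (sY b).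
  transitivity (\int[P]_omega \sum_a \sum_b c a * c b * (Y a omega * Y b omega)).
    apply: eqE => omega; rewrite expr2 mulr_suml; apply: eq_bigr => a _.
    by rewrite mulr_sumr; apply: eq_bigr => b _; rewrite /Y; ring.
  rewrite E_sum; last by move=> a; apply: int1_sum => b.
  apply: eq_bigr => a _; rewrite E_sum//; apply: eq_bigr => b _.
  by rewrite (EZ _ (sqintM (sY a) (sY b))) (isometry HF Hw _ _ _ _ s0 sT) mulrA.
apply: cvgn_sum => a; apply: cvgn_sum => b; apply: cvgMr.
exact: l2cvg_prod (stZ a) (stZ b) (stBH a) (stBH b) (tZ_cvg a) (tZ_cvg b).
Qed.

Let W_martingale k r Y : s <= r -> r <= T -> measG (F r) Y -> sqint P Y ->
  \int[P]_omega (Y omega * W k T omega) = \int[P]_omega (Y omega * W k r omega).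
Proof.
move=> sr rT mY sY; have r0 := le_trans s0 sr.
apply/eqP; rewrite -subr_eq0 -(EB (sqintM sY (sW k sT)) (sqintM sY (sW k sr))).
pose X a omega := Y omega * (SI (Z a k) (jj a) T omega - SI (Z a k) (jj a) r omega).
have iX a : int1 P (X a) by exact: sqintM sY (SI_diff_sqint HF Hw _ _ r0 rT).
rewrite (@eqE _ _ _ P _ (fun omega => \sum_a c a * X a omega)); last first.
  move=> omega; rewrite -mulrBr /W -sumrB mulr_sumr; apply: eq_bigr => a _.
  by rewrite /X; ring.
rewrite E_sum; last by move=> a; exact: int1Z.
by rewrite big1// => a _; rewrite (EZ _ (iX a)) (SI_martingale HF Hw)// mulr0.
Qed.

Let mart_lim (z : R * Omega) := zeta z.1 z.2 - zeta s z.2 - drift_int (cut z.1) z.2.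

Let th_int1 : int1 M (fun z => tind s T z.1 * h z.1 z.2).
Proof.
have := sqintM th_sqint tind_sqintM; congr int1; apply/funext => z.
by rewrite mulrAC -expr2 tind_sqr.
Qed.

Let thzeta_int1 : int1 M (fun z => tind s T z.1 * h z.1 z.2 * zeta z.1 z.2).
Proof.
have := sqintM th_sqint tzeta_sqint; congr int1; apply/funext => z.
rewrite /h -[in RHS](tind_sqr s T) -[in RHS](B_sqr C N); ring.
Qed.

Let thU_int1 : int1 M (fun z => tind s T z.1 * h z.1 z.2 * U z.2).
Proof.
have := sqintM th_sqint (tY_sqint sU); congr int1; apply/funext => z.
by rewrite -[in RHS](tind_sqr s T); ring.
Qed.

Let bounded_th_int1 (f : R * Omega -> R) : measurable_fun setT f -> (forall z, `|f z| <= N) ->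
  int1 M (fun z => tind s T z.1 * h z.1 z.2 * f z).
Proof.
move=> mf fN; have := @int1_bdM _ _ _ M f _ N mf fN th_int1.
by congr int1; apply/funext => z; rewrite mulrC.
Qed.

Let thU_E (z : R * Omega) : tind s T z.1 * h z.1 z.2 * U z.2 = tind s T z.1 * h z.1 z.2 * zeta s z.2.
Proof.
rewrite tindE; case: (boolP ((s < z.1) && (z.1 <= T))) => [/andP[sr _]|]; last by rewrite !mul0r.
rewrite !mul1r /h /U; rewrite -(B_mul z.2 (ltW sr)).
by rewrite -[in RHS](B_sqr C N s); ring.
Qed.

Let dint_N r omega : `|drift_int (cut r) omega| <= N.
Proof. exact: (BD_int omega (cut_s r) (cut_T r)).2. Qed.

Let dkept_N r omega : `|drift_kept (cut r) omega| <= N.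
Proof. exact: (h_int omega (cut_s r) (cut_T r)).2. Qed.

Let mdint : measurable_fun setT (fun z : R * Omega => drift_int (cut z.1) z.2).
Proof. exact: joint_int mBD BD_le. Qed.

Let mdkept : measurable_fun setT (fun z : R * Omega => drift_kept (cut z.1) z.2).
Proof. exact: joint_int mh h_le. Qed.

Let thm_int1 : int1 M (fun z => tind s T z.1 * h z.1 z.2 * mart_lim z).
Proof.
have := int1B (int1B thzeta_int1 thU_int1) (bounded_th_int1 mdint (fun z => dint_N z.1 z.2)).
congr int1; apply/funext => z; rewrite thU_E /mart_lim; ring.
Qed.

(** By Fubini and the martingale property, E[A W_T] for the kept drift A is the
    time integral of E[h_r W_r]; since h_r contains the factor B_r, it suffices
    to know the limit of B_r W_r, and the time integral converges by domination. *)
Let AW_cvg : (fun k => \int[P]_omega (drift_kept T omega * W k T omega)) @ \oo -->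
  \int[M]_z (tind s T z.1 * h z.1 z.2 * mart_lim z).
Proof.
pose g k r := tind s T r * \int[P]_omega (h r omega * W k T omega).
have hr0 r : (s < r) && (r <= T) -> [/\ s <= r, r <= T & 0 <= r].
  by move=> /andP[sr rT]; rewrite (ltW sr) rT (le_trans s0 (ltW sr)).
have shr r : sqint P (h r) by exact: sqint_bounded (sect_meas r mh) (h_bd r).
have iml r : int1 P (fun omega => tind s T r * h r omega * mart_lim (r, omega)).
  rewrite tindE; case: (boolP ((s < r) && (r <= T))) => [/hr0[sr rT r0]|_]; last first.
    rewrite (_ : (fun _ => _) = fun=> 0); first exact: int10.
    by apply/funext => omega; rewrite !mul0r.
  have := sqintM (shr r) (W_cvg sr rT).1; congr int1; apply/funext => omega.
  by rewrite mul1r /mart_lim/= cutE// /h -[in RHS](B_sqr C N); ring.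
have [iG EG] := fubini_fst thm_int1 iml.
rewrite EG (_ : (fun k => _) = fun k => \int[leb]_r g k r); last first.
  by apply/funext => k; rewrite (swap (sW k sT)).1.
have [Wb hWb] : exists Wb, forall k, \int[P]_omega (W k T omega ^+ 2) <= Wb.
  have /cvg_seq_bounded[Wb [_ /(_ (Wb + 1)) hb]] : cvgn (fun k => \int[P]_omega (W k T omega ^+ 2)).
    by apply/cvg_ex; eexists; exact: W_energy.
  exists (Wb + 1) => k; apply: le_trans (ler_norm _) _.
  by apply: hb => //; rewrite ltrDl.
apply: (@E_dct _ _ _ leb g _ (fun r => (Np * (1 + Wb)) * tind s T r) _ _ _ _ _).2.
- move=> k; apply: measurable_funM; first exact: tind_meas.
  have mf : measurable_fun setT (fun z : Omega * R => h z.2 z.1 * W k T z.1).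
    apply: measurable_funM.
      have mp : measurable_fun setT (fun z : Omega * R => (z.2, z.1)) by exact: measurable_swap.
      exact: (measurableT_comp mh mp).
    exact: (measurableT_comp (sW k sT).1 measurable_fst).
  apply: (@param_int_meas _ _ _ _ _ P (fun z => h z.2 z.1 * W k T z.1) mf) => r /=.
  exact: sqintM (shr r) (sW k sT).
- exact: int1_measurable iG.
- move=> r; rewrite /g; case: (boolP ((s < r) && (r <= T))) => [/[dup] srT /hr0[sr rT r0]|nsrT]; last first.
    rewrite tindE (negbTE nsrT) (_ : (fun k => _) = fun=> 0); last first.
      by apply/funext => k; rewrite mul0r.
    rewrite [X in _ --> X](_ : _ = 0); first exact: cvg_cst.
    by rewrite -[RHS](E0 P); apply: eqE => omega; rewrite !mul0r.
  have := l2cvg_prod (fun=> shr r) (fun k => sqint_bdM (measG_measurable HF r0 (B_F HF Cad N r0).1)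
    (fun omega => (_ : `|B r omega| <= 1)) (sW k sr)) (shr r) (W_cvg sr rT).1 (l2cvg_cst P (h r)) (W_cvg sr rT).2.
  move=> lim; rewrite tindE srT.
  rewrite (_ : (fun k => _) = fun k => \int[P]_omega (h r omega * (B r omega * W k r omega))); last first.
    apply/funext => k; rewrite mul1r (W_martingale k sr rT (h_F r0) (shr r)).
    by apply: eqE => omega; rewrite /h -[in LHS](B_sqr C N); ring.
  rewrite [X in _ --> X](_ : _ = \int[P]_x (h r x * (B r x * (zeta r x - zeta s x - drift_int r x)))).
    by apply: lim => omega; exact: nat01.
  apply: eqE => omega; rewrite mul1r /mart_lim/= cutE//.
  by rewrite /h -[in LHS](B_sqr C N); ring.
- by apply: int1Z; exact: tind_int1.
- move=> k r; rewrite /g normrM ger0_norm ?tind_ge0// mulrC ler_wpM2r ?tind_ge0//.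
  have i1 := sqintM (shr r) (sW k sT).
  apply: (le_trans (E_norm i1)).
  have i2 : int1 P (fun omega => Np * (1 + W k T omega ^+ 2)).
    by apply: int1Z; apply: int1D; [exact: int1_cst|exact: (sW k sT).2].
  have i3 := int1D (int1_cst P 1) (sW k sT).2.
  apply: (@le_trans _ _ (\int[P]_omega (Np * (1 + W k T omega ^+ 2)))).
    apply: E_le => //; first exact: int1_norm.
    move=> omega; rewrite normrM ler_pM//.
    have := normr_ge0 (W k T omega); rewrite -[_ ^+ 2]real_normK ?num_real//.
    by move: (`|W k T omega|) => x; nra.
  rewrite (EZ _ i3) (ED (int1_cst P 1) (sW k sT).2) (E_cst P).
  have omega := sample_point P.
  by rewrite ler_wpM2l ?(Np0 omega)// lerD2l.
Qed.

(** Ito's formula for the square of zeta as an inequality, in the limit of large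
    k from the expansion of the square of U + drift_kept T + W k T. On the event
    B T = 1 this sum approximates zeta T - drift_lost T; the factor B T is
    dropped before expanding, and U is orthogonal to W k T. *)
Lemma energy_inequality_lost :
  \int[P]_omega ((B T omega * (zeta T omega - drift_lost T omega)) ^+ 2) <=
  \int[P]_omega ((B s omega * zeta s omega) ^+ 2) +
  \int[M]_z (tind s T z.1 * (B z.1 z.2 * qvar z)) +
  2 * \int[M]_z (tind s T z.1 * h z.1 z.2 * (zeta z.1 z.2 - drift_lost (cut z.1) z.2)).
Proof.
have TT := lexx T.
have mkT : measurable_fun setT (drift_kept T).
  have := sect_meas T mdkept (f := fun r omega => drift_kept (cut r) omega).
  by rewrite (cutE sT TT).
have kTN omega : `|drift_kept T omega| <= N by have := dkept_N T omega; rewrite cutE.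
have sk : sqint P (drift_kept T) := sqint_bounded P mkT kTN.
have mBT := measG_measurable HF T0 (B_F HF Cad N T0).1.
have BTb omega : `|B T omega| <= 1 by exact: nat01.
pose base omega := U omega + drift_kept T omega.
have sbase : sqint P base := sqintD sU sk.
have [slim Wlim] := W_cvg sT TT.
have lhs : (fun k => \int[P]_omega ((B T omega * (base omega + W k T omega)) ^+ 2)) @ \oo -->
    \int[P]_omega ((B T omega * (zeta T omega - drift_lost T omega)) ^+ 2).
  have sBb := sqint_bdM mBT BTb sbase.
  have sBW k := sqint_bdM mBT BTb (sW k sT).
  have l := l2cvgD (fun=> sBb) sBW sBb slim (l2cvg_cst P _) Wlim.
  have l2 := l2cvg_prod (fun k => sqintD sBb (sBW k)) (fun k => sqintD sBb (sBW k))
    (sqintD sBb slim) (sqintD sBb slim) l l.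
  have eL : \int[P]_omega ((B T omega * (zeta T omega - drift_lost T omega)) ^+ 2) =
      \int[P]_omega ((B T omega * base omega + B T omega * (zeta T omega - zeta s omega - drift_int T omega)) *
      (B T omega * base omega + B T omega * (zeta T omega - zeta s omega - drift_int T omega))).
    apply: eqE => omega; rewrite -expr2 -mulrDr; congr (_ ^+ 2).
    rewrite /base /U /drift_lost.
    case: (B01 T omega) => BT1; rewrite BT1 ?mul0r// !mul1r.
    by rewrite (B_one_before sT BT1) mul1r; ring.
  rewrite eL (_ : (fun k => _) = fun k => \int[P]_omega ((B T omega * base omega + B T omega * W k T omega) *
    (B T omega * base omega + B T omega * W k T omega)))//.
  by apply/funext => k; apply: eqE => omega; rewrite -mulrDr expr2.
have expand k : \int[P]_omega ((base omega + W k T omega) ^+ 2) =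
   \int[P]_omega (base omega ^+ 2) + \int[P]_omega (W k T omega ^+ 2) +
   2 * \int[P]_omega (drift_kept T omega * W k T omega).
  have iUW := sqintM sU (sW k sT); have ikW := sqintM sk (sW k sT).
  have i1 := sbase.2; have i2 := (sW k sT).2.
  have UW0 : \int[P]_omega (U omega * W k T omega) = 0.
    have mU : measG (F s) U by apply: (measGM (F_sigma HF s0)); [exact: (B_F HF Cad N s0).1|exact: zetaad].
    rewrite (W_martingale k (lexx s) sT mU sU) -[RHS](E0 P); apply: eqE => omega.
    by rewrite /W big1 ?mulr0// => a _; rewrite subrr mulr0.
  rewrite (@eqE _ _ _ P _ (fun omega => base omega ^+ 2 + W k T omega ^+ 2 +
    2 * (U omega * W k T omega + drift_kept T omega * W k T omega))); last first.
    by move=> omega; rewrite /base; ring.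
  rewrite (ED (int1D i1 i2) (int1Z 2 (int1D iUW ikW))) (ED i1 i2) (EZ _ (int1D iUW ikW)).
  by rewrite (ED iUW ikW) UW0 add0r.
have rhs : (fun k => \int[P]_omega ((base omega + W k T omega) ^+ 2)) @ \oo -->
   \int[P]_omega (base omega ^+ 2) + \int[M]_z (tind s T z.1 * (B z.1 z.2 * qvar z)) +
   2 * \int[M]_z (tind s T z.1 * h z.1 z.2 * mart_lim z).
  rewrite (_ : (fun k => _) = fun k => \int[P]_omega (base omega ^+ 2) + \int[P]_omega (W k T omega ^+ 2) +
   2 * \int[P]_omega (drift_kept T omega * W k T omega)); last exact/funext.
  apply: cvgD; first by apply: cvgD; [exact: cvg_cst|exact: W_energy].
  exact: cvgMr AW_cvg.
have base2 : \int[P]_omega (base omega ^+ 2) = \int[P]_omega (U omega ^+ 2) +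
   2 * \int[M]_z (tind s T z.1 * h z.1 z.2 * U z.2) +
   2 * \int[M]_z (tind s T z.1 * h z.1 z.2 * drift_kept (cut z.1) z.2).
  have e1 : \int[M]_z (tind s T z.1 * h z.1 z.2 * drift_kept (cut z.1) z.2) =
      \int[P]_omega (2^-1 * drift_kept T omega ^+ 2).
    rewrite fubini_snd; last 2 first.
    - exact: (bounded_th_int1 mdkept (fun z => dkept_N z.1 z.2)).
    - move=> omega /=; have i := (h_int omega sT TT).1.
      have := @int1_bdM _ _ _ leb (fun r => drift_kept (cut r) omega) _ N
        (path_meas omega mdkept (f := fun r omega => drift_kept (cut r) omega)) (fun r => dkept_N r omega) i.
      by congr int1; apply/funext => r; rewrite mulrC.
    apply: eqE => omega; have i := (h_int omega sT TT).1.
    have e2 : drift_kept T omega ^+ 2 = 2 * \int[leb]_r (tind s T r * h r omega *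
        \int[leb]_u ((u <= r)%R%:R * (tind s T u * h u omega))) := sqr_integral i.
    rewrite e2 mulrA mulVf ?pnatr_eq0// mul1r.
    apply: eqE => r /=; case: (boolP ((s < r) && (r <= T))) => [/andP[sr rT]|nr]; last first.
      by rewrite tindE (negbTE nr) !mul0r.
    congr (_ * _); rewrite cutE//; last exact: ltW.
    apply: eqE => u; rewrite !tindE mulrA; congr (_ * _).
    have [ur|//] := leP u r; last by rewrite andbF mul0r.
    by rewrite (le_trans ur rT) mul1r.
  have iUk := sqintM sk sU.
  rewrite e1 (EZ _ sk.2) -(swap sU).2 mulrA divff// mul1r.
  rewrite (@eqE _ _ _ P _ (fun omega => U omega ^+ 2 + 2 * (drift_kept T omega * U omega) + drift_kept T omega ^+ 2)).
    by rewrite (ED (int1D sU.2 (int1Z 2 iUk)) sk.2) (ED sU.2 (int1Z 2 iUk)) (EZ _ iUk).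
  by move=> omega; rewrite /base; ring.
have comb : 2 * \int[M]_z (tind s T z.1 * h z.1 z.2 * (zeta z.1 z.2 - drift_lost (cut z.1) z.2)) =
   2 * \int[M]_z (tind s T z.1 * h z.1 z.2 * U z.2) +
   2 * \int[M]_z (tind s T z.1 * h z.1 z.2 * drift_kept (cut z.1) z.2) +
   2 * \int[M]_z (tind s T z.1 * h z.1 z.2 * mart_lim z).
  have ik := bounded_th_int1 mdkept (fun z => dkept_N z.1 z.2).
  rewrite -!mulrDr -(ED thU_int1 ik) -(ED (int1D thU_int1 ik) thm_int1); congr (_ * _).
  by apply: eqE => z; rewrite thU_E /mart_lim /drift_lost; ring.
have -> : \int[P]_omega ((B s omega * zeta s omega) ^+ 2) = \int[P]_omega (U omega ^+ 2) by [].
apply: (@le_trans _ _ (\int[P]_omega (base omega ^+ 2) + \int[M]_z (tind s T z.1 * (B z.1 z.2 * qvar z)) +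
   2 * \int[M]_z (tind s T z.1 * h z.1 z.2 * mart_lim z))); last by rewrite base2 comb; lra.
apply: (ler_cvg_to lhs rhs); apply: nearW => k.
have sbW := sqintD sbase (sW k sT).
apply: E_le; [exact: (sqint_bdM mBT BTb sbW).2|exact: sbW.2|].
move=> omega; rewrite exprMn -[leRHS]mul1r ler_wpM2r ?sqr_ge0// B_sqr; exact: B_le1.
Qed.

(** It bounds the discarded drift at all times, and tends to 0 as kap increases
    to 1. *)
Definition lost omega := \int[leb]_u (tind s T u * (B u omega * ((1 - kap u omega) * `|D u omega|))).

Let k1 r omega : 0 <= 1 - kap r omega.
Proof. by rewrite subr_ge0. Qed.

Let mlost_fun : measurable_fun setT (fun z : R * Omega => B z.1 z.2 * ((1 - kap z.1 z.2) * `|D z.1 z.2|)).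
Proof.
apply: measurable_funM; first exact: B_meas.
by apply: measurable_funM; [exact: measurable_funB|exact: measurableT_comp mD].
Qed.

Let lost_fun0 r omega : 0 <= B r omega * ((1 - kap r omega) * `|D r omega|).
Proof. by rewrite mulr_ge0 ?B_ge0// mulr_ge0. Qed.

Let lost_le r omega : `|B r omega * ((1 - kap r omega) * `|D r omega|)| <= B r omega * `|D r omega|.
Proof.
rewrite ger0_norm ?lost_fun0// ler_wpM2l ?B_ge0// ler_piMl//.
by rewrite gerBl.
Qed.

Let lost_int t omega (st : s <= t) (tT : t <= T) :=
  dom_int (f := fun r omega => B r omega * ((1 - kap r omega) * `|D r omega|)) (t := t) omega mlost_fun lost_le st tT.

Lemma lost_ge0 omega : 0 <= lost omega.
Proof. by apply: E_ge0 => u; rewrite mulr_ge0 ?tind_ge0. Qed.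

Lemma lost_N omega : lost omega <= N.
Proof. exact: le_trans (ler_norm _) (lost_int omega sT (lexx T)).2. Qed.

Lemma lost_meas : measurable_fun setT lost.
Proof.
apply: (@param_int_meas _ _ _ _ _ leb (fun z : R * Omega => tind s T z.1 * (B z.1 z.2 * ((1 - kap z.1 z.2) * `|D z.1 z.2|)))).
  by apply: measurable_funM => //; exact: tind_fst_meas.
by move=> omega; exact: (lost_int omega sT (lexx T)).1.
Qed.

Lemma drift_lost_le r omega : `|drift_lost (cut r) omega| <= lost omega.
Proof.
have [i1 _] := BD_int omega (cut_s r) (cut_T r).
have [i2 _] := h_int omega (cut_s r) (cut_T r).
rewrite /drift_lost /drift_int /drift_kept -(EB i1 i2).
apply: (le_trans (E_norm (int1B i1 i2))); apply: E_le.
- exact: int1_norm (int1B i1 i2).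
- exact: (lost_int omega sT (lexx T)).1.
move=> u; have -> : tind s (cut r) u * BD u omega - tind s (cut r) u * h u omega =
  tind s (cut r) u * (B u omega * ((1 - kap u omega) * D u omega)) by rewrite /BD /h; ring.
rewrite !normrM (ger0_norm (tind_ge0 _ _ _)) (ger0_norm (B_ge0 _ _ _ _)).
rewrite (ger0_norm (k1 _ _)); apply: ler_wpM2r; first exact: lost_fun0.
exact: tind_le.
Qed.

Lemma energy_terms_int1 : int1 M (fun z => tind s T z.1 * (B z.1 z.2 * qvar z)) /\
  int1 M (fun z => tind s T z.1 * (B z.1 z.2 * (kap z.1 z.2 * D z.1 z.2)) * zeta z.1 z.2).
Proof. by split; [exact: tBQ_E.1|exact: thzeta_int1]. Qed.

(** [energy_inequality_lost] with the discarded drift moved to an error term, by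
    Cauchy-Schwarz and the bound Kb on the second moments. *)
Lemma energy_cut Kb : (forall r, 0 <= r -> r <= T -> \int[P]_omega ((B r omega * zeta r omega) ^+ 2) <= Kb) ->
  \int[P]_omega ((B T omega * zeta T omega) ^+ 2) <=
  \int[P]_omega ((B s omega * zeta s omega) ^+ 2) +
  \int[M]_z (tind s T z.1 * (B z.1 z.2 * qvar z)) +
  2 * \int[M]_z (tind s T z.1 * (B z.1 z.2 * (kap z.1 z.2 * D z.1 z.2)) * zeta z.1 z.2) +
  (2 * (Num.sqrt Kb * Num.sqrt (N * \int[P]_omega lost omega)) + 2 * (N * \int[P]_omega lost omega)).
Proof.
move=> hKb; have TT := lexx T.
have mBT := measG_measurable HF T0 (B_F HF Cad N T0).1.
have BTb omega : `|B T omega| <= 1 by exact: nat01.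
have slost : sqint P lost.
  apply: (@sqint_bounded _ _ _ _ _ N); first exact: lost_meas.
  by move=> omega; rewrite ger0_norm ?lost_ge0// lost_N.
have ilost := sqint_int1 slost.
have lost2 : \int[P]_omega (lost omega ^+ 2) <= N * \int[P]_omega lost omega.
  rewrite -(EZ _ ilost); apply: E_le; [exact: slost.2|exact: int1Z|].
  by move=> omega; rewrite expr2 ler_wpM2r ?lost_ge0// lost_N.
have sz := szeta T0 TT.
have mdl : measurable_fun setT (fun z : R * Omega => drift_lost (cut z.1) z.2) by exact: measurable_funB.
have mdT : measurable_fun setT (drift_lost T).
  have := sect_meas T mdl (f := fun r omega => drift_lost (cut r) omega).
  by rewrite (cutE sT TT).
have dTle omega : `|drift_lost T omega| <= lost omega.
  by have := drift_lost_le T omega; rewrite cutE.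
have sd : sqint P (drift_lost T).
  split=> //; apply: (int1_le _ slost.2); first exact: measurable_sqr.
  by move=> omega; rewrite normrX lerXn2r ?nnegrE ?lost_ge0 ?dTle.
have sBd := sqint_bdM mBT BTb sd.
have lhs : \int[P]_omega ((B T omega * zeta T omega) ^+ 2) <=
  \int[P]_omega ((B T omega * (zeta T omega - drift_lost T omega)) ^+ 2) +
  2 * (Num.sqrt Kb * Num.sqrt (N * \int[P]_omega lost omega)).
  have i1 := sqintM sz sd.
  have e omega : (B T omega * (zeta T omega - drift_lost T omega)) ^+ 2 =
    (B T omega * zeta T omega - B T omega * drift_lost T omega) ^+ 2 by rewrite mulrBr.
  have i2 : int1 P (fun omega => (B T omega * (zeta T omega - drift_lost T omega)) ^+ 2).
    have := (sqintB sz sBd).2; congr int1; apply/funext => omega; exact/esym/e.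
  have : \int[P]_omega ((B T omega * zeta T omega) ^+ 2) <=
     \int[P]_omega ((B T omega * (zeta T omega - drift_lost T omega)) ^+ 2 +
     2 * (B T omega * zeta T omega * drift_lost T omega)).
    apply: E_le; [exact: sz.2|by apply: int1D => //; exact: int1Z|].
    move=> omega; rewrite e.
    by case: (B01 T omega) => BT1; rewrite BT1; have := sqr_ge0 (drift_lost T omega); lra.
  move/le_trans; apply; rewrite (ED i2 (int1Z 2 i1)) (EZ _ i1) lerD2l ler_pM2l//.
  apply: (le_trans (ler_norm _)); apply: (le_trans (E_CS_norm sz sd)).
  apply: ler_pM; rewrite ?sqrtr_ge0// ler_wsqrtr//; first exact: hKb.
  apply: le_trans lost2; apply: E_le; [exact: sd.2|exact: slost.2|].
  move=> omega /=; rewrite -(real_normK (num_real (drift_lost T omega))).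
  by rewrite lerXn2r ?nnegrE ?lost_ge0 ?dTle.
have rhs : \int[M]_z (tind s T z.1 * h z.1 z.2 * (zeta z.1 z.2 - drift_lost (cut z.1) z.2)) <=
    \int[M]_z (tind s T z.1 * h z.1 z.2 * zeta z.1 z.2) + N * \int[P]_omega lost omega.
  have dlN z : `|drift_lost (cut z.1) z.2| <= N.
    exact: le_trans (drift_lost_le _ _) (lost_N _).
  have idl := bounded_th_int1 mdl dlN.
  have absm : measurable_fun setT (fun z : R * Omega => B z.1 z.2 * `|D z.1 z.2|).
    by apply: measurable_funM; [exact: B_meas|exact: measurableT_comp mD].
  pose g (z : R * Omega) := tind s T z.1 * (B z.1 z.2 * `|D z.1 z.2|) * lost z.2.
  have mg : measurable_fun setT g.
    apply: measurable_funM; last exact: (measurableT_comp lost_meas measurable_snd).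
    by apply: measurable_funM => //; exact: tind_fst_meas.
  have g0 z : 0 <= g z by rewrite /g mulr_ge0 ?lost_ge0// mulr_ge0 ?tind_ge0// mulr_ge0 ?B_ge0.
  have di omega := drift_clock omega s0 sT TT.
  have ig omega : int1 leb (fun r => g (r, omega)).
    have := int1Z (lost omega) (di omega).1; congr int1; apply/funext => r; exact: mulrC.
  have gE omega : \int[leb]_r g (r, omega) =
     lost omega * \int[leb]_r (tind s T r * (B r omega * `|D r omega|)).
    by rewrite -(EZ _ (di omega).1); apply: eqE => r; rewrite /g mulrC.
  have gle omega : \int[leb]_r g (r, omega) <= N * lost omega.
    by rewrite gE mulrC ler_wpM2r ?lost_ge0// (di omega).2.
  have iG : int1 P (fun omega => \int[leb]_r g (r, omega)).
    apply: (int1_le _ (int1Z N ilost)); first exact: (tonelli_meas mg g0).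
    by move=> omega; rewrite ger0_norm ?gle// E_ge0.
  have [igM gM] := tonelli_E mg g0 ig iG.
  have -> : \int[M]_z (tind s T z.1 * h z.1 z.2 * (zeta z.1 z.2 - drift_lost (cut z.1) z.2)) =
     \int[M]_z (tind s T z.1 * h z.1 z.2 * zeta z.1 z.2) -
     \int[M]_z (tind s T z.1 * h z.1 z.2 * drift_lost (cut z.1) z.2).
    by rewrite -(EB thzeta_int1 idl); apply: eqE => z; rewrite mulrBr.
  rewrite lerD2l; apply: (le_trans (ler_norm _)); rewrite normrN.
  apply: (le_trans (E_norm idl)); apply: (@le_trans _ _ (\int[M]_z g z)).
    apply: E_le => //; first exact: int1_norm.
    move=> z; rewrite normrM ler_pM ?drift_lost_le//.
    by rewrite normrM ger0_norm ?tind_ge0// ler_wpM2l ?tind_ge0.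
  by rewrite gM -(EZ _ ilost); apply: E_le => //; exact: int1Z.
apply: (le_trans lhs).
have := energy_inequality_lost; move: rhs; rewrite /h.
set a1 := \int[P]_omega _; set a2 := \int[P]_omega _; set a3 := \int[M]_z _.
set a4 := \int[M]_z _; set a5 := \int[M]_z _; set a6 := N * _.
by move: (Num.sqrt Kb * _) => a7 h1 h2; lra.
Qed.

End energy_inequality.
End scalar_ito.

(** * Absolute continuity and a Gronwall inequality *)

Section absolute_continuity.
Context {R : realType}.
Local Notation leb := (@lebesgue_measure R).

Lemma tind_sub_int1 (a : R -> R) (S T s t : R) : measurable_fun setT a ->
  (forall r, 0 <= a r) -> int1 leb (fun r => tind S T r * a r) ->
  S <= s -> t <= T -> int1 leb (fun r => tind s t r * a r).
Proof.
move=> ma a0 ia Ss tT; apply: (int1_le _ ia).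
  by apply: measurable_funM => //; exact: tind_meas.
move=> r; rewrite ger0_norm ?mulr_ge0 ?tind_ge0// ler_wpM2r//; exact: tind_le.
Qed.

(** a is split at a level k: the part above k has small integral by dominated
    convergence, the part below is at most k. *)
Lemma abs_cont (a : R -> R) (S T : R) : measurable_fun setT a ->
  (forall r, 0 <= a r) -> int1 leb (fun r => tind S T r * a r) ->
  forall e, 0 < e -> exists2 eta, 0 < eta & forall s t, S <= s -> s <= t -> t <= T ->
    t - s <= eta -> \int[leb]_r (tind s t r * a r) <= e.
Proof.
move=> ma a0 ia e e0.
pose u (k : nat) r := tind S T r * a r * (1 - (a r <= k%:R)%R%:R).
have mu k : measurable_fun setT (u k).
  apply: measurable_funM; first by apply: measurable_funM => //; exact: tind_meas.
  by apply: measurable_funB => //; exact: measurable_le_indic.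
have ta0 r : 0 <= tind S T r * a r by rewrite mulr_ge0 ?tind_ge0.
have uge k r : 0 <= u k r.
  by rewrite mulr_ge0// subr_ge0; case: (a r <= k%:R)%R.
have ule k r : `|u k r| <= tind S T r * a r.
  rewrite ger0_norm// ler_piMr// gerBl; by case: (a r <= k%:R)%R.
have iu k : int1 leb (u k) by apply: (int1_le _ ia); [exact: mu|exact: ule].
have u0 : (fun k => \int[leb]_r u k r) @ \oo --> (0 : R).
  apply: (@E_dct0 _ _ _ leb u (fun r => tind S T r * a r)) => // r.
  apply: cvg_near_cst; near=> k.
  rewrite /u (_ : (a r <= k%:R)%R = true) ?subrr ?mulr0//.
  by near: k; exact: nbhs_infty_ger.
have e20 : 0 < e / 2 by rewrite divr_gt0.
move/cvgrPdist_le: u0 => /(_ _ e20) [k _ /(_ k (leqnn k))].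
rewrite sub0r normrN ger0_norm; last exact: E_ge0.
move=> hk; exists (e / 2 / k.+1%:R); first by rewrite divr_gt0.
move=> s t Ss st tT ts.
have i1 := int1Z k%:R (tind_int1 s t); have i2 := int1D i1 (iu k).
apply: (@le_trans _ _ (\int[leb]_r (k%:R * tind s t r + u k r))).
  apply: E_le => //; first exact: (tind_sub_int1 ma a0 ia Ss tT).
  move=> r; rewrite /u; have [ak|ak] := leP (a r) k%:R.
    by rewrite subrr mulr0 addr0 mulrC ler_wpM2r ?tind_ge0.
  rewrite subr0 mulr1 ler_wpDl ?mulr_ge0 ?tind_ge0// ler_wpM2r//; exact: tind_le.
rewrite (ED i1 (iu k)) (EZ _ (tind_int1 s t)) tind_E (max_idPr _) ?subr_ge0//.
have : k%:R * (t - s) <= e / 2.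
  apply: (@le_trans _ _ (k.+1%:R * (t - s))).
    by rewrite ler_wpM2r ?subr_ge0// ler_nat.
  by rewrite mulrC -ler_pdivlMr.
by move: hk; lra.
Unshelve. all: by end_near. Qed.

(** Absolute continuity on a window around t gives a common modulus on both
    sides of t. *)
Lemma indefinite_continuous (a : R -> R) : measurable_fun setT a ->
  (forall r, 0 <= a r) -> (forall T, int1 leb (fun r => tind 0 T r * a r)) ->
  continuous (fun t => \int[leb]_r (tind 0 t r * a r)).
Proof.
move=> ma a0 ia t.
have mono (s u : R) : s <= u -> \int[leb]_r (tind 0 s r * a r) <= \int[leb]_r (tind 0 u r * a r).
  by move=> su; apply: E_le => // r; rewrite ler_wpM2r//; exact: tind_le.
have diff (s u : R) : s <= u -> \int[leb]_r (tind 0 u r * a r) - \int[leb]_r (tind 0 s r * a r) <=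
    \int[leb]_r (tind s u r * tind 0 u r * a r).
  move=> su; rewrite -(EB (ia u) (ia s)); apply: E_le.
  - exact: int1B.
  - apply: (int1_le _ (ia u)).
      by apply: measurable_funM => //; apply: measurable_funM; exact: tind_meas.
    move=> r; rewrite ger0_norm ?mulr_ge0 ?tind_ge0// ler_wpM2r// -[leRHS]mul1r.
    by rewrite ler_wpM2r ?tind_ge0// (le_trans (ler_norm _))// tind_norm.
  - move=> r; rewrite -mulrBl ler_wpM2r// !tindE.
    case: (0 < r)%R => /=; last by rewrite subrr mulr0.
    have [rs|sr] := leP r s; first by rewrite (le_trans rs su) subrr.
    by case: (r <= u)%R; rewrite /= ?subrr ?subr0 ?mulr1 ?mulr0.
apply/cvgrPdist_le => e e0.
have mta : measurable_fun setT (fun r => tind 0 (t + 1) r * a r).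
  by apply: measurable_funM => //; exact: tind_meas.
have mta0 r : 0 <= tind 0 (t + 1) r * a r by rewrite mulr_ge0 ?tind_ge0.
have ita : int1 leb (fun r => tind (t - 1) (t + 1) r * (tind 0 (t + 1) r * a r)).
  apply: (int1_le _ (ia (t + 1))); first by apply: measurable_funM => //; exact: tind_meas.
  move=> r; rewrite ger0_norm ?mulr_ge0 ?tind_ge0// ler_piMl ?mulr_ge0 ?tind_ge0//.
  by rewrite (le_trans (ler_norm _))// tind_norm.
have [eta eta0 heta] := abs_cont mta mta0 ita e0.
have key (s u : R) : t - 1 <= s -> s <= u -> u <= t + 1 -> u - s <= eta ->
    \int[leb]_r (tind 0 u r * a r) - \int[leb]_r (tind 0 s r * a r) <= e.
  move=> ts su ut us; apply: le_trans (diff s u su) _.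
  apply: le_trans (heta s u ts su ut us); apply: E_le.
  - apply: (int1_le _ (ia u)).
      by apply: measurable_funM => //; apply: measurable_funM; exact: tind_meas.
    move=> r; rewrite ger0_norm ?mulr_ge0 ?tind_ge0// ler_wpM2r// -[leRHS]mul1r.
    by rewrite ler_wpM2r ?tind_ge0// (le_trans (ler_norm _))// tind_norm.
  - apply: (int1_le _ (ia (t + 1))); first by apply: measurable_funM => //; exact: tind_meas.
    move=> r; rewrite ger0_norm ?mulr_ge0 ?tind_ge0// ler_piMl ?mulr_ge0 ?tind_ge0//.
    by rewrite (le_trans (ler_norm _))// tind_norm.
  - by move=> r; rewrite -mulrA ler_wpM2l ?tind_ge0// ler_wpM2r//; exact: tind_le.
near=> u.
have d1 : `|t - u| <= 1 by near: u; apply: cvgr_dist_le => //; exact: cvg_id.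
have d2 : `|t - u| <= eta by near: u; apply: cvgr_dist_le => //; exact: cvg_id.
have [tu|ut] := leP t u.
  rewrite distrC ger0_norm ?subr_ge0 ?mono//.
  move: d1 d2; rewrite distrC ger0_norm ?subr_ge0// => d1 d2.
  by apply: key => //; lra.
have ut0 : 0 <= t - u by rewrite subr_ge0 ltW.
rewrite ger0_norm; last by rewrite subr_ge0 mono// ltW.
move: d1 d2; rewrite (ger0_norm ut0) => d1 d2.
by apply: key => //; lra.
Unshelve. all: by end_near. Qed.

End absolute_continuity.

Section gronwall.
Context {R : realType}.
Local Notation leb := (@lebesgue_measure R).
Variables (psi a : R -> R) (lam T Kb : R).
Hypotheses (T0 : 0 <= T) (lam0 : 0 <= lam).
Hypotheses (mpsi : measurable_fun setT psi) (psi0 : forall r, 0 <= psi r).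
Hypothesis psiK : forall r, 0 <= r -> r <= T -> psi r <= Kb.
Hypotheses (ma : measurable_fun setT a) (a0 : forall r, 0 <= a r).
Hypothesis ia : int1 leb (fun r => tind 0 T r * a r).
Hypothesis step : forall s t, 0 <= s -> s <= t -> t <= T ->
  psi t <= psi s + \int[leb]_r (tind s t r * ((- lam + a r) * psi r)).

Let al s t := \int[leb]_r (tind s t r * a r).

Let ial s t : 0 <= s -> t <= T -> int1 leb (fun r => tind s t r * a r).
Proof. exact: (tind_sub_int1 ma a0 ia). Qed.

Let al0 s t : 0 <= al s t.
Proof. by apply: E_ge0 => r; rewrite mulr_ge0 ?tind_ge0. Qed.

Let Kb0 : 0 <= Kb.
Proof. exact: le_trans (psi0 0) (psiK (lexx 0) T0). Qed.

(** The term in -lam is bounded with the lower bound c of psi, the one in a with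
    its upper bound e. *)
Let int_bd s t c e : 0 <= s -> s <= t -> t <= T -> 0 <= e ->
  (forall r, s < r -> r <= t -> c <= psi r /\ psi r <= e) ->
  \int[leb]_r (tind s t r * ((- lam + a r) * psi r)) <= - lam * (t - s) * c + al s t * e.
Proof.
move=> s0 st tT e0 h.
have i1 := int1Z (- lam * c) (tind_int1 s t); have i2 := int1Z e (ial s0 tT).
have -> : - lam * (t - s) * c + al s t * e =
    \int[leb]_r (- lam * c * tind s t r + e * (tind s t r * a r)).
  rewrite (ED i1 i2) (EZ _ (tind_int1 s t)) (EZ _ (ial s0 tT)) tind_E.
  by rewrite (max_idPr _) ?subr_ge0// -/(al s t); ring.
have le r : tind s t r * ((- lam + a r) * psi r) <= - lam * c * tind s t r + e * (tind s t r * a r).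
  rewrite tindE; case: (boolP ((s < r) && (r <= t))) => [/andP[sr rt]|_]; last by rewrite !mul0r !mulr0 addr0.
  have [h1 h2] := h r sr rt; have := a0 r; have := lam0.
  rewrite !mul1r mulr1 mulrDl; move: (psi r) (a r) h1 h2 => x y h1 h2 l0 y0.
  by apply: lerD; [nra|rewrite mulrC ler_wpM2r].
apply: E_le => //; last exact: int1D.
apply: (int1_le _ (int1Z Kb (int1D (int1Z lam (tind_int1 s t)) (ial s0 tT)))).
  apply: measurable_funM; first exact: tind_meas.
  by apply: measurable_funM => //; exact: measurable_funD.
move=> r; rewrite tindE; case: (boolP ((s < r) && (r <= t))) => [/andP[sr rt]|_]; last first.
  by rewrite !mul0r normr0 mulr0 addr0 mulr0.
have pK := psiK (le_trans s0 (ltW sr)) (le_trans rt tT).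
rewrite !mul1r mulr1 normrM (ger0_norm (psi0 r)) mulrC ler_pM//.
by rewrite (le_trans (ler_normD _ _))// normrN !ger0_norm.
Qed.

(** On a cell where a has integral at most e, psi grows by at most Kb e. Hence
    on the cell psi is at least psi t - Kb e and at most psi s + Kb e, and the
    one-step inequality becomes a semi-implicit Euler step up to an error of
    second order. *)
Let one_cell s t e : 0 <= s -> s <= t -> t <= T -> al s t <= e ->
  psi t * (1 + lam * (t - s)) <= psi s * (1 + al s t) + Kb * e * (lam * (t - s) + al s t).
Proof.
move=> s0 st tT ae; have e0 := le_trans (al0 s t) ae.
have al_mono s' t' : s <= s' -> t' <= t -> al s' t' <= al s t.
  move=> ss tt; apply: E_le.
  - apply: ial; [exact: le_trans ss|exact: le_trans tt tT].
  - exact: ial.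
  - by move=> r; rewrite ler_wpM2r//; exact: tind_le.
have growth s' t' : s <= s' -> s' <= t' -> t' <= t -> psi t' <= psi s' + Kb * e.
  move=> ss st' tt; apply: le_trans (step (le_trans s0 ss) st' (le_trans tt tT)) _.
  rewrite lerD2l; apply: le_trans (int_bd (c := 0) (le_trans s0 ss) st' (le_trans tt tT) Kb0 _) _.
    move=> r sr rt; split=> //; apply: psiK; last exact: le_trans rt (le_trans tt tT).
    exact: le_trans (le_trans s0 ss) (ltW sr).
  rewrite mulr0 add0r mulrC ler_wpM2l//; exact: le_trans (al_mono _ _ ss tt) ae.
have bnd r : s < r -> r <= t -> psi t - Kb * e <= psi r /\ psi r <= psi s + Kb * e.
  move=> sr rt; split; last by apply: growth => //; exact: ltW.
  by rewrite lerBlDr; apply: growth => //; exact: ltW.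
have e1 : 0 <= psi s + Kb * e by rewrite addr_ge0 ?mulr_ge0.
have := le_trans (step s0 st tT) (lerD (lexx _) (int_bd s0 st tT e1 bnd)).
by lra.
Qed.

Let expR_quad (x : R) : 0 <= x -> expR (x - x ^+ 2) <= 1 + x.
Proof.
move=> x0; have h := expR_ge1Dx (x ^+ 2 - x).
have e0 := expR_gt0 (x - x ^+ 2).
have e1 : expR (x - x ^+ 2) * expR (x ^+ 2 - x) = 1.
  by rewrite -expRD (_ : _ + _ = 0) ?expR0//; ring.
have h2 : 1 <= (1 + x) * (1 + (x ^+ 2 - x)).
  by have := exprn_ge0 3 x0; lra.
have h3 : 0 <= 1 + x by lra.
rewrite -[leLHS]mulr1; apply: (@le_trans _ _ (expR (x - x ^+ 2) * ((1 + x) * expR (x ^+ 2 - x)))).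
  rewrite ler_wpM2l ?(ltW e0)//; apply: (le_trans h2); rewrite ler_wpM2l//.
by rewrite mulrCA e1 mulr1.
Qed.

Let one_cell_exp s t e : 0 <= s -> s <= t -> t <= T -> al s t <= e ->
  psi t <= psi s * expR (al s t - lam * (t - s) + (lam * (t - s)) ^+ 2) +
    Kb * e * (lam * (t - s) + al s t).
Proof.
move=> s0 st tT ae; have h := one_cell s0 st tT ae.
have e0 := le_trans (al0 s t) ae.
set x := lam * (t - s) in h *; have x0 : 0 <= x by rewrite mulr_ge0 ?subr_ge0.
set E := expR (x - x ^+ 2); have E0' : 0 < E by exact: expR_gt0.
have Ex : E <= 1 + x by exact: expR_quad.
have -> : al s t - x + x ^+ 2 = al s t + - (x - x ^+ 2) by ring.
rewrite expRD expRN -/E.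
have y0 : 0 <= Kb * e * (x + al s t) by rewrite !mulr_ge0 ?addr_ge0.
have x1 : 0 < 1 + x by lra.
have : psi t <= (psi s * (1 + al s t)) / (1 + x) + Kb * e * (x + al s t).
  rewrite -(ler_pM2r x1) mulrDl divfK ?gt_eqF//; apply: le_trans h _.
  by rewrite lerD2l ler_peMr// lerDl.
move/le_trans; apply; rewrite lerD2r -mulrA ler_wpM2l//.
rewrite ler_pM//; [by rewrite addr_ge0|by rewrite invr_ge0 ltW|exact: expR_ge1Dx|].
by rewrite lef_pV2.
Qed.

(** Iterating [one_cell_exp]: the cells are so small that a has integral at most
    e on each, and so short that the quadratic errors (lam D)^2 add up to at
    most e. *)
Let partition_bound (e : R) : 0 < e -> e <= 1 ->
  psi T <= expR (al 0 T - lam * T) * (expR e * (psi 0 + e * (expR (lam * T) * Kb * (lam * T + al 0 T)))).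
Proof.
move=> e0 e1.
have [eta eta0 heta] := abs_cont ma a0 ia e0.
pose D0 := Num.min eta (e / (1 + lam ^+ 2 * T)).
have den0 : 0 < 1 + lam ^+ 2 * T.
  by have := mulr_ge0 (sqr_ge0 lam) T0; lra.
have D00 : 0 < D0 by rewrite lt_min eta0 divr_gt0.
pose p := (Num.bound (T / D0)).+1.
have p0 : 0 < p%:R :> R by rewrite ltr0n.
pose D := T / p%:R.
have Dge0 : 0 <= D by rewrite divr_ge0// ltW.
have DD0 : D <= D0.
  rewrite ler_pdivrMr// -ler_pdivrMl// mulrC; apply: (@le_trans _ _ (Num.bound (T / D0))%:R).
    by apply: ltW; apply: archi_boundP; rewrite divr_ge0// ltW.
  by rewrite ler_nat.
pose t (i : nat) := i%:R * D.
have t0 i : 0 <= t i by rewrite mulr_ge0.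
have tS i : t i.+1 - t i = D by rewrite /t -natr1; ring.
have tt i : t i <= t i.+1 by rewrite -subr_ge0 tS.
have tp : t p = T by rewrite /t /D mulrCA divff ?mulr1// gt_eqF.
have tT i : (i <= p)%N -> t i <= T by move=> ip; rewrite -tp ler_wpM2r// ler_nat.
have ale i : (i < p)%N -> al (t i) (t i.+1) <= e.
  move=> ip; apply: heta => //; first exact: tT.
  by rewrite tS (le_trans DD0)// ge_min lexx.
pose G i := al 0 (t i) - lam * t i + lam ^+ 2 * D * t i.
pose Er i := expR (lam * T) * Kb * e * (lam * t i + al 0 (t i)).
have alS i : (i < p)%N -> al 0 (t i.+1) = al 0 (t i) + al (t i) (t i.+1).
  move=> ip; rewrite /al -ED; [|exact: ial (tT _ (ltnW ip))|exact: ial (t0 i) (tT _ ip)].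
  by apply: eqE => r; rewrite (tind_add r (t0 i) (tt i)) mulrDl.
have ind i : (i <= p)%N -> psi (t i) <= expR (G i) * (psi 0 + Er i).
  elim: i => [_|i IH ip].
    rewrite /G /Er /t !mul0r !mulr0 addr0 subr0.
    have -> : al 0 0 = 0.
      by rewrite -[RHS](E0 leb); apply: eqE => r; rewrite tindE; case: ltP => // h; rewrite ?mul0r// leNgt h mul0r.
    by rewrite expR0 mul1r addr0 mulr0 addr0.
  have c1 := one_cell_exp (t0 i) (tt i) (tT _ ip) (ale i ip).
  rewrite tS in c1; apply: (le_trans c1).
  set al' := al (t i) (t i.+1) in c1 *.
  have tE : t i.+1 = t i + D by rewrite -(tS i); ring.
  have GS : G i.+1 = G i + (al' - lam * D + (lam * D) ^+ 2).
    by rewrite /G (alS i ip) -/al' tE; ring.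
  have ErS : Er i.+1 = Er i + expR (lam * T) * Kb * e * (lam * D + al').
    by rewrite /Er (alS i ip) -/al' tE; ring.
  rewrite GS (expRD (G i)) ErS [X in _ <= _ * X]addrA [leRHS]mulrDr; apply: lerD.
    by rewrite mulrAC ler_wpM2r ?expR_ge0// IH// ltnW.
  have big : 1 <= expR (G i) * expR (al' - lam * D + (lam * D) ^+ 2) * expR (lam * T).
    rewrite -!expRD -GS -expR0 ler_expR /G.
    have h1 := al0 0 (t i.+1); have h2 : 0 <= lam ^+ 2 * D * t i.+1 by rewrite !mulr_ge0 ?sqr_ge0.
    have h3 : lam * t i.+1 <= lam * T by rewrite ler_wpM2l// tT.
    by lra.
  have y0 : 0 <= Kb * e * (lam * D + al').
    apply: mulr_ge0; first by apply: mulr_ge0 => //; exact: ltW.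
    by apply: addr_ge0; [exact: mulr_ge0|exact: al0].
  rewrite -[leLHS]mul1r (_ : _ * (expR (lam * T) * Kb * e * _) =
    expR (G i) * expR (al' - lam * D + (lam * D) ^+ 2) * expR (lam * T) * (Kb * e * (lam * D + al'))).
    by rewrite ler_wpM2r.
  by ring.
have := ind p (leqnn p); rewrite tp => /le_trans; apply.
have -> : psi 0 + Er p = psi 0 + e * (expR (lam * T) * Kb * (lam * T + al 0 T)).
  by rewrite /Er tp; ring.
rewrite [leRHS]mulrA -expRD; apply: ler_wpM2r.
  apply: addr_ge0 => //; apply: mulr_ge0; first exact: ltW.
  apply: mulr_ge0; first by apply: mulr_ge0 => //; exact: expR_ge0.
  by apply: addr_ge0; [exact: mulr_ge0|exact: al0].
rewrite ler_expR /G tp lerD2l.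
have : D <= e / (1 + lam ^+ 2 * T) by rewrite (le_trans DD0)// ge_min lexx orbT.
rewrite ler_pdivlMr// => h; have := Dge0; lra.
Qed.

(** Only the integral inequality from s to t is available, with a decay term in
    it, so that the usual monotone iteration does not apply; the bound is
    obtained from products of one-cell estimates as the mesh tends to 0. *)
Lemma gronwall : psi T <= psi 0 * expR (al 0 T - lam * T).
Proof.
pose c := expR (lam * T) * Kb * (lam * T + al 0 T).
pose f (k : nat) := expR (al 0 T - lam * T) * (expR (k.+1%:R^-1) * (psi 0 + k.+1%:R^-1 * c)).
have fk k : psi T <= f k.
  by apply: partition_bound; rewrite ?invr_gt0// invf_le1// ler1n.
have lim : f @ \oo --> expR (al 0 T - lam * T) * (expR 0 * (psi 0 + 0 * c)).
  have h : (fun k => k.+1%:R^-1 : R) @ \oo --> (0 : R) by exact: (@cvg_harmonic R).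
  apply: cvgMr; apply: cvgM.
    by apply: continuous_cvg => //; exact: continuous_expR.
  by apply: cvgD; [exact: cvg_cst|exact: cvgMl].
have : psi T <= expR (al 0 T - lam * T) * (expR 0 * (psi 0 + 0 * c)).
  rewrite -(cvg_lim _ lim)//; apply: limr_ge; first by apply/cvg_ex; eexists; exact: lim.
  exact: nearW.
by rewrite expR0 mul1r mul0r addr0 mulrC.
Qed.

End gronwall.

(** * Decay of the stopped Lyapunov function *)

Section lyapunov_decay.
Context {R : realType} {d : measure_display} {Omega : measurableType d}.
Variables (P : probability Omega R) (F : R -> set (set Omega)).
Variables (n q : nat) (K : 'M[R]_q) (w : R -> Omega -> 'cV[R]_q).
Hypotheses (HF : usual_filtration P F) (Hw : wiener_process P F K w).
Local Notation leb := (@lebesgue_measure R).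
Local Notation M := (leb \x P)%E.
Variables (x D : R -> Omega -> 'cV[R]_n) (Gam : R -> Omega -> 'M[R]_(n, q)).
Variables (J : R -> 'I_n -> 'I_q -> Omega -> R) (z0 : 'cV[R]_n) (S : 'M[R]_n).
Hypothesis mx : forall i, measurable_fun setT (fun z : R * Omega => x z.1 z.2 i 0).
Hypothesis xad : forall i r, 0 <= r -> measG (F r) (fun omega => x r omega i 0).
Hypothesis mD : forall i, measurable_fun setT (fun z : R * Omega => D z.1 z.2 i 0).
Hypothesis Dad : forall i r, 0 <= r -> measG (F r) (fun omega => D r omega i 0).
Hypothesis mGam : forall i j, measurable_fun setT (fun z : R * Omega => Gam z.1 z.2 i j).
Variable C : R -> Omega -> R.
Hypothesis C0 : forall omega, C 0 omega = 0.
Hypothesis Cnd : forall omega, {homo C ^~ omega : s t / s <= t}.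
Hypothesis Cc : forall omega, continuous (C ^~ omega).
Hypothesis Cad : forall t, 0 <= t -> measG (F t) (C t).
Hypothesis Cm : measurable_fun setT (fun z : R * Omega => C z.1 z.2).
Hypothesis DC : forall i omega s t, 0 <= s -> s <= t ->
  int1 leb (fun r => tind s t r * `|D r omega i 0|) /\
  \int[leb]_r (tind s t r * `|D r omega i 0|) <= C t omega - C s omega.
Hypothesis SDC : forall l omega s t, 0 <= s -> s <= t ->
  int1 leb (fun r => tind s t r * `|(S *m D r omega) l 0|) /\
  \int[leb]_r (tind s t r * `|(S *m D r omega) l 0|) <= C t omega - C s omega.
Hypothesis GC : forall i j omega s t, 0 <= s -> s <= t ->
  int1 leb (fun r => tind s t r * Gam r omega i j ^+ 2) /\
  \int[leb]_r (tind s t r * Gam r omega i j ^+ 2) <= C t omega - C s omega.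
Hypothesis HJ : forall r, 0 <= r -> forall i j,
  ito_lim P F w (fun r omega => Gam r omega i j) j r (J r i j).
Hypothesis sde : forall r, 0 <= r -> {ae P, forall omega, forall i,
  x r omega i 0 = z0 i 0 + (\int[leb]_u (tind 0 r u * D u omega i 0)) + \sum_j J r i j omega}.
Variables (a : R -> R) (lam : R).
Hypotheses (ma : measurable_fun setT a) (a0 : forall r, 0 <= a r) (lam0 : 0 <= lam).
Hypothesis ia : forall T, int1 leb (fun r => tind 0 T r * a r).

Definition lyapV r omega := \sum_l (S *m x r omega) l 0 ^+ 2.
(** The Ito correction in the drift of |S x|^2. *)
Definition noise_rate r omega := \sum_l \sum_j \sum_j' K j j' *
  ((S *m Gam r omega) l j * (S *m Gam r omega) l j').
Hypothesis lyap : forall r omega, 0 < r ->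
  2 * (\sum_l (S *m x r omega) l 0 * (S *m D r omega) l 0) + noise_rate r omega <=
  (- lam + a r) * lyapV r omega.

Section stopped.
Variable N : R.
Hypothesis N0 : 0 <= N.
Local Notation B := (Bind C N).

Let I := ('I_n * 'I_q)%type.
Let zeta l r omega := (S *m x r omega) l 0.
Let Dl l r omega := (S *m D r omega) l 0.
Let cl (l : 'I_n) (k : I) := S l k.1.
Let Hk (k : I) r omega := Gam r omega k.1 k.2.
Let Jk (k : I) r omega := J r k.1 k.2 omega.

Let mulmx_meas (Y : R -> Omega -> 'cV[R]_n) l :
  (forall i, measurable_fun setT (fun z : R * Omega => Y z.1 z.2 i 0)) ->
  measurable_fun setT (fun z : R * Omega => (S *m Y z.1 z.2) l 0).
Proof.
move=> mY; rewrite (_ : (fun _ => _) = fun z : R * Omega => \sum_i S l i * Y z.1 z.2 i 0).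
  by apply: measurable_sum => i; exact: measurable_funM.
by apply/funext => z; rewrite mxE.
Qed.

Let mulmx_adapted (Y : R -> Omega -> 'cV[R]_n) l r : 0 <= r ->
  (forall i r, 0 <= r -> measG (F r) (fun omega => Y r omega i 0)) ->
  measG (F r) (fun omega => (S *m Y r omega) l 0).
Proof.
move=> r0 mY; have sF := F_sigma HF r0.
rewrite (_ : (fun _ => _) = fun omega => \sum_i S l i * Y r omega i 0).
  by apply: (measG_sum sF) => i; apply: (measGM sF); [exact: measG_cst|exact: mY].
by apply/funext => z; rewrite mxE.
Qed.

Let mzeta l := mulmx_meas (Y := x) l mx.
Let mDl l := mulmx_meas (Y := D) l mD.
Let zetaad l r (r0 : 0 <= r) := mulmx_adapted (Y := x) l r0 xad.
Let Dlad l r (r0 : 0 <= r) := mulmx_adapted (Y := D) l r0 Dad.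

Let tDi_int1 i t omega : 0 <= t -> int1 leb (fun u => tind 0 t u * D u omega i 0).
Proof.
move=> t0; apply: (int1_le _ (DC i omega (lexx 0) t0).1).
  apply: measurable_funM; first exact: tind_meas.
  exact: (path_meas (f := fun r omega => D r omega i 0) omega (mD i)).
by move=> r; rewrite normrM ger0_norm ?tind_ge0.
Qed.

Let sde_l l r : 0 <= r -> {ae P, forall omega, zeta l r omega = (S *m z0) l 0 +
  (\int[leb]_u (tind 0 r u * Dl l u omega)) + \sum_(k : I) cl l k * Jk k r omega}.
Proof.
move=> r0; apply: filterS (sde r0) => omega e.
rewrite /zeta mxE (eq_bigr (fun i => S l i * z0 i 0 + S l i * (\int[leb]_u (tind 0 r u * D u omega i 0)) +
   \sum_j S l i * J r i j omega)); last first.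
  by move=> i _; rewrite e !mulrDr mulr_sumr.
rewrite !big_split/= mxE; congr (_ + _ + _).
  transitivity (\int[leb]_u \sum_i S l i * (tind 0 r u * D u omega i 0)).
    rewrite E_sum; last by move=> i; apply: int1Z; exact: tDi_int1.
    by apply: eq_bigr => i _; rewrite EZ//; exact: tDi_int1.
  apply: eqE => u; rewrite /Dl mxE mulr_sumr; apply: eq_bigr => i _.
  by rewrite mulrCA.
by rewrite pair_big.
Qed.

Let HJk k r T : 0 <= r -> r <= T -> ito_lim P F w (Hk k) k.2 r (Jk k r).
Proof. by move=> r0 _; exact: HJ. Qed.

Let noise_rateE (z : R * Omega) : noise_rate z.1 z.2 = \sum_l qvar K snd (cl l) Hk z.
Proof.
apply: eq_bigr => l _; rewrite /qvar -(pair_big xpredT xpredT (fun i j =>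
  \sum_(b : I) cl l (i, j) * cl l b * K j b.2 * (Hk (i, j) z.1 z.2 * Hk b z.1 z.2)))/=.
rewrite [RHS]exchange_big/=; apply: eq_bigr => j _.
transitivity (\sum_i \sum_(j' < q) \sum_(i' < n) S l i * S l i' * K j j' * (Gam z.1 z.2 i j * Gam z.1 z.2 i' j')).
  rewrite [RHS]exchange_big/=; apply: eq_bigr => j' _.
  rewrite !mxE mulr_suml mulr_sumr; apply: eq_bigr => i _.
  by rewrite !mulr_sumr; apply: eq_bigr => i' _; ring.
apply: eq_bigr => i _; rewrite exchange_big/=.
by rewrite (pair_big xpredT xpredT (fun i' j' => S l i * S l i' * K j j' * (Gam z.1 z.2 i j * Gam z.1 z.2 i' j'))).
Qed.

Let stopped_bound T : 0 <= T -> exists Kb, forall l r, 0 <= r -> r <= T ->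
  sqint P (fun omega => B r omega * zeta l r omega) /\
  \int[P]_omega ((B r omega * zeta l r omega) ^+ 2) <= Kb.
Proof.
move=> T0.
have h l := @zeta_stopped_bound _ _ _ P F q K w HF Hw C C0 Cnd Cc Cad Cm N N0 I snd (cl l) Hk Jk
  (fun k => mGam k.1 k.2) (fun k => GC k.1 k.2) (Dl l) (zeta l) (mDl l) (SDC l) (mzeta l)
  T ((S *m z0) l 0) T0 (fun k r r0 rT => HJk k r0 rT) (fun r r0 _ => sde_l l r0).
have /choice[Kb hKb] := h; exists (\sum_l `|Kb l|) => l r r0 rT.
have [h1 h2] := hKb l r r0 rT; split=> //; apply: le_trans h2 _.
by rewrite (bigD1 l)//= (le_trans (ler_norm _))// lerDl sumr_ge0.
Qed.

Let BV_int1 r : 0 <= r -> int1 P (fun omega => B r omega * lyapV r omega) /\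
  \int[P]_omega (B r omega * lyapV r omega) = \sum_l \int[P]_omega ((B r omega * zeta l r omega) ^+ 2).
Proof.
move=> r0; have [Kb h] := stopped_bound r0.
have e : (fun omega => B r omega * lyapV r omega) = fun omega => \sum_l (B r omega * zeta l r omega) ^+ 2.
  by apply/funext => omega; rewrite /lyapV mulr_sumr; apply: eq_bigr => l _; rewrite exprMn B_sqr.
have i l : int1 P (fun omega => (B r omega * zeta l r omega) ^+ 2).
  exact: (h l r r0 (lexx r)).1.2.
by rewrite e; split; [exact: int1_sum|rewrite E_sum].
Qed.

Lemma BV_integrable r : 0 <= r -> int1 P (fun omega => B r omega * lyapV r omega).
Proof. by move=> r0; have [] := BV_int1 r0. Qed.

Definition mean_V r := \int[P]_omega (B r omega * lyapV r omega).

Let lyapV_ge0 r omega : 0 <= lyapV r omega.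
Proof. by apply: sumr_ge0 => l _; exact: sqr_ge0. Qed.

Let mean_V_bound T : 0 <= T -> exists Kb, forall r, 0 <= r -> r <= T -> mean_V r <= Kb.
Proof.
move=> T0; have [Kb h] := stopped_bound T0; exists (\sum_(l < n) Kb) => r r0 rT.
by rewrite /mean_V (BV_int1 r0).2; apply: ler_sum => l _; exact: (h l r r0 rT).2.
Qed.

Section one_step.
Variables s t : R.
Hypotheses (s0 : 0 <= s) (st : s <= t).
Let t0 := le_trans s0 st.

Let vd r omega := \sum_l `|Dl l r omega|.
(** Cutting off the drift where it exceeds p makes it bounded; p then tends to
    infinity. *)
Let kap (p : nat) r omega : R := (vd r omega <= p%:R)%R%:R.

Let mvd : measurable_fun setT (fun z : R * Omega => vd z.1 z.2).
Proof. by apply: measurable_sum => l; apply: measurableT_comp => //; exact: mDl. Qed.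

Let mkap p : measurable_fun setT (fun z : R * Omega => kap p z.1 z.2).
Proof. exact: measurable_le_indic. Qed.

Let kapad p r : 0 <= r -> measG (F r) (kap p r).
Proof.
move=> r0; have sF := F_sigma HF r0; apply: (measG_le_indic sF).
apply: (measG_sum sF) => l B' mB'.
have mn : measurable_fun setT (fun y : R => `|y|) by exact: measurableT_comp.
have := Dlad l r0 (mn measurableT B' mB').
by rewrite setTI.
Qed.

Let kap0 p r omega : 0 <= kap p r omega. Proof. by []. Qed.

Let kap1 p r omega : kap p r omega <= 1.
Proof. by rewrite /kap; case: (vd _ _ <= _)%R. Qed.

Let kapD p l r omega : `|kap p r omega * Dl l r omega| <= p%:R.
Proof.
rewrite /kap; case: (boolP (vd r omega <= p%:R)) => h; last by rewrite mul0r normr0.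
rewrite mul1r; apply: le_trans h; rewrite /vd (bigD1 l)//= lerDl sumr_ge0//.
Qed.

Let kap_lim r omega : \forall p \near \oo, kap p r omega = 1.
Proof.
near=> p; rewrite /kap (_ : (vd r omega <= p%:R)%R = true)//.
by near: p; exact: nbhs_infty_ger.
Unshelve. all: by end_near. Qed.

Let lostl p l := lost C N (Dl l) t (kap p) s.

Let lost_int_meas p l : measurable_fun setT (fun z : R * Omega =>
  tind s t z.1 * (B z.1 z.2 * ((1 - kap p z.1 z.2) * `|Dl l z.1 z.2|))).
Proof.
apply: measurable_funM; first exact: tind_fst_meas.
apply: measurable_funM; first exact: B_meas.
apply: measurable_funM; first exact: measurable_funB.
by apply: measurableT_comp => //; exact: mDl.
Qed.

Let lost_cvg l : (fun p => \int[P]_omega lostl p l omega) @ \oo --> (0 : R).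
Proof.
apply: (@E_dct0 _ _ _ P (fun p => lostl p l) (fun=> N)).
- move=> p; exact: (lost_meas C0 Cnd Cc Cm N0 (mDl l) (SDC l) t0 (mkap p) (kap0 p) (kap1 p) s0 st).
- move=> omega.
  have [i _] := drift_clock C0 Cnd Cc Cm N0 (mDl l) (SDC l) t0 omega s0 st (lexx t).
  apply: (@E_dct0 _ _ _ leb (fun p r => tind s t r * (B r omega * ((1 - kap p r omega) * `|Dl l r omega|)))
    (fun r => tind s t r * (B r omega * `|Dl l r omega|))) => //.
  + move=> p; exact: (measurableT_comp (lost_int_meas p l) (measurable_pair2 omega)).
  + move=> r; apply: cvg_near_cst; apply: filterS (kap_lim r omega) => p ->.
    by rewrite subrr mul0r !mulr0.
  + move=> p r; rewrite !normrM normr_id (ger0_norm (tind_ge0 _ _ _)) (ger0_norm (B_ge0 _ _ _ _)).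
    rewrite ler_wpM2l ?tind_ge0// ler_wpM2l ?B_ge0// ler_piMl//.
    by rewrite ger0_norm ?subr_ge0// gerBl.
- exact: int1_cst.
- move=> p omega.
  have l0 := lost_ge0 C N (Dl l) t s (kap1 p) omega.
  rewrite ger0_norm//.
  exact: (lost_N C0 Cnd Cc Cm N0 (mDl l) (SDC l) t0 (mkap p) (kap0 p) (kap1 p) s0 st omega).
Qed.

Let g (z : R * Omega) := tind s t z.1 * ((- lam + a z.1) * (B z.1 z.2 * lyapV z.1 z.2)).
Let gabs (z : R * Omega) := tind s t z.1 * ((lam + a z.1) * (B z.1 z.2 * lyapV z.1 z.2)).

Let mBV : measurable_fun setT (fun z : R * Omega => B z.1 z.2 * lyapV z.1 z.2).
Proof.
apply: measurable_funM; first exact: B_meas.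
by apply: measurable_sum => l; apply: measurable_funX; exact: mzeta.
Qed.

Let mafst : measurable_fun setT (fun z : R * Omega => a z.1).
Proof. exact: (measurableT_comp ma measurable_fst). Qed.

Let mgabs : measurable_fun setT gabs.
Proof.
apply: measurable_funM; first exact: tind_fst_meas.
by apply: measurable_funM => //; exact: measurable_funD.
Qed.

Let mg : measurable_fun setT g.
Proof.
apply: measurable_funM; first exact: tind_fst_meas.
by apply: measurable_funM => //; exact: measurable_funD.
Qed.

Let BV0 r omega : 0 <= B r omega * lyapV r omega.
Proof. by rewrite mulr_ge0 ?B_ge0. Qed.

Let gabs_ge0 z : 0 <= gabs z.
Proof. by rewrite /gabs mulr_ge0 ?tind_ge0// mulr_ge0// addr_ge0. Qed.

Let gabs_int1 : int1 M gabs.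
Proof.
have i2 r : int1 P (fun omega => gabs (r, omega)) /\
    \int[P]_omega gabs (r, omega) = tind s t r * ((lam + a r) * mean_V r).
  rewrite /gabs/=; case: (boolP ((s < r) && (r <= t))) => [/andP[sr rt]|h].
    have [i _] := BV_int1 (le_trans s0 (ltW sr)).
    by split; [apply: int1Z; exact: int1Z|rewrite (EZ _ (int1Z _ i)) (EZ _ i)].
  have e : (fun omega => tind s t r * ((lam + a r) * (B r omega * lyapV r omega))) = fun=> 0.
    by apply/funext => omega; rewrite tindE (negbTE h) mul0r.
  rewrite e; split; first exact: int10.
  by rewrite E0 tindE (negbTE h) mul0r.
apply: tonelli_fst => //; first by move=> r; exact: (i2 r).1.
have [Kb hKb] := mean_V_bound t0.
apply: (int1_le _ (int1Z Kb (int1D (int1Z lam (tind_int1 s t)) (tind_sub_int1 ma a0 (ia t) s0 (lexx t))))).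
  have mg' : measurable_fun setT (fun z : Omega * R => gabs (z.2, z.1)).
    by apply: (measurableT_comp mgabs); exact: measurable_swap.
  exact: (@param_int_meas _ _ _ _ _ P (fun z => gabs (z.2, z.1)) mg' (fun r => (i2 r).1)).
move=> r; rewrite ger0_norm; last exact: E_ge0.
rewrite (i2 r).2 tindE; case: (boolP ((s < r) && (r <= t))) => [/andP[sr rt]|h]; last first.
  by rewrite !mul0r mulr0 addr0 mulr0.
rewrite !mul1r mulr1 mulrC ler_wpM2r ?addr_ge0// hKb//; exact: le_trans (ltW sr).
Qed.

Let g_le_gabs z : `|g z| <= gabs z.
Proof.
rewrite /g normrM (ger0_norm (tind_ge0 _ _ _)) ler_wpM2l ?tind_ge0// normrM.
rewrite (ger0_norm (BV0 _ _)) ler_wpM2r// (le_trans (ler_normD _ _))// normrN.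
by rewrite !ger0_norm.
Qed.

Let g_int1 : int1 M g.
Proof. by apply: (int1_le _ gabs_int1); [exact: mg|exact: g_le_gabs]. Qed.

Let Q z := noise_rate z.1 z.2.
Let tBQ z := tind s t z.1 * (B z.1 z.2 * Q z).

Let terms p l : int1 M (fun z => tind s t z.1 * (B z.1 z.2 * qvar K snd (cl l) Hk z)) /\
  int1 M (fun z => tind s t z.1 * (B z.1 z.2 * (kap p z.1 z.2 * Dl l z.1 z.2)) * zeta l z.1 z.2).
Proof.
have /choice[Z hZ] k := approx_all HF Hw C0 Cnd Cc Cad Cm N0 (mGam k.1 k.2) (GC k.1 k.2) t0
  (fun r r0 rt => HJk k r0 rt).
exact: (energy_terms_int1 HF Hw C0 Cnd Cc Cad Cm N0 (fun k => mGam k.1 k.2) (fun k => GC k.1 k.2)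
  (mDl l) (SDC l) (mzeta l) t0 (fun k r r0 rT => HJk k r0 rT) (fun r r0 _ => sde_l l r0)
  (mkap p) (kapD p l) s0 st Z).
Qed.

Let tBQ_int1 : int1 M tBQ.
Proof.
rewrite (_ : tBQ = fun z => \sum_l tind s t z.1 * (B z.1 z.2 * qvar K snd (cl l) Hk z)).
  by apply: int1_sum => l; exact: (terms 0 l).1.
by apply/funext => z; rewrite /tBQ /Q noise_rateE !mulr_sumr.
Qed.

Let G (p : nat) z := \sum_l (tind s t z.1 * (B z.1 z.2 * qvar K snd (cl l) Hk z) +
  2 * (tind s t z.1 * (B z.1 z.2 * (kap p z.1 z.2 * Dl l z.1 z.2)) * zeta l z.1 z.2)).

(** The integrand g of the Lyapunov inequality, corrected where the cut-off has
    removed the drift, so that the inequality could not be applied. *)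
Let U (p : nat) z := g z + (1 - kap p z.1 z.2) * (tBQ z - g z).

Let G_int1 p : int1 M (G p).
Proof.
apply: int1_sum => l; have [h1 h2] := terms p l.
by apply: int1D => //; exact: int1Z.
Qed.

Let G_le_U p z : G p z <= U p z.
Proof.
have -> : G p z = tind s t z.1 * (B z.1 z.2 * (Q z + kap p z.1 z.2 *
    (2 * \sum_l zeta l z.1 z.2 * Dl l z.1 z.2))).
  rewrite /G /Q noise_rateE mulr_sumr mulr_sumr -big_split/= mulr_sumr mulr_sumr.
  by apply: eq_bigr => l _; ring.
have -> : U p z = tind s t z.1 * (B z.1 z.2 * (kap p z.1 z.2 * ((- lam + a z.1) * lyapV z.1 z.2) +
   (1 - kap p z.1 z.2) * Q z)).
  by rewrite /U /g /tBQ; ring.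
rewrite tindE; case: (boolP ((s < z.1) && (z.1 <= t))) => [/andP[sr _]|_]; last by rewrite !mul0r.
rewrite !mul1r ler_wpM2l ?B_ge0//.
have := lyap z.2 (le_lt_trans s0 sr).
rewrite -/(Q z) => h.
have := ler_wpM2l (kap0 p z.1 z.2) h; rewrite mulrDr.
set A := \sum_l _; move=> h'.
lra.
Qed.

Let mU p : measurable_fun setT (U p).
Proof.
apply: measurable_funD => //; apply: measurable_funM; first exact: measurable_funB.
by apply: measurable_funB => //; exact: (int1_measurable tBQ_int1).
Qed.

Let U_cvg : (fun p => \int[M]_z U p z) @ \oo --> \int[M]_z g z.
Proof.
apply: (@E_dct _ _ _ M U g (fun z => gabs z + (`|tBQ z| + gabs z)) _ _ _ _ _).2 => //.
- move=> z; apply: cvg_near_cst; apply: filterS (kap_lim z.1 z.2) => p e.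
  by rewrite /U e subrr mul0r addr0.
- by apply: int1D => //; apply: int1D => //; exact: int1_norm.
- move=> p z; rewrite /U (le_trans (ler_normD _ _))// lerD//.
  rewrite normrM (le_trans (ler_piMl _ _))//; first by rewrite ger0_norm ?subr_ge0// gerBl.
  by rewrite (le_trans (ler_normB _ _))// lerD.
Qed.

Let U_int1 p : int1 M (U p).
Proof.
apply: (@int1_le _ _ _ M _ (fun z => gabs z + (`|tBQ z| + gabs z))); first exact: mU.
  by apply: int1D => //; apply: int1D => //; exact: int1_norm.
move=> z; rewrite /U (le_trans (ler_normD _ _))// lerD//.
rewrite normrM (le_trans (ler_piMl _ _))//; first by rewrite ger0_norm ?subr_ge0// gerBl.
by rewrite (le_trans (ler_normB _ _))// lerD.
Qed.

Let err Kb p := \sum_(l < n) (2 * (Num.sqrt Kb * Num.sqrt (N * \int[P]_omega lostl p l omega)) +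
  2 * (N * \int[P]_omega lostl p l omega)).

Let err_cvg Kb : err Kb @ \oo --> (0 : R).
Proof.
have -> : (0 : R) = \sum_(l < n) (2 * (Num.sqrt Kb * Num.sqrt (N * 0)) + 2 * (N * 0)).
  by rewrite big1// => l _; rewrite mulr0 sqrtr0 !mulr0 addr0.
apply: cvgn_sum => l.
have h : (fun p => N * \int[P]_omega lostl p l omega) @ \oo --> N * 0.
  by apply: cvgMr; exact: lost_cvg.
apply: cvgD; last exact: cvgMr.
apply: cvgMr; apply: cvgMr.
by apply: continuous_cvg => //; exact: sqrt_continuous.
Qed.

Let step_p : exists Kb, forall p, mean_V t <= mean_V s + \int[M]_z U p z + err Kb p.
Proof.
have [Kb hKb] := stopped_bound t0; exists Kb => p.
have /choice[Z hZ] k := approx_all HF Hw C0 Cnd Cc Cad Cm N0 (mGam k.1 k.2) (GC k.1 k.2) t0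
  (fun r r0 rt => HJk k r0 rt).
rewrite /mean_V (BV_int1 t0).2 (BV_int1 s0).2.
apply: (@le_trans _ _ (\sum_l \int[P]_omega ((B s omega * zeta l s omega) ^+ 2) + \int[M]_z G p z + err Kb p)).
  rewrite E_sum; last first.
    by move=> l; have [h1 h2] := terms p l; apply: int1D => //; exact: int1Z.
  rewrite -!big_split/=; apply: ler_sum => l _.
  have [h1 h2] := terms p l.
  rewrite ED//; last exact: int1Z.
  rewrite EZ//.
  apply: (le_trans (energy_cut HF Hw C0 Cnd Cc Cad Cm N0 (fun k => mGam k.1 k.2) (fun k => GC k.1 k.2)
    (mDl l) (Dlad l) (SDC l) (mzeta l) (zetaad l) t0 (fun k r r0 rT => HJk k r0 rT)
    (fun r r0 _ => sde_l l r0) (mkap p) (kapad p) (kap0 p) (kap1 p) (kapD p l) s0 st hZ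
    (fun r r0 rt => (hKb l r r0 rt).2))).
  by rewrite -!addrA.
by rewrite lerD2r lerD2l; apply: E_le; [exact: G_int1|exact: U_int1|exact: G_le_U].
Qed.

(** The energy inequality is summed over the coordinates of S x, the Lyapunov
    inequality is applied under the integral, and the cut-off is removed by
    dominated convergence. *)
Lemma mean_V_step : mean_V t <= mean_V s + \int[leb]_r (tind s t r * ((- lam + a r) * mean_V r)).
Proof.
have [Kb h] := step_p.
have -> : \int[leb]_r (tind s t r * ((- lam + a r) * mean_V r)) = \int[M]_z g z.
  have ig r : int1 P (fun omega => g (r, omega)) /\
      \int[P]_omega g (r, omega) = tind s t r * ((- lam + a r) * mean_V r).
    rewrite /g/=; case: (boolP ((s < r) && (r <= t))) => [/andP[sr rt]|h'].
      have [i _] := BV_int1 (le_trans s0 (ltW sr)).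
      by split; [apply: int1Z; exact: int1Z|rewrite (EZ _ (int1Z _ i)) (EZ _ i)].
    have e : (fun omega => tind s t r * ((- lam + a r) * (B r omega * lyapV r omega))) = fun=> 0.
      by apply/funext => omega; rewrite tindE (negbTE h') mul0r.
    rewrite e; split; first exact: int10.
    by rewrite E0 tindE (negbTE h') mul0r.
  rewrite (fubini_fst g_int1 (fun r => (ig r).1)).2.
  by apply: eqE => r; rewrite (ig r).2.
have c : (fun p => mean_V s + \int[M]_z U p z + err Kb p) @ \oo --> mean_V s + \int[M]_z g z + 0.
  by apply: cvgD; [apply: cvgD; [exact: cvg_cst|exact: U_cvg]|exact: err_cvg].
rewrite addr0 in c; rewrite -(cvg_lim _ c)//; apply: limr_ge; first by apply/cvg_ex; eexists; exact: c.
exact: nearW.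
Qed.

End one_step.

Let V0 := \sum_l (S *m z0) l 0 ^+ 2.

(** The integral of a simple process up to time 0 is 0. *)
Let J0_ae i j : {ae P, forall omega, J 0 i j omega = 0}.
Proof.
have [mJ [S' [_ cS]]] := HJ (lexx 0) i j.
have h (k : nat) : {ae P, forall omega, `|J 0 i j omega| < k.+1%:R^-1}.
  have k0 : 0 < k.+1%:R^-1 :> R by rewrite invr_gt0.
  have mk := measurable_ge_norm k.+1%:R^-1 mJ.
  have e : P [set omega | k.+1%:R^-1 <= `|J 0 i j omega|] = 0%E.
    have c := cS _ k0.
    have e' : (fun k' => fine (P [set x | k.+1%:R^-1 <=
        `|sp_integral (S' k') (fun s omega => w s omega j 0) 0 x - J 0 i j x|])) =
        fun=> fine (P [set omega | k.+1%:R^-1 <= `|J 0 i j omega|]).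
      apply/funext => k'; congr (fine (P _)).
      by apply/seteqP; split=> omega /=; rewrite SI0 sub0r normrN.
    rewrite e' in c.
    have := cvg_unique _ c (cvg_cst _) => h.
    rewrite -[LHS]fineK; last exact: fin_num_measure.
    by rewrite -h.
  exists [set omega | k.+1%:R^-1 <= `|J 0 i j omega|]; split=> //.
  by move=> omega /= /negP; rewrite -leNgt.
apply: filterS (ae_foralln h) => omega hk; apply/eqP; rewrite -normr_eq0 eq_le normr_ge0 andbT.
apply/ler_addgt0Pl => e e0; rewrite addr0.
have [k _ hk'] := near_infty_natSinv_lt (PosNum e0).
exact: (le_trans (ltW (hk k)) (ltW (hk' k (leqnn k)))).
Qed.

Let mean_V_init : mean_V 0 <= V0.
Proof.
rewrite -(@E_cst _ _ _ P V0); apply: (@le_trans _ _ (\int[P]_omega (B 0 omega * V0))).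
  have mB : measurable_fun setT (B 0) := measG_measurable HF (lexx 0) (B_F HF Cad N (lexx 0)).1.
  rewrite le_eqVlt; apply/orP; left; apply/eqP; apply: E_ae_eq.
  - exact: (int1_measurable (BV_int1 (lexx 0)).1).
  - exact: measurable_funM.
  - have hJ : {ae P, forall omega, forall i j, J 0 i j omega = 0}.
      apply: filter_forall => i; apply: filter_forall => j; exact: J0_ae.
    apply: filterS2 (sde (lexx 0)) hJ => omega hx hJ; congr (_ * _).
    apply: eq_bigr => l _; congr (_ ^+ 2); congr (_ _ l 0); congr (_ *m _).
    apply/matrixP => i j; rewrite (ord1 j) hx big1 ?addr0; last by move=> k _; exact: hJ.
    rewrite (_ : (fun _ => _) = fun=> 0) ?E0 ?addr0//.
    by apply/funext => u; rewrite tindE ltNge andNb mul0r.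
have mB : measurable_fun setT (B 0) := measG_measurable HF (lexx 0) (B_F HF Cad N (lexx 0)).1.
have V00 : 0 <= V0 by apply: sumr_ge0 => l _; exact: sqr_ge0.
apply: E_le; last 1 first.
- by move=> omega; rewrite ler_piMl// B_le1.
- apply: (@int1_bounded _ _ _ P _ V0); first exact: measurable_funM.
  by move=> omega; rewrite ger0_norm ?ler_piMl ?B_le1// mulr_ge0// B_ge0.
- exact: int1_cst.
Qed.

(** Gronwall's inequality for the time-clamped mean, since measurability is
    required on the whole line. *)
Lemma stopped_decay T : 0 <= T ->
  \int[P]_omega (B T omega * lyapV T omega) <= V0 * expR (\int[leb]_r (tind 0 T r * a r) - lam * T).
Proof.
move=> T0; have [Kb hKb] := mean_V_bound T0.
pose clamp r := Num.min (Num.max 0 r) T.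
have clamp0 r : 0 <= clamp r by rewrite le_min T0 andbT le_max lexx.
have clampT r : clamp r <= T by rewrite ge_min lexx orbT.
have clampE r : 0 <= r -> r <= T -> clamp r = r.
  by move=> r0 rT; rewrite /clamp (max_idPr r0) (min_idPl rT).
have mmean : measurable_fun setT (fun r => mean_V (clamp r)).
  have mclamp : measurable_fun setT clamp.
    by apply: measurable_minr => //; exact: measurable_maxr.
  have mBV : measurable_fun setT (fun z : R * Omega => B z.1 z.2 * lyapV z.1 z.2).
    apply: measurable_funM; first exact: B_meas.
    by apply: measurable_sum => l; apply: measurable_funX; exact: mzeta.
  have mg : measurable_fun setT (fun z : Omega * R => B (clamp z.2) z.1 * lyapV (clamp z.2) z.1).
    apply: (measurableT_comp mBV (f := fun z : R * Omega => B z.1 z.2 * lyapV z.1 z.2)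
      (g := fun z : Omega * R => (clamp z.2, z.1))).
    by apply: measurable_fun_pair => //; exact: measurableT_comp.
  exact: (@param_int_meas _ _ _ _ _ P _ mg (fun r => (BV_int1 (clamp0 r)).1)).
have p0 r : 0 <= mean_V (clamp r).
  by apply: E_ge0 => omega; rewrite mulr_ge0// B_ge0.
have pK r : 0 <= r -> r <= T -> mean_V (clamp r) <= Kb by move=> _ _; exact: hKb.
have step s t : 0 <= s -> s <= t -> t <= T ->
    mean_V (clamp t) <= mean_V (clamp s) + \int[leb]_r (tind s t r * ((- lam + a r) * mean_V (clamp r))).
  move=> s0 st tT; rewrite !clampE//; [|exact: le_trans st _|exact: le_trans s0 _].
  apply: (le_trans (mean_V_step s0 st)); rewrite lerD2l le_eqVlt; apply/orP; left; apply/eqP.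
  apply: eqE => r; rewrite tindE; case: (boolP ((s < r) && (r <= t))) => [/andP[sr rt]|_]; last by rewrite !mul0r.
  by rewrite clampE//; [exact: le_trans s0 (ltW sr)|exact: le_trans rt tT].
have := gronwall T0 lam0 mmean p0 pK ma a0 (ia T) step.
rewrite !clampE// => h; apply: (le_trans h).
exact: (ler_wpM2r (expR_ge0 _) mean_V_init).
Qed.

End stopped.

Let lyapV_ge0' r omega : 0 <= lyapV r omega.
Proof. by apply: sumr_ge0 => l _; exact: sqr_ge0. Qed.

(** As N tends to infinity the events C T <= N increase to the whole space. *)
Theorem lyapunov_decay T : 0 <= T ->
  (\int[P]_omega (lyapV T omega)%:E <=
   ((\sum_l (S *m z0) l 0 ^+ 2) * expR (\int[leb]_r (tind 0 T r * a r) - lam * T))%:E)%E.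
Proof.
move=> T0.
have mV : measurable_fun setT (lyapV T).
  apply: measurable_sum => l; apply: measurable_funX.
  rewrite (_ : (fun _ => _) = fun omega => \sum_i S l i * x T omega i 0).
    apply: measurable_sum => i; apply: measurable_funM => //.
    exact: (measG_measurable HF T0 (xad i T0)).
  by apply/funext => omega; rewrite mxE.
pose gN (k : nat) omega := (Bind C k%:R T omega * lyapV T omega)%:E : \bar R.
have mg k : measurable_fun setT (gN k).
  apply/measurable_EFinP; apply: measurable_funM => //.
  exact: (measG_measurable HF T0 (B_F HF Cad k%:R T0).1).
have g0 k omega : (setT omega -> 0 <= gN k omega)%E.
  by rewrite lee_fin mulr_ge0// B_ge0.
have gmono omega : setT omega -> {homo gN ^~ omega : i k / (i <= k)%N >-> (i <= k)%E}.
  move=> _ i k ik; rewrite lee_fin ler_wpM2r// /Bind ler_nat.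
  case: (boolP (C T omega <= i%:R)) => h; last by case: (C T omega <= k%:R)%R.
  by rewrite (le_trans h)// ler_nat.
have glim omega : limn (gN ^~ omega) = (lyapV T omega)%:E.
  apply/cvg_lim => //; apply: cvg_near_cst; near=> k.
  rewrite /gN /Bind (_ : (C T omega <= k%:R)%R = true) ?mul1r//.
  by near: k; exact: nbhs_infty_ger.
have c := @cvg_monotone_convergence _ _ _ P _ measurableT _ mg g0 gmono.
under [X in (X <= _)%E]eq_integral do rewrite -glim.
rewrite -(cvg_lim _ c)//; apply: lime_le; first by apply/cvg_ex; eexists; exact: c.
apply: nearW => k; have k0 : 0 <= k%:R :> R by [].
have i : int1 P (fun omega => Bind C k%:R T omega * lyapV T omega) by exact: BV_integrable.
by rewrite (E_fin i) lee_fin; exact: stopped_decay.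
Unshelve. all: by end_near. Qed.

End lyapunov_decay.

(** * Joint measurability and clamped paths *)

Section caratheodory.
Context {R : realType} {d : measure_display} {T : measurableType d}.

(** A process that is measurable at each time and has continuous paths is the
    pointwise limit of its discretizations in time. *)
Lemma caratheodory (y : R -> T -> R) : (forall r, 0 <= r -> measurable_fun setT (y r)) ->
  (forall omega, continuous (fun r : R => y (Num.max 0 r) omega)) ->
  measurable_fun setT (fun z : R * T => y (Num.max 0 z.1) z.2).
Proof.
move=> my cy.
pose h (k : nat) (z : R * T) := Num.max 0 z.1 * k.+1%:R.
pose p k z := (Num.trunc (h k z))%:R / k.+1%:R : R.
have k0 k : (0 : R) < k.+1%:R by rewrite ltr0n.
have h0 k z : 0 <= h k z by rewrite mulr_ge0// ?ler0n// le_max lexx.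
have mmax : measurable_fun setT (fun z : R * T => Num.max 0 z.1 : R).
  by apply: measurable_maxr => //; exact: measurable_fst.
have mh k : measurable_fun setT (h k) by exact: measurable_funM.
apply: (@measurable_fun_cvg _ _ _ _ (fun k z => y (p k z) z.2)) => [k|z _].
  pose E (i : nat) := [set z | (i%:R <= h k z < i.+1%:R)%R].
  have EU : \bigcup_i E i = setT.
    apply/seteqP; split=> // z _; exists (Num.trunc (h k z)) => //.
    by apply: trunc_itv.
  rewrite -EU; apply/measurable_fun_bigcup => i.
    have := mh k measurableT _ (measurable_itv `[i%:R, i.+1%:R[); rewrite setTI.
    by congr (measurable _); apply/seteqP; split=> z /=; rewrite in_itv.
  apply: (eq_measurable_fun (fun z : R * T => y (i%:R / k.+1%:R) z.2)).
    move=> z /set_mem /= hz; rewrite /p.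
    suff -> : Num.trunc (h k z) = i by [].
    exact: trunc_def.
  apply: (measurable_funS measurableT) => //.
  apply: (measurableT_comp (my _ _) measurable_snd).
  by rewrite divr_ge0.
have cp : (p ^~ z) @ \oo --> Num.max 0 z.1.
  apply/cvgrPdist_le => e e0; near=> k.
  have /andP[l u] := trunc_itv (h0 k z).
  have k1 := k0 k.
  have ke : k.+1%:R^-1 <= e by near: k; apply: filterS (near_infty_natSinv_lt (PosNum e0)) => k; exact: ltW.
  have -> : Num.max 0 z.1 - p k z = (h k z - (Num.trunc (h k z))%:R) / k.+1%:R.
    by rewrite /p mulrBl /h mulfK// gt_eqF.
  rewrite ger0_norm ?divr_ge0 ?subr_ge0//; apply: le_trans ke.
  rewrite ler_pdivrMr// mulVf ?gt_eqF//.
  by move: u; rewrite -natr1 => /ltW; rewrite lerBlDl addrC.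
have pE k : p k z = Num.max 0 (p k z) by rewrite max_r// divr_ge0.
have : (fun k => y (Num.max 0 (p k z)) z.2) @ \oo --> y (Num.max 0 (Num.max 0 z.1)) z.2.
  exact: (continuous_cvg _ (cy z.2 _) cp).
rewrite (max_r (x := 0) (y := Num.max 0 z.1)) ?le_max ?lexx//.
by under eq_fun do rewrite -pE.
Unshelve. all: by end_near. Qed.

End caratheodory.

Section borel_maps.
Context {R : realType}.

(** The sets whose preimage under Y is measurable form a sigma-algebra that
    contains the generators of the Borel sigma-algebra. *)
Lemma borel_fun_coord (d : measure_display) (T : measurableType d) n p
  (f : 'cV[R]_n -> 'cV[R]_p) (Y : T -> 'cV[R]_n) : borel_fun f ->
  (forall i, measurable_fun setT (fun z => Y z i 0)) ->
  forall i, measurable_fun setT (fun z => f (Y z) i 0).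
Proof.
move=> bf mY i _ B mB; rewrite setTI.
have pre : @borel_cV R n `<=` [set A | measurable (Y @^-1` A)].
  apply: smallest_sub; last first.
    move=> A' /=; rewrite -bigcup_seq => -[j _ [B' mB' <-]].
    rewrite setTI; have := mY j measurableT B' mB'; by rewrite setTI.
  split; first by rewrite /= preimage_set0.
    move=> A' /= mA'; rewrite (_ : _ @^-1` _ = setT `\` Y @^-1` A'); first exact: measurableD.
    by apply/seteqP; split=> z.
  by move=> A' /= mA'; rewrite preimage_bigcup; exact: bigcup_measurable.
suff /bf /pre h : @borel_cV R p [set y : 'cV[R]_p | B (y i 0)] by exact: h.
apply: sub_sigma_algebra; rewrite -bigcup_seq; exists i => /=; first by rewrite mem_index_enum.
by exists B => //; rewrite setTI.
Qed.

Lemma continuous_clamped n (h : R -> 'cV[R]_n) : {within `[0, +oo[, continuous h} ->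
  forall i, continuous (fun r : R => h (Num.max 0 r) i 0).
Proof.
move=> /subspace_continuousP ch i r.
apply: (continuous_comp (f := fun u : R => h (Num.max 0 u)) (g := fun M : 'cV[R]_n => M i 0));
  last exact: coord_continuous.
have m0 (u : R) : `[0, +oo[%classic (Num.max 0 u) by rewrite /= in_itv/= andbT le_max lexx.
move=> A /(ch _ (m0 r)) hA.
have cm : continuous (fun u : R => Num.max 0 u).
  by move=> u; apply: (continuous_max (f := fun=> 0) (g := id)); [exact: cst_continuous|].
by apply: (@filterS _ (nbhs r) _ _ _ _ (cm r _ hA)) => u /= hu; exact: hu (m0 u).
Qed.

End borel_maps.

(** * The regularized solution and its clock *)

Section reduction.
Context {R : realType} {d : measure_display} {Omega : measurableType d}.
Variables (P : probability Omega R) (F : R -> set (set Omega)).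
Variables (n m q : nat) (K : 'M[R]_q) (w : R -> Omega -> 'cV[R]_q).
Hypotheses (HF : usual_filtration P F) (Hw : wiener_process P F K w).
Local Notation leb := (@lebesgue_measure R).
Local Notation M := (leb \x P)%E.
Variables (f : 'cV[R]_n -> 'cV[R]_n) (g : 'I_m -> 'cV[R]_n -> 'cV[R]_n).
Variable gamma : 'I_q -> 'cV[R]_n -> 'cV[R]_n.
Hypotheses (Hf : borel_fun f) (Hg : forall i, borel_fun (g i)).
Hypothesis Hgamma : forall j, borel_fun (gamma j).
Hypotheses (f0 : f 0 = 0) (g0 : forall i, g i 0 = 0).
Hypothesis gamma0 : forall j, gamma j 0 = 0.
Variables (u : R -> Omega -> 'cV[R]_m) (v : R -> 'cV[R]_m).
Hypothesis Hu : admissible_control P F u.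
Hypothesis Huv : forall t omega, 0 <= t -> mult_control g u t omega = v t.
Hypothesis Hv : (L2normsq v < +oo)%E.
Variable S : 'M[R]_n.

(** Clamped at time 0 so as to be measurable on the whole line. *)
Definition ctrl (r : R) := v (Num.max 0 r).
Definition drift_at (y : 'cV[R]_n) (r : R) := f y + cols g y *m ctrl r.
Definition clock_rate (y : 'cV[R]_n) (r : R) := \sum_i `|drift_at y r i 0| +
  \sum_l `|(S *m drift_at y r) l 0| + \sum_i \sum_j cols gamma y i j ^+ 2.

(** v is a section of the jointly measurable u. *)
Lemma ctrl_meas i : measurable_fun setT (fun r => ctrl r i 0).
Proof.
have [_ /(_ i) mu _] := Hu.
have e : (fun r => ctrl r i 0) = fun r =>
    if `[< forall x, g i x = 0 >] then 0 else u (Num.max 0 r) (sample_point P) i 0.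
  apply/funext => r; rewrite /ctrl -(Huv (sample_point P)); last by rewrite le_max lexx.
  by rewrite mxE.
rewrite e; case: asboolP => _; first exact: measurable_cst.
have mz : measurable [set z : R * Omega | 0 <= z.1].
  rewrite (_ : [set z | _] = (fst : R * Omega -> R) @^-1` `[0, +oo[); last first.
    by apply/seteqP; split=> z /=; rewrite in_itv/= andbT.
  by rewrite -[X in measurable X]setTI; exact: measurable_fst.
apply: (@measurable_comp _ _ _ _ _ _ [set z : R * Omega | 0 <= z.1] _ _
  (fun r : R => (Num.max 0 r, (sample_point P))) mz _ mu).
  by move=> _ [r _ <-] /=; rewrite le_max lexx.
by apply: measurable_fun_pair => //; exact: measurable_maxr.
Qed.

(** u and v differ only in components that multiply a zero column. *)
Lemma cols_control t omega y : 0 <= t -> cols g y *m u t omega = cols g y *m v t.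
Proof.
move=> t0; apply/matrixP => i k; rewrite !mxE; apply: eq_bigr => j _.
rewrite (ord1 k) -(Huv omega t0) !mxE; case: asboolP => // h.
by rewrite h mxE !mul0r.
Qed.

Section composition.
Context {d' : measure_display} {T' : measurableType d'}.
Variable Y : R -> T' -> 'cV[R]_n.
Hypothesis mY : forall i, measurable_fun setT (fun z : R * T' => Y z.1 z.2 i 0).

Lemma drift_at_meas i : measurable_fun setT (fun z : R * T' => drift_at (Y z.1 z.2) z.1 i 0).
Proof.
rewrite (_ : (fun _ => _) = fun z : R * T' =>
  f (Y z.1 z.2) i 0 + \sum_j g j (Y z.1 z.2) i 0 * ctrl z.1 j 0); last first.
  by apply/funext => z; rewrite !mxE; congr (_ + _); apply: eq_bigr => j _; rewrite mxE.
apply: measurable_funD; first exact: (borel_fun_coord (Y := fun z : R * T' => Y z.1 z.2) Hf mY).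
apply: measurable_sum => j; apply: measurable_funM.
  exact: (borel_fun_coord (Y := fun z : R * T' => Y z.1 z.2) (Hg j) mY).
exact: (measurableT_comp (ctrl_meas j) measurable_fst).
Qed.

Lemma cols_gamma_meas i j : measurable_fun setT (fun z : R * T' => cols gamma (Y z.1 z.2) i j).
Proof.
rewrite (_ : (fun _ => _) = fun z : R * T' => gamma j (Y z.1 z.2) i 0).
  exact: (borel_fun_coord (Y := fun z : R * T' => Y z.1 z.2) (Hgamma j) mY).
by apply/funext => z; rewrite mxE.
Qed.

Lemma clock_rate_meas : measurable_fun setT (fun z : R * T' => clock_rate (Y z.1 z.2) z.1).
Proof.
apply: measurable_funD; first apply: measurable_funD.
- by apply: measurable_sum => i; apply: measurableT_comp => //; exact: drift_at_meas.
- apply: measurable_sum => l; apply: measurableT_comp => //.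
  rewrite (_ : (fun _ => _) = fun z : R * T' => \sum_i S l i * drift_at (Y z.1 z.2) z.1 i 0).
    by apply: measurable_sum => i; apply: measurable_funM => //; exact: drift_at_meas.
  by apply/funext => z; rewrite mxE.
- apply: measurable_sum => i; apply: measurable_sum => j; apply: measurable_funX.
  exact: cols_gamma_meas.
Qed.

End composition.

Lemma drift_at0 r : drift_at 0 r = 0.
Proof.
rewrite /drift_at f0 add0r; apply/matrixP => i k; rewrite !mxE big1// => j _.
by rewrite mxE g0 mxE mul0r.
Qed.

Lemma cols_gamma0 : cols gamma 0 = 0.
Proof. by apply/matrixP => i j; rewrite !mxE gamma0 mxE. Qed.

Lemma clock_rate_ge0 y r : 0 <= clock_rate y r.
Proof.
by rewrite /clock_rate !addr_ge0// sumr_ge0// => i _; rewrite sumr_ge0// => j _; exact: sqr_ge0.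
Qed.

Variables (x0 : 'cV[R]_n) (x : R -> Omega -> 'cV[R]_n) (J : R -> 'I_n -> 'I_q -> Omega -> R).
Hypothesis xad : adapted_cV F x.
Hypothesis xcont : continuous_paths P x.
Hypothesis xdrift : {ae P, forall omega, forall t : R, 0 <= t -> forall i,
  leb.-integrable `[0, t] (fun s => (drift f g u x s omega i 0)%:E)}.
Hypothesis xito : forall t : R, 0 <= t -> forall i j,
  is_ito_integral P F (fun s omega => w s omega j 0)
    (fun s omega => cols gamma (x s omega) i j) t (J t i j).
Hypothesis xsde : forall t : R, 0 <= t -> {ae P, forall omega, forall i,
  x t omega i 0 = x0 i 0 + (\int[leb]_(s in `[0, t]) drift f g u x s omega i 0)
    + \sum_j J t i j omega}.

(** Regularity is required of the whole path. The exceptional set is negligible,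
    hence belongs to F 0 by completeness. *)
Definition regular omega := [/\ {within `[0, +oo[, continuous (x ^~ omega)},
  forall t : R, 0 <= t -> forall i,
    leb.-integrable `[0, t] (fun s => (drift f g u x s omega i 0)%:E)
  & forall (k : nat) (i : 'I_n) (j : 'I_q), measurable_fun `[0, k%:R : R] (fun s : R => cols gamma (x s omega) i j) /\
      (\int[leb]_(s in `[0%R, k%:R]) (cols gamma (x s omega) i j ^+ 2)%:E < +oo)%E].

Lemma ae_regular : {ae P, forall omega, regular omega}.
Proof.
have h : {ae P, forall omega, forall (k : nat) (i : 'I_n) (j : 'I_q),
    measurable_fun `[0, k%:R : R] (fun s : R => cols gamma (x s omega) i j) /\
    (\int[leb]_(s in `[0%R, k%:R]) (cols gamma (x s omega) i j ^+ 2)%:E < +oo)%E}.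
  apply: ae_foralln => k; apply: filter_forall => i; apply: filter_forall => j.
  by have [_ h _] := xito (ler0n R k) i j.
by apply: filterS3 xcont xdrift h => omega c dd s; split.
Qed.

Definition irregular := ~` [set omega | regular omega].

Lemma irregular_F t : 0 <= t -> F t irregular.
Proof.
move=> t0; have [_ _ mono _ ng] := HF.
by apply: (mono 0 t) => //; apply: ng; exact: ae_regular.
Qed.

Lemma regular_F t : 0 <= t -> F t [set omega | regular omega].
Proof.
move=> t0; have [_ h _] := F_sigma HF t0; rewrite -[X in F t X]setCK -setTD.
exact: h (irregular_F t0).
Qed.

(** On the exceptional set the solution is replaced by the equilibrium 0, where
    all coefficients vanish; the path properties then hold everywhere and
    adaptedness is preserved. *)
Definition xreg r omega : 'cV[R]_n := if `[< regular omega >] then x (Num.max 0 r) omega else 0.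

Lemma xreg_max r omega : xreg (Num.max 0 r) omega = xreg r omega.
Proof. by rewrite /xreg (max_r (y := Num.max 0 r)) ?le_max ?lexx. Qed.

Lemma xreg_regular r omega : regular omega -> 0 <= r -> xreg r omega = x r omega.
Proof. by move=> h r0; rewrite /xreg asboolT// max_r. Qed.

Lemma xreg_irregular r omega : ~ regular omega -> xreg r omega = 0.
Proof. by move=> h; rewrite /xreg asboolF. Qed.

Lemma xreg_continuous i omega : continuous (fun r : R => xreg r omega i 0).
Proof.
rewrite /xreg; case: asboolP => [[c _ _]|_]; last exact: cst_continuous.
exact: continuous_clamped c i.
Qed.

Lemma xreg_adapted i r : 0 <= r -> measG (F r) (fun omega => xreg r omega i 0).
Proof.
move=> r0; have sF := F_sigma HF r0.
have mI : measG (F r) (\1_[set omega | regular omega] : Omega -> R).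
  apply/(measGP sF); apply: measurable_indic.
  have GE : <<s F r >> = F r by exact: sigma_algebra_id.
  by rewrite /measurable/= GE; exact: regular_F.
have -> : (fun omega => xreg r omega i 0) =
    fun omega => \1_[set omega | regular omega] omega * x r omega i 0.
  apply/funext => omega; rewrite /xreg max_r// indicE; case: asboolP => h.
    by rewrite mem_set// mul1r.
  by rewrite memNset// mul0r mxE.
by apply: (measGM sF) => //; exact: xad.
Qed.

Lemma xreg_meas i : measurable_fun setT (fun z : R * Omega => xreg z.1 z.2 i 0).
Proof.
rewrite (_ : (fun _ => _) = fun z : R * Omega => xreg (Num.max 0 z.1) z.2 i 0).
  apply: (caratheodory (y := fun r omega => xreg r omega i 0)).
    by move=> r r0; exact: (measG_measurable HF r0 (xreg_adapted i r0)).
  move=> omega; rewrite (_ : (fun _ => _) = fun r : R => xreg r omega i 0); first exact: xreg_continuous.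
  by apply/funext => r; rewrite xreg_max.
by apply/funext => z; rewrite xreg_max.
Qed.

(** Progressive measurability, by continuity of the paths. *)
Lemma xreg_progressive t i : 0 <= t -> measurable_fun setT
  (fun z : R * g_sigma_algebraType (F t) => xreg (Num.min (Num.max 0 z.1) t) z.2 i 0).
Proof.
move=> t0.
apply: (@caratheodory _ _ (g_sigma_algebraType (F t)) (fun r omega => xreg (Num.min r t) omega i 0)).
  move=> r r0; apply/(measGP (F_sigma HF t0)).
  have h0 : 0 <= Num.min r t by rewrite le_min r0.
  by apply: (measG_mono HF h0 _ (xreg_adapted i h0)); rewrite ge_min lexx orbT.
move=> omega r; apply: (continuous_comp (f := fun r : R => Num.min (Num.max 0 r) t)
  (g := fun r : R => xreg r omega i 0)); last exact: xreg_continuous.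
apply: (continuous_min (f := fun r : R => Num.max 0 r) (g := fun=> t)); last exact: cst_continuous.
by apply: (continuous_max (f := fun=> 0) (g := id)); [exact: cst_continuous|].
Qed.

Lemma itv_tindE (t : R) (h h' : R -> R) : measurable_fun setT h' ->
  (forall r, 0 < r -> r <= t -> h r = h' r) ->
  (\int[leb]_(s in `[0%R, t]) (h s)%:E = \int[leb]_s (tind 0 t s * h' s)%:E)%E.
Proof.
move=> mh' hh'.
have mo : measurable_fun (`]0, t] : set R) (EFin \o h).
  apply: (eq_measurable_fun (EFin \o h')).
    by move=> r; rewrite inE/= in_itv/= => /andP[r0 rt]; rewrite /= hh'.
  by apply: (measurable_funS measurableT) => //; apply/measurable_EFinP.
rewrite -(integral_itv_obnd_cbnd mo) integral_mkcond; apply: eq_integral => r _.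
rewrite patchE tindE; case: ifPn; rewrite ?inE ?notin_setE /= in_itv/=.
  by move=> /andP[r0 rt]; rewrite r0 rt mul1r hh'.
by move=> /negP/negbTE ->; rewrite mul0r.
Qed.

Lemma itv_tind_int1 (t : R) (h h' : R -> R) :
  leb.-integrable (`[0%R, t] : set R) (EFin \o h) ->
  (forall r, 0 < r -> r <= t -> h r = h' r) -> int1 leb (fun r => tind 0 t r * h' r).
Proof.
move=> ih hh'.
have ih' : leb.-integrable (`]0%R, t] : set R) (EFin \o h).
  by apply: integrableS ih => //; apply: subset_itvr; rewrite bnd_simp.
have := proj1 (integrable_mkcond (mu := leb) _ (measurable_itv _)) ih'; rewrite /int1.
suff -> : (EFin \o h) \_ `]0%R, t] = EFin \o (fun r => tind 0 t r * h' r) by [].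
apply/funext => r; rewrite patchE /= tindE; case: ifPn; rewrite ?inE ?notin_setE /= in_itv/=.
  by move=> /andP[r0 rt]; rewrite r0 rt mul1r hh'.
by move=> /negP/negbTE ->; rewrite mul0r.
Qed.

Lemma drift_at_regular omega r : regular omega -> 0 <= r -> drift_at (xreg r omega) r = drift f g u x r omega.
Proof.
by move=> h r0; rewrite /drift_at /drift xreg_regular// /ctrl max_r// cols_control.
Qed.

Lemma clock_rate_path omega : measurable_fun setT (fun r => clock_rate (xreg r omega) r).
Proof. exact: (measurableT_comp (clock_rate_meas xreg_meas) (measurable_pair2 omega)). Qed.

Lemma drift_at_path i omega : measurable_fun setT (fun r => drift_at (xreg r omega) r i 0).
Proof. exact: (measurableT_comp (drift_at_meas xreg_meas i) (measurable_pair2 omega)). Qed.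

Lemma cols_gamma_path i j omega : measurable_fun setT (fun r => cols gamma (xreg r omega) i j).
Proof. exact: (measurableT_comp (cols_gamma_meas xreg_meas i j) (measurable_pair2 omega)). Qed.

Lemma clock_rate_int1 omega t : int1 leb (fun r => tind 0 t r * clock_rate (xreg r omega) r).
Proof.
have [k tk] : exists k : nat, t <= k%:R.
  by exists (Num.bound `|t|); exact: le_trans (ler_norm _) (ltW (archi_boundP (normr_ge0 t))).
apply: (tind_sub_int1 (clock_rate_path omega) (fun r => clock_rate_ge0 _ r) _ (lexx 0) tk).
have [h|h] := pselect (regular omega); last first.
  rewrite (_ : (fun _ => _) = fun=> 0); first exact: int10.
  apply/funext => r; rewrite xreg_irregular// /clock_rate drift_at0 mulmx0 cols_gamma0.
  rewrite !big1 ?addr0 ?mulr0// => i _; rewrite ?mxE ?normr0//.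
  by rewrite big1// => j _; rewrite mxE expr0n.
have [_ hd hg] := h.
have idr i : int1 leb (fun r => tind 0 k%:R r * `|drift_at (xreg r omega) r i 0|).
  have := itv_tind_int1 (hd k%:R (ler0n R k) i) (h' := fun r => drift_at (xreg r omega) r i 0) _.
  move=> /(_ (fun r r0 _ => esym (congr1 (fun y : 'cV[R]_n => y i 0) (drift_at_regular h (ltW r0))))) ih.
  apply: (int1_le _ (int1_norm ih)).
    apply: measurable_funM; first exact: tind_meas.
    by apply: measurableT_comp => //; exact: drift_at_path.
  by move=> r; rewrite !normrM normr_id.
rewrite (_ : (fun _ => _) = fun r => \sum_i tind 0 k%:R r * `|drift_at (xreg r omega) r i 0| +
    \sum_l tind 0 k%:R r * `|(S *m drift_at (xreg r omega) r) l 0| +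
    \sum_i \sum_j tind 0 k%:R r * cols gamma (xreg r omega) i j ^+ 2); last first.
  apply/funext => r; rewrite /clock_rate !mulrDr !mulr_sumr; congr (_ + _).
  by apply: eq_bigr => i _; rewrite mulr_sumr.
apply: int1D; first apply: int1D.
- exact: int1_sum.
- apply: int1_sum => l.
  apply: (@int1_le _ _ _ leb _ (fun r => \sum_i `|S l i| * (tind 0 k%:R r * `|drift_at (xreg r omega) r i 0|))).
  + apply: measurable_funM; first exact: tind_meas.
    apply: measurableT_comp => //.
    rewrite (_ : (fun _ => _) = fun r => \sum_i S l i * drift_at (xreg r omega) r i 0).
      by apply: measurable_sum => i; apply: measurable_funM => //; exact: drift_at_path.
    by apply/funext => z; rewrite mxE.
  + by apply: int1_sum => i; exact: int1Z.
  + move=> r; rewrite normrM normr_id ger0_norm ?tind_ge0// mxE.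
    apply: (le_trans (ler_wpM2l (tind_ge0 _ _ _) (ler_norm_sum _ _ _))).
    rewrite mulr_sumr; apply: ler_sum => i _; rewrite normrM mulrCA//.
- apply: int1_sum => i; apply: int1_sum => j; have [mg ig] := hg k i j.
  apply: (@itv_tind_int1 _ (fun r => cols gamma (x r omega) i j ^+ 2)); last first.
    by move=> r r0 _; rewrite xreg_regular// ltW.
  apply/integrableP; split.
    by apply/measurable_EFinP; exact: measurable_funX.
  apply: le_lt_trans ig; rewrite le_eqVlt; apply/orP; left; apply/eqP.
  by apply: eq_integral => r _; rewrite /= ger0_norm ?sqr_ge0.
Qed.

(** A clock that dominates the variation of the drift, in the coordinates of x
    and of S x, and the energy of the diffusion coefficients. *)
Definition clock t omega : R := \int[leb]_r (tind 0 t r * clock_rate (xreg r omega) r).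

Lemma clock0 omega : clock 0 omega = 0.
Proof.
rewrite /clock (_ : (fun _ => _) = fun=> 0) ?E0//.
by apply/funext => r; rewrite tindE ltNge andNb mul0r.
Qed.

Lemma clock_homo omega : {homo clock ^~ omega : s t / s <= t}.
Proof.
move=> s t st; apply: E_le; try exact: clock_rate_int1.
by move=> r; rewrite ler_wpM2r ?clock_rate_ge0//; exact: tind_le.
Qed.

Lemma clock_continuous omega : continuous (clock ^~ omega).
Proof.
exact: (indefinite_continuous (clock_rate_path omega) (fun r => clock_rate_ge0 _ r) (clock_rate_int1 omega)).
Qed.

Lemma clock_adapted t : 0 <= t -> measG (F t) (clock t).
Proof.
move=> t0; apply/(measGP (F_sigma HF t0)).
pose G (z : R * g_sigma_algebraType (F t)) :=
  tind 0 t z.1 * clock_rate (xreg (Num.min (Num.max 0 z.1) t) z.2) z.1.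
have e omega r : G (r, omega) = tind 0 t r * clock_rate (xreg r omega) r.
  rewrite /G/= tindE; case: (boolP ((0 < r) && (r <= t))) => [/andP[r0 rt]|_]; last by rewrite !mul0r.
  by rewrite (max_r (ltW r0)) (min_l rt).
have mG : measurable_fun setT G.
  apply: measurable_funM; first exact: (measurableT_comp (tind_meas 0 t) measurable_fst).
  exact: (clock_rate_meas (T' := g_sigma_algebraType (F t))
    (Y := fun r omega => xreg (Num.min (Num.max 0 r) t) omega) (fun i => xreg_progressive i t0)).
have -> : (clock t : g_sigma_algebraType (F t) -> R) = fun omega => \int[leb]_r G (r, omega).
  by apply/funext => omega; apply: eqE => r; rewrite e.
apply: (param_int_meas (m1 := leb) mG) => omega.
by rewrite (_ : (fun _ => _) = fun r => tind 0 t r * clock_rate (xreg r omega) r);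
  [exact: clock_rate_int1|apply/funext => r; rewrite e].
Qed.

Lemma clock_max r omega : clock (Num.max 0 r) omega = clock r omega.
Proof.
case: (boolP (0 <= r)) => r0; first by rewrite max_r.
rewrite -ltNge in r0; rewrite max_l ?(ltW r0)//.
apply: eqE => s; rewrite !tindE; congr (_%:R * _).
case: (boolP (0 < s)) => //= s0.
by rewrite !leNgt s0 (lt_trans r0 s0).
Qed.

Lemma clock_meas : measurable_fun setT (fun z : R * Omega => clock z.1 z.2).
Proof.
rewrite (_ : (fun _ => _) = fun z : R * Omega => clock (Num.max 0 z.1) z.2); last first.
  by apply/funext => z; rewrite clock_max.
apply: caratheodory => [r r0|omega].
  exact: (measG_measurable HF r0 (clock_adapted r0)).
rewrite (_ : (fun _ => _) = clock ^~ omega); first exact: clock_continuous.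
by apply/funext => r; rewrite clock_max.
Qed.

Lemma clock_bound_rate (h : R -> R) omega s t : measurable_fun setT h ->
  (forall r, 0 <= h r <= clock_rate (xreg r omega) r) -> 0 <= s -> s <= t ->
  int1 leb (fun r => tind s t r * h r) /\
  \int[leb]_r (tind s t r * h r) <= clock t omega - clock s omega.
Proof.
move=> mh hr s0 st.
have ir := tind_sub_int1 (clock_rate_path omega) (fun r => clock_rate_ge0 _ r) (clock_rate_int1 omega t) s0 (lexx t).
have ih : int1 leb (fun r => tind s t r * h r).
  apply: (int1_le _ ir); first by apply: measurable_funM => //; exact: tind_meas.
  move=> r; have /andP[h0 h1] := hr r.
  by rewrite ger0_norm ?mulr_ge0 ?tind_ge0// ler_wpM2l ?tind_ge0.
split=> //; rewrite /clock -EB; try exact: clock_rate_int1.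
apply: E_le => //; first by apply: int1B; exact: clock_rate_int1.
move=> r; have /andP[h0 h1] := hr r.
by rewrite -mulrBl (tind_add r s0 st) addrAC subrr add0r ler_wpM2l ?tind_ge0.
Qed.

Lemma irregular_meas : measurable irregular.
Proof. by have [_ h _ _ _] := HF; exact: (h 0 (lexx 0) _ (irregular_F (lexx 0))). Qed.

Lemma irregular0 : P irregular = 0%E.
Proof. by apply: measure_negligible; [exact: irregular_meas|exact: ae_regular]. Qed.

Lemma gap_energy_regular (Z : simple_process F) t i j omega : regular omega ->
  gap_energy (fun r omega => cols gamma (xreg r omega) i j) Z t omega =
  fine (\int[leb]_(s in `[0%R, t])
    ((sp_eval Z s omega - cols gamma (x s omega) i j) ^+ 2)%:E)%E.
Proof.
move=> h; rewrite (itv_tindE (h' := fun s => (sp_eval Z s omega - cols gamma (xreg s omega) i j) ^+ 2))//.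
  apply: measurable_funX; apply: measurable_funB; last exact: cols_gamma_path.
  exact: (measurableT_comp (sp_eval_meas HF Z) (measurable_pair2 omega)).
by move=> r r0 _; rewrite xreg_regular// ltW.
Qed.

(** On regular paths the real-valued gap energy is the finite part of the
    extended one, so its large values are controlled up to a null event. *)
Lemma xreg_ito t i j : 0 <= t ->
  ito_lim P F w (fun r omega => cols gamma (xreg r omega) i j) j t (J t i j).
Proof.
move=> t0; have [_ _ [Z [[mgap cgap] [mI cI]]]] := xito t0 i j.
split.
  have -> : J t i j = fun omega => sp_integral (Z 0) (fun s omega => w s omega j 0) t omega -
      (sp_integral (Z 0) (fun s omega => w s omega j 0) t omega - J t i j omega).
    by apply/funext => omega; rewrite subKr.
  apply: measurable_funB; first exact: (SI_sqint HF Hw _ _ t0).1.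
  by apply/measurable_EFinP; exact: mI.
exists Z; split=> e e0; last first.
  exact: (fine_cvg (cI e e0)).
pose Y k omega := (\int[leb]_(s in `[0%R, t])
  ((sp_eval (Z k) s omega - cols gamma (x s omega) i j) ^+ 2)%:E)%E.
apply: (@cvg0_squeeze _ _ (fun k => fine (P [set omega | (e%:E <= `|Y k omega|)%E]))) => [k|];
  last exact: (fine_cvg (cgap e e0)).
rewrite ger0_norm ?fine_ge0//.
set E := [set omega | (e%:E <= `|Y k omega|)%E].
have mE : measurable E.
  have ma : measurable_fun setT (fun y : \bar R => `|y|%E) by exact: abse_measurable.
  have mY := measurableT_comp ma (mgap k).
  have := mY measurableT _ (emeasurable_itv `[e%:E, +oo[); rewrite setTI.
  by congr (measurable _); apply/seteqP; split=> omega /=; rewrite in_itv/= andbT.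
apply: fine_le; rewrite ?fin_num_measure//.
  apply: measurable_ge_norm; apply: (gap_energy_meas HF); exact: cols_gamma_meas xreg_meas i j.
rewrite -(measureU0 mE irregular_meas irregular0); apply: le_measure; rewrite ?inE.
- by apply: measurable_ge_norm; apply: (gap_energy_meas HF); exact: cols_gamma_meas xreg_meas i j.
- by apply: measurableU => //; exact: irregular_meas.
move=> omega /= h; have [go|nb] := pselect (regular omega); last by right.
left; rewrite /E/=; move: h; rewrite gap_energy_regular// -/(Y k omega).
by case: (Y k omega) => [r| |] /= h; rewrite ?leey// lee_fin.
Qed.

Lemma xreg_sde t : 0 <= t -> {ae P, forall omega, forall i,
  xreg t omega i 0 = x0 i 0 + (\int[leb]_s (tind 0 t s * drift_at (xreg s omega) s i 0))
    + \sum_j J t i j omega}.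
Proof.
move=> t0; apply: filterS2 ae_regular (xsde t0) => omega h hx i.
rewrite xreg_regular// hx; congr (_ + _ + _).
rewrite /Rintegral; congr (fine _); apply: itv_tindE; first exact: drift_at_path.
by move=> r r0 _; rewrite drift_at_regular// ltW.
Qed.

Variables lam delta : R.
Hypotheses (lam0 : 0 <= lam) (delta0 : 0 < delta).
Hypothesis lyapS : forall (y : 'cV[R]_n) (c : 'cV[R]_m),
  2 * dotv (S *m y) (S *m (f y + cols g y *m c)) +
  \sum_l \sum_j \sum_j' K j j' * ((S *m cols gamma y) l j * (S *m cols gamma y) l j') <=
  (- lam + enorm c ^+ 2 / delta ^+ 2) * \sum_l (S *m y) l 0 ^+ 2.

Definition rate r := enorm (ctrl r) ^+ 2 / delta ^+ 2.

Lemma enorm_ctrl_meas : measurable_fun setT (fun r => enorm (ctrl r) ^+ 2).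
Proof.
rewrite (_ : (fun _ => _) = fun r => \sum_i ctrl r i 0 ^+ 2).
  by apply: measurable_sum => i; apply: measurable_funX; exact: ctrl_meas.
by apply/funext => r; rewrite enorm_sqr.
Qed.

Lemma rate_meas : measurable_fun setT rate.
Proof. by apply: measurable_funM => //; exact: enorm_ctrl_meas. Qed.

Lemma rate_ge0 r : 0 <= rate r.
Proof. by rewrite divr_ge0 ?sqr_ge0. Qed.

Lemma energy_le T : 0 <= T ->
  (\int[leb]_r (tind 0 T r * enorm (ctrl r) ^+ 2)%:E <= L2normsq v)%E.
Proof.
move=> T0; rewrite -(itv_tindE (h := fun r => enorm (ctrl r) ^+ 2) enorm_ctrl_meas)//.
rewrite (_ : L2normsq v = \int[leb]_(t in `[0%R, +oo[) (enorm (ctrl t) ^+ 2)%:E)%E; last first.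
  by apply: eq_integral => r; rewrite inE/= in_itv/= andbT => r0; rewrite /ctrl max_r.
apply: ge0_subset_integral => //.
- by apply: (measurable_funS measurableT) => //; apply/measurable_EFinP; exact: enorm_ctrl_meas.
- by move=> r _; rewrite lee_fin sqr_ge0.
- by apply: subset_itvl; rewrite bnd_simp.
Qed.

Lemma energy_int1 T : int1 leb (fun r => tind 0 T r * enorm (ctrl r) ^+ 2).
Proof.
have [T0|T0] := leP 0 T; last first.
  rewrite (_ : (fun _ => _) = fun=> 0); first exact: int10.
  apply/funext => r; rewrite tindE; case: (boolP (_ && _)) => [/andP[r0 rT]|_]; last by rewrite mul0r.
  by move: (lt_trans (lt_le_trans r0 rT) T0); rewrite ltxx.
apply/integrableP; split.
  apply/measurable_EFinP; apply: measurable_funM; [exact: tind_meas|exact: enorm_ctrl_meas].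
apply: le_lt_trans Hv; apply: le_trans (energy_le T0).
rewrite le_eqVlt; apply/orP; left; apply/eqP; apply: eq_integral => r _ /=.
by rewrite ger0_norm// tind_sqr_ge0.
Qed.

Lemma rate_int1 T : int1 leb (fun r => tind 0 T r * rate r).
Proof.
rewrite (_ : (fun _ => _) = fun r => (delta ^+ 2)^-1 * (tind 0 T r * enorm (ctrl r) ^+ 2)).
  by apply: int1Z; exact: energy_int1.
by apply/funext => r; rewrite /rate; ring.
Qed.

Lemma rate_bound T : 0 <= T -> \int[leb]_r (tind 0 T r * rate r) <= (L2norm v / delta) ^+ 2.
Proof.
move=> T0; rewrite (_ : \int[leb]_r _ = (delta ^+ 2)^-1 * \int[leb]_r (tind 0 T r * enorm (ctrl r) ^+ 2)).
  have n0 : (0 <= L2normsq v)%E by apply: integral_ge0 => r _; rewrite lee_fin sqr_ge0.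
  rewrite expr_div_n mulrC ler_wpM2r ?invr_ge0 ?sqr_ge0//.
  rewrite /L2norm sqr_sqrtr ?fine_ge0// -lee_fin -(E_fin (energy_int1 T)) fineK ?energy_le//.
  by rewrite ge0_fin_numE.
rewrite -(EZ _ (energy_int1 T)); apply: eqE => r; rewrite /rate; ring.
Qed.

Lemma reduced_decay T : 0 <= T ->
  (\int[P]_omega (\sum_l (S *m x T omega) l 0 ^+ 2)%:E <=
   ((\sum_l (S *m x0) l 0 ^+ 2) * (expR ((L2norm v / delta) ^+ 2) * expR (- lam * T)))%:E)%E.
Proof.
move=> T0.
have mS (Y : Omega -> 'cV[R]_n) : (forall i, measurable_fun setT (fun omega => Y omega i 0)) ->
    measurable_fun setT (fun omega => (\sum_l (S *m Y omega) l 0 ^+ 2)%:E : \bar R).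
  move=> mY; apply/measurable_EFinP; apply: measurable_sum => l; apply: measurable_funX.
  rewrite (_ : (fun _ => _) = fun omega => \sum_i S l i * Y omega i 0).
    by apply: measurable_sum => i; apply: measurable_funM.
  by apply/funext => omega; rewrite mxE.
rewrite (@ae_eq_integral _ _ _ P setT (fun omega => (\sum_l (S *m xreg T omega) l 0 ^+ 2)%:E)) //; last 3 first.
- by apply: mS => i; exact: (measG_measurable HF T0 (xad i T0)).
- by apply: mS => i; exact: (measG_measurable HF T0 (xreg_adapted i T0)).
- by apply: filterS ae_regular => omega h _; rewrite xreg_regular.
have sdr l omega : measurable_fun setT (fun r => `|(S *m drift_at (xreg r omega) r) l 0|).
  apply: measurableT_comp => //.
  rewrite (_ : (fun _ => _) = fun r => \sum_i S l i * drift_at (xreg r omega) r i 0).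
    by apply: measurable_sum => i; apply: measurable_funM => //; exact: drift_at_path.
  by apply/funext => z; rewrite mxE.
have s1 : forall y r, 0 <= \sum_i `|drift_at y r i 0| by move=> y r; exact: sumr_ge0.
have s2 : forall y r, 0 <= \sum_l `|(S *m drift_at y r) l 0| by move=> y r; exact: sumr_ge0.
have s3' : forall y i, 0 <= \sum_j cols gamma y i j ^+ 2.
  by move=> y i; apply: sumr_ge0 => j _; exact: sqr_ge0.
have s3 : forall y, 0 <= \sum_i \sum_j cols gamma y i j ^+ 2 by move=> y; apply: sumr_ge0.
apply: (@le_trans _ _ ((\sum_l (S *m x0) l 0 ^+ 2) *
    expR (\int[leb]_r (tind 0 T r * rate r) - lam * T))%:E); last first.
  rewrite lee_fin ler_wpM2l//; first by apply: sumr_ge0 => l _; exact: sqr_ge0.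
  by rewrite mulNr expRD ler_wpM2r ?expR_ge0// ler_expR rate_bound.
apply: (lyapunov_decay HF Hw (x := xreg) (D := fun r omega => drift_at (xreg r omega) r)
  (Gam := fun r omega => cols gamma (xreg r omega)) (J := J) (z0 := x0) (S := S) xreg_meas xreg_adapted
  (drift_at_meas xreg_meas) _ (cols_gamma_meas xreg_meas) clock0 clock_homo clock_continuous clock_adapted clock_meas
  _ _ _ (fun r r0 i j => xreg_ito i j r0) xreg_sde rate_meas rate_ge0 lam0 rate_int1 _ T0).
- move=> i r r0; apply/(measGP (F_sigma HF r0)).
  have m1 : forall i, measurable_fun setT (fun z : R * g_sigma_algebraType (F r) => xreg (Num.min (Num.max 0 z.1) r) z.2 i 0).
    by move=> k; exact: xreg_progressive.
  have := measurableT_comp (drift_at_meas (T' := g_sigma_algebraType (F r))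
    (Y := fun s omega => xreg (Num.min (Num.max 0 s) r) omega) m1 i) (measurable_pair1 r).
  by congr measurable_fun; apply/funext => omega /=; rewrite (max_r r0) (min_l (lexx r)).
- move=> i omega s t s0 st; apply: clock_bound_rate => //.
    by apply: measurableT_comp => //; exact: drift_at_path.
  move=> r; rewrite normr_ge0/= /clock_rate (bigD1 i)//= -!addrA lerDl !addr_ge0//.
  exact: sumr_ge0.
- move=> l omega s t s0 st; apply: clock_bound_rate => // r.
  rewrite normr_ge0/= /clock_rate addrAC (bigD1 l (F := fun l => `|(S *m _) l 0|))//= addrA addrAC.
  by rewrite -[leLHS]add0r lerD// addr_ge0// ?sumr_ge0// addr_ge0.
- move=> i j omega s t s0 st; apply: clock_bound_rate => //.
    by apply: measurable_funX; exact: cols_gamma_path.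
  move=> r; rewrite sqr_ge0/= /clock_rate.
  apply: (@le_trans _ _ (\sum_i \sum_j cols gamma (xreg r omega) i j ^+ 2)); last first.
    by rewrite lerDr addr_ge0.
  rewrite (bigD1 i)//= (bigD1 j)//= -addrA lerDl addr_ge0//.
    by apply: sumr_ge0 => k _; exact: sqr_ge0.
  exact: sumr_ge0.
- move=> r omega r0; have := lyapS (xreg r omega) (ctrl r); rewrite dotvE.
  by [].
Qed.

End reduction.

(** * Exponential decay of the second moment *)

Unset Implicit Arguments.
Theorem theorem3p5 (R : realType) (d : measure_display)
    (Omega : measurableType d) (P : probability Omega R)
    (F : R -> set (set Omega)) (n m q : nat)
    (K : 'M[R]_q) (w : R -> Omega -> 'cV[R]_q)
    (f : 'cV[R]_n -> 'cV[R]_n)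
    (g : 'I_m -> 'cV[R]_n -> 'cV[R]_n)
    (gamma : 'I_q -> 'cV[R]_n -> 'cV[R]_n)
    (X : 'M[R]_n) (lambda delta : R)
    (HF : usual_filtration P F)
    (Hw : wiener_process P F K w)
    (Hf : borel_fun f) (Hg : forall i, borel_fun (g i))
    (Hgamma : forall j, borel_fun (gamma j))
    (f0 : f 0 = 0) (g0 : forall i, g i 0 = 0) (gamma0 : forall j, gamma j 0 = 0)
    (Hgcst : forall i,
       (forall x, g i x = 0) \/ ~ (exists c, forall x, g i x = c))
    (HX : posdef X) (Hlambda : 0 < lambda) (Hdelta : 0 < delta)
    (HLV : forall x : 'cV[R]_n,
       LV f g gamma K X x 0 delta <= - lambda * quadV X x) :
  exists k : R, 0 < k /\
    forall u : R -> Omega -> 'cV[R]_m,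
      admissible_control P F u ->
      unique_global_solution P F f g gamma w u ->
    forall v : R -> 'cV[R]_m,
      (forall t omega, 0 <= t -> mult_control g u t omega = v t) ->
      (L2normsq v < +oo)%E ->
    forall (x0 : 'cV[R]_n) (x : R -> Omega -> 'cV[R]_n),
      sde_solution P F f g gamma w u x0 x ->
    forall t : R, 0 <= t ->
      ('E_P[fun omega => (enorm (x t omega) ^+ 2)%R]
        <= (k * expR ((L2norm v / delta) ^+ 2) * enorm x0 ^+ 2
              * expR (- lambda * t))%:E)%E.
Proof.
have HK : possemidef K by case: Hw.
have bound := drift_bound HK HX f0 g0 gamma0 Hdelta HLV.
pose S := msqrt X.
exists (frobenius S ^+ 2 * frobenius (invmx S) ^+ 2 + 1); split.
  by rewrite ltr_wpDl// mulr_ge0// sqr_ge0.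
move=> u Hu _ v Huv Hv x0 x [xad xcont xdrift [J [xito xsde]]] t t0.
have lyapS (y : 'cV[R]_n) (c : 'cV[R]_m) :
  2 * dotv (S *m y) (S *m (f y + cols g y *m c)) +
  \sum_l \sum_j \sum_j' K j j' * ((S *m cols gamma y) l j * (S *m cols gamma y) l j') <=
  (- lambda + enorm c ^+ 2 / delta ^+ 2) * \sum_l (S *m y) l 0 ^+ 2.
  by rewrite -(quadV_sqrt HX); exact: bound.
have decay := reduced_decay HF Hw Hf Hg Hgamma f0 g0 gamma0 Hu Huv Hv xad xcont xdrift
  xito xsde (ltW Hlambda) lyapS t0.
have mx i : measurable_fun setT (fun omega => x t omega i 0).
  exact: (measG_measurable HF t0 (xad i t t0)).
have mV : measurable_fun setT (fun omega => (\sum_l (S *m x t omega) l 0 ^+ 2)%:E : \bar R).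
  apply/measurable_EFinP; apply: measurable_sum => l; apply: measurable_funX.
  rewrite (_ : (fun _ => _) = fun omega => \sum_i S l i * x t omega i 0).
    by apply: measurable_sum => i; apply: measurable_funM.
  by apply/funext => omega; rewrite mxE.
have V0 omega : (0 <= (\sum_l (S *m x t omega) l 0 ^+ 2)%:E)%E.
  by rewrite lee_fin sumr_ge0// => l _; exact: sqr_ge0.
rewrite unlock.
apply: (@le_trans _ _ (\int[P]_omega ((frobenius (invmx S) ^+ 2)%:E *
    (\sum_l (S *m x t omega) l 0 ^+ 2)%:E))%E).
  apply: ge0_le_integral => //.
  - by move=> omega _; rewrite lee_fin sqr_ge0.
  - apply/measurable_EFinP; rewrite (_ : (fun _ => _) = fun omega => \sum_i x t omega i 0 ^+ 2).
      by apply: measurable_sum => i; exact: measurable_funX.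
    by apply/funext => omega; rewrite enorm_sqr.
  - exact: measurable_funeM.
  - by move=> omega _; rewrite -EFinM lee_fin -(quadV_sqrt HX) enorm_le.
rewrite ge0_integralZl_EFin//; last exact: sqr_ge0.
have h0 : (0 <= (frobenius (invmx S) ^+ 2)%:E)%E by rewrite lee_fin sqr_ge0.
apply: (le_trans (lee_wpmul2l h0 decay)).
rewrite -EFinM lee_fin -(quadV_sqrt HX).
set E := expR _; set E' := expR _; set fi := frobenius _ ^+ 2; set fs := frobenius _ ^+ 2.
have E0 : 0 <= E by exact: expR_ge0.
have E0' : 0 <= E' by exact: expR_ge0.
have fi0 : 0 <= fi by exact: sqr_ge0.
have h := quadV_le HX x0; rewrite -/S -/fs in h.
have n0 : 0 <= enorm x0 ^+ 2 by exact: sqr_ge0.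
rewrite (_ : (fs * fi + 1) * E * enorm x0 ^+ 2 * E' =
  fi * (fs * enorm x0 ^+ 2 * (E * E')) + enorm x0 ^+ 2 * (E * E')); last by ring.
have EE : 0 <= E * E' by exact: mulr_ge0.
rewrite -[leLHS]addr0 lerD//; last exact: mulr_ge0.
by rewrite ler_wpM2l// ler_wpM2r.
Qed.
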